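(* Let $k\ge 2$ be an integer. For $n \ge 0$ and $t\ge 0$ set $r_n(t) := \tau[(W_t^k/k^2)^n]$ (so $r_0(t)=1$), where $W_t^k = G_t^k (G_t^k)^{\star}$ and $G_t^k = U_t^1+\dots+U_t^k$. Then for any $n \geq 1$ and $t>0$, $$\partial_t r_n(t) = -n r_n(t) + \frac{n}{k} r_{n-1}(t) + \frac{n}{k}\sum_{j=0}^{n-2} r_{n-j-1}(t)\,[r_j(t) - r_{j+1}(t)],$$ where an empty sum is zero.
   Context: $(\mathscr{A},\tau)$ is a tracial non commutative probability space (a von Neumann algebra with faithful normal tracial state $\tau$). A free unitary Brownian motion is the solution of the free stochastic differential equation $dU_t = iU_t\,dX_t - \frac{1}{2}U_t\,dt$, $U_0 = {\bf 1}$, where $(X_t)_{t \ge 0}$ is a free additive Brownian motion. $(U_t^j)_{t\ge0}$, $1\le j\le k$, are $k$ $\star$-free copies of the free unitary Brownian motion in $(\mathscr{A},\tau)$, driven by $k$ free additive Brownian motions $(X_t^j)_{t\ge 0}$ which are free from one another. *)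

(* Defs.v *)
From HB Require Import structures.
From mathcomp Require Import all_boot all_order all_algebra.
From mathcomp Require Import complex.
From mathcomp Require Import all_classical all_reals all_analysis.
Set Implicit Arguments.
Unset Strict Implicit.
Unset Printing Implicit Defensive.
Import Order.TTheory GRing.Theory Num.Theory.
Import numFieldTopology.Exports numFieldNormedType.Exports.
Local Open Scope classical_set_scope.
Local Open Scope ring_scope.

Section HilbertSpace.
Variable R : realType.

Definition dot_norm (H : lmodType R[i]) (dot : {dot H for @conjc R}) (x : H) : R :=
  Num.sqrt (complex.Re (dot x x)).

(* The inner product is linear in its first variable and antilinear in its
   second one. *)
Record hilbertSpace := HilbertSpace {
  hcarrier :> lmodType R[i];
  hdot : {dot hcarrier for @conjc R};
  hcomplete : forall u : nat -> hcarrier,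
    (forall e : R, 0 < e -> exists N : nat, forall m n : nat,
       (N <= m)%N -> (N <= n)%N -> dot_norm hdot (u m - u n) < e) ->
    exists l : hcarrier, dot_norm hdot (u n - l) @[n --> \oo] --> (0 : R) }.

Definition hnorm (H : hilbertSpace) (x : H) : R := dot_norm (hdot H) x.

Definition bounded_operator (H : hilbertSpace) (T : H -> H) : Prop :=
  linear T /\ exists c : R, forall x, hnorm (T x) <= c * hnorm x.

Definition commutant (H : hilbertSpace) (B : set (H -> H)) : set (H -> H) :=
  [set T | bounded_operator T /\ forall S, B S -> T \o S = S \o T].

End HilbertSpace.

(* A von Neumann algebra: a unital *-algebra identified, through its faithful
   action on a Hilbert space, with a *-algebra of bounded operators that is
   equal to its bicommutant. *)
Record vonNeumannAlgebra (R : realType) := VonNeumannAlgebra {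
  vnalg :> algType R[i];
  adj : vnalg -> vnalg;
  hspace : hilbertSpace R;
  act : vnalg -> hspace -> hspace;
  act_bounded : forall a, bounded_operator (act a);
  act_linear : forall (c : R[i]) a b x, act (c *: a + b) x = c *: act a x + act b x;
  act_one : forall x, act 1 x = x;
  act_mul : forall a b x, act (a * b) x = act a (act b x);
  act_adj : forall a x y, hdot hspace (act a x) y = hdot hspace x (act (adj a) y);
  act_inj : injective act;
  act_bicommutant : commutant (commutant (range act)) = range act }.
Arguments adj {R v} _.
Arguments act {R v} _ _.

Section VonNeumann.
Variables (R : realType) (A : vonNeumannAlgebra R).

Definition opnorm (a : A) : R :=
  sup [set hnorm (act a x) | x in [set x : hspace A | hnorm x <= 1]].

Definition vN_generated (S : set A) : set A :=
  [set a | commutant (commutant (act @` (S `|` adj @` S))) (act a)].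

(* Normal means sigma-weakly continuous, i.e. belonging to the predual: a
   functional a |-> sum_n <a xi_n, eta_n> with square-summable (xi_n), (eta_n). *)
Definition normal_functional (f : A -> R[i]) : Prop :=
  exists xi eta : nat -> hspace A,
    [/\ cvgn (series (fun n => hnorm (xi n) ^+ 2)),
        cvgn (series (fun n => hnorm (eta n) ^+ 2)) &
        forall a, Normc.normc (f a - \sum_(n < N) hdot (hspace A) (act a (xi n)) (eta n))
          @[N --> \oo] --> (0 : R)].

Definition star_subalgebra (M : set A) : Prop :=
  [/\ M 1,
      forall (c : R[i]) a b, M a -> M b -> M (c *: a + b),
      forall a b, M a -> M b -> M (a * b) &
      forall a, M a -> M (adj a)].

Definition star_generated (S : set A) : set A := smallest star_subalgebra S.

End VonNeumann.

Record tracialSpace (R : realType) := TracialSpace {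
  tvn :> vonNeumannAlgebra R;
  tau : {scalar tvn};
  tau1 : tau 1 = 1;
  tau_ge0 : forall a, 0 <= tau (adj a * a);
  tau_faithful : forall a, tau (adj a * a) = 0 -> a = 0;
  tauC : forall a b, tau (a * b) = tau (b * a);
  tau_normal : normal_functional tau }.
Arguments tau {R t}.

Section FreeStochasticCalculus.
Variables (R : realType) (A : tracialSpace R).

Definition norm2 (a : A) : R := Num.sqrt (complex.Re (tau (adj a * a))).

(* Freeness of the unital *-algebras generated by the sets S i. *)
Definition star_free (I : Type) (S : I -> set A) : Prop :=
  forall (n : nat) (i : nat -> I) (a : nat -> A),
    (forall j, (j <= n)%N -> star_generated (S (i j)) (a j) /\ tau (a j) = 0) ->
    (forall j, (j < n)%N -> i j <> i j.+1) ->
    tau (\prod_(0 <= j < n.+1) a j) = 0.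

(* Self-adjoint, with distribution the centred semicircle law of variance v. *)
Definition semicircular (v : R) (x : A) : Prop :=
  adj x = x /\
  forall n : nat, tau (x ^+ n) =
    (\int[lebesgue_measure]_(s in `[- (2 * Num.sqrt v), 2 * Num.sqrt v])
        (s ^+ n * (Num.sqrt (4 * v - s ^+ 2) / (2 * pi * v))))%:C%C.

Definition natural_filtration (X : R -> A) (t : R) : set A :=
  vN_generated (X @` [set s | 0 <= s <= t]).

Definition free_additive_BM (X : R -> A) : Prop :=
  [/\ X 0 = 0,
      forall t, 0 <= t -> adj (X t) = X t,
      forall s t, 0 <= s < t -> semicircular (t - s) (X t - X s) &
      forall s t, 0 <= s < t ->
        star_free (fun b : bool =>
          if b then [set X t - X s] else natural_filtration X s)].

(* The step process with value a i on [u i, u i.+1[ for i < m, and 0 elsewhere. *)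
Definition step_process (m : nat) (u : nat -> R) (a : nat -> A) (s : R) : A :=
  \sum_(i < m | s \in `[u i, u i.+1[%R) a i.

Definition simple_adapted (F : R -> set A) (t : R)
    (m : nat) (u : nat -> R) (a : nat -> A) : Prop :=
  [/\ 0 <= u 0%N, u m <= t,
      forall i, (i < m)%N -> u i <= u i.+1 &
      forall i, (i < m)%N -> F (u i) (a i)].

Definition step_stochastic_integral (X : R -> A)
    (m : nat) (u : nat -> R) (a : nat -> A) : A :=
  \sum_(i < m) a i * (X (u i.+1) - X (u i)).

(* J is the free stochastic integral of Y_s dX_s over [0, t]: the extension, by
   the isometry from L^2([0, t]; L^2(tau)) to L^2(tau), of its value on simple
   adapted processes. *)
Definition is_stochastic_integral (X Y : R -> A) (t : R) (J : A) : Prop :=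
  exists (m : nat -> nat) (u : nat -> nat -> R) (a : nat -> nat -> A),
    [/\ forall n, simple_adapted (natural_filtration X) t (m n) (u n) (a n),
        (\int[lebesgue_measure]_(s in `[0%R, t])
           (norm2 (Y s - step_process (m n) (u n) (a n) s)%R ^+ 2)%:E)%E
          @[n --> \oo] --> (0%:E : \bar R) &
        norm2 (J - step_stochastic_integral X (m n) (u n) (a n))
          @[n --> \oo] --> (0 : R)].

(* K is the integral of Y_s ds over [0, t], characterised by its matrix
   coefficients <K x, y>. *)
Definition is_time_integral (Y : R -> A) (t : R) (K : A) : Prop :=
  forall x y : hspace A,
    hdot (hspace A) (act K x) y =
    Complex
      (\int[lebesgue_measure]_(s in `[0, t])
          complex.Re (hdot (hspace A) (act (Y s) x) y))
      (\int[lebesgue_measure]_(s in `[0, t])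
          complex.Im (hdot (hspace A) (act (Y s) x) y)).

(* U is a norm-continuous adapted solution of dU = i U dX - (1/2) U dt, U_0 = 1,
   in integrated form.  Unitarity is a consequence, not part of the definition. *)
Definition free_unitary_BM (X U : R -> A) : Prop :=
  [/\ U 0 = 1,
      forall t, 0 <= t -> natural_filtration X t (U t),
      forall t, 0 <= t ->
        opnorm (U s - U t) @[s --> within [set s | 0 <= s] (nbhs t)] --> (0 : R) &
      forall t, 0 <= t -> exists J K : A,
        [/\ is_stochastic_integral X U t J,
            is_time_integral U t K &
            U t = 1 + ('i%C : R[i]) *: J - (2^-1 : R[i]) *: K]].

Definition Gsum (k : nat) (U : 'I_k -> R -> A) (t : R) : A := \sum_(j < k) U j t.

Definition Wprod (k : nat) (U : 'I_k -> R -> A) (t : R) : A :=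
  Gsum U t * adj (Gsum U t).

Definition moment (k : nat) (U : 'I_k -> R -> A) (n : nat) (t : R) : R[i] :=
  tau (((k%:R ^+ 2)^-1 *: Wprod U t) ^+ n).

End FreeStochasticCalculus.

(* Derivative of a complex-valued function of a real variable. *)
Definition is_complex_derive (R : realType) (f : R -> R[i]) (t : R) (l : R[i]) : Prop :=
  is_derive t 1 (fun s => complex.Re (f s)) (complex.Re l) /\
  is_derive t 1 (fun s => complex.Im (f s)) (complex.Im l).

(* Main.v *)
(* Over a short interval [s, s'], every U^j has an expansion
   U_s' - U_s = i U_s (X_s' - X_s) - (s' - s) U_s / 2 + error, where the error is
   o((s' - s)^(1/2)) in the L^2 norm and o(s' - s) when tested against the past.
   Processes with such expansions are closed under products, by the free Ito rule
   dX a dX = tau(a) dt; this gives U U^* = 1 and differential equations for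
   tau(U^n) that determine these moments, hence the law of U^j is the same for
   all j.

   For words in several U^j only the freeness of the family (U^j) is used: by
   linearity and centering every word reduces to alternating words of centered
   letters, on which both the trace and the formal Ito drift vanish. So the trace
   of a word is differentiated by the Ito rule dX^i a dX^j = [i = j] tau(a) dt.
   Applied to W^n, W = G G^*, this produces traces of words containing a single U_j
   or U_j^* besides G and G^*; by freeness and equality of laws, exchanging two
   indices shows tau(G^* W^b U_j) = tau(W^(b+1)) / k, which closes the equation. *)
From HB Require Import structures.
Require Import Defs.
From mathcomp Require Import all_boot all_order all_algebra.
From mathcomp Require Import perm complex.
From mathcomp Require Import all_classical all_reals all_analysis.
From mathcomp Require Import measurable_realfun zify ring lra.
Set Implicit Arguments.
Unset Strict Implicit.
Unset Printing Implicit Defensive.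
Import Order.TTheory GRing.Theory Num.Theory.
Import numFieldTopology.Exports numFieldNormedType.Exports.
Local Open Scope classical_set_scope.
Local Open Scope ring_scope.

(** * Operator norm and trace norm *)

(** The analysis handles one process at a time: the expansion of U^j is controlled only against the
    past of its own X^j, and no filtration common to all the X^j is set up. Two sizes of error are
    needed because a product of two increments, of order h = s' - s, must be kept: an L^2 error
    o(h^(1/2)) makes the cross terms o(h), while a trace is differentiable only if the error is o(h)
    once tested. Testing against every element of the past, and not only against 1, makes the class
    stable under products. Words mixing several indices therefore carry a formal drift, defined on
    records by the Ito product rule and compared with a derivative only under the trace. Both
    quantities follow the same rules when neighbours are merged or a letter is split into its
    centered part and its mean. Combining L^2 and operator bounds rests on ||ab||_2 <= ||a||
    ||b||_2, which is extracted from the normality of tau. The single sum of the conclusion is a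
    double sum over pairs of factors of the cyclic word W^n, folded by its symmetry. *)

Notation cnorm := Normc.normc.

Section ComplexModulus.
Variable R : realType.
Implicit Types z w : R[i].

Lemma cnormE z : `|z| = (cnorm z)%:C%C.
Proof. by case: z => a b; rewrite normc_def. Qed.

Lemma cnormM z w : cnorm (z * w) = cnorm z * cnorm w.
Proof. exact: Normc.normcM. Qed.

Lemma cnormD z w : cnorm (z + w) <= cnorm z + cnorm w.
Proof. exact: le_normcD. Qed.

Lemma cnormN z : cnorm (- z) = cnorm z.
Proof. exact: normcN. Qed.

Lemma cnormB z w : cnorm (z - w) <= cnorm z + cnorm w.
Proof. by rewrite -(cnormN w); exact: cnormD. Qed.

Lemma cnorm0 : cnorm (0 : R[i]) = 0.
Proof. exact: Normc.normc0. Qed.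

Lemma cnorm_ge0 z : 0 <= cnorm z.
Proof. by case: z => a b; rewrite sqrtr_ge0. Qed.

Lemma cnorm_sqr z : cnorm z ^+ 2 = complex.Re z ^+ 2 + complex.Im z ^+ 2.
Proof. by case: z => a b; rewrite sqr_sqrtr ?addr_ge0 ?sqr_ge0. Qed.

Lemma cnorm_conj z : cnorm z^*%C = cnorm z.
Proof. by case: z => a b /=; rewrite sqrrN. Qed.

Lemma cnorm_real (x : R) : cnorm x%:C%C = `|x|.
Proof. by rewrite /= expr0n /= addr0 sqrtr_sqr. Qed.

Lemma cnorm_Re z : `|complex.Re z| <= cnorm z.
Proof.
rewrite -(ler_pXn2r (n := 2)) ?nnegrE ?cnorm_ge0 //.
by rewrite cnorm_sqr real_normK ?num_real // lerDl sqr_ge0.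
Qed.

Lemma cnorm_Im z : `|complex.Im z| <= cnorm z.
Proof.
rewrite -(ler_pXn2r (n := 2)) ?nnegrE ?cnorm_ge0 //.
by rewrite cnorm_sqr real_normK ?num_real // lerDr sqr_ge0.
Qed.

Lemma cnorm_ReIm z : cnorm z <= `|complex.Re z| + `|complex.Im z|.
Proof.
rewrite -(ler_pXn2r (n := 2)) ?nnegrE ?cnorm_ge0 ?addr_ge0 //.
rewrite cnorm_sqr sqrrD !real_normK ?num_real //.
by rewrite addrAC lerDl mulrn_wge0 // mulr_ge0.
Qed.

Lemma mul_conj_cnorm z : z * z^*%C = (cnorm z ^+ 2)%:C%C.
Proof. by rewrite -sqr_normc cnormE rmorphXn. Qed.

Lemma ReD z w : complex.Re (z + w) = complex.Re z + complex.Re w.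
Proof. by case: z; case: w. Qed.

Lemma ImD z w : complex.Im (z + w) = complex.Im z + complex.Im w.
Proof. by case: z; case: w. Qed.

Lemma ReN z : complex.Re (- z) = - complex.Re z.
Proof. by case: z. Qed.

Lemma ImN z : complex.Im (- z) = - complex.Im z.
Proof. by case: z. Qed.

Lemma Re_realM (x : R) z : complex.Re (x%:C%C * z) = x * complex.Re z.
Proof. by case: z => a b /=; rewrite mul0r subr0. Qed.

Lemma Im_realM (x : R) z : complex.Im (x%:C%C * z) = x * complex.Im z.
Proof. by case: z => a b /=; rewrite mul0r addr0. Qed.

Lemma Re_conj z : complex.Re z^*%C = complex.Re z.
Proof. by case: z. Qed.

Lemma ge0_ReC z : 0 <= z -> z = (complex.Re z)%:C%C.
Proof. by move=> z0; rewrite RRe_real // ger0_real. Qed.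

Lemma Re_ge0 z : 0 <= z -> 0 <= complex.Re z.
Proof. by move=> z0; rewrite -lecR -ge0_ReC. Qed.

End ComplexModulus.

(** * Cauchy-Schwarz and triangle inequalities for semi-definite Hermitian forms *)

Section SemiInnerProduct.
Variables (R : realType) (V : lmodType R[i]) (f : V -> V -> R[i]).
Hypothesis f_linl : forall a x y z, f (a *: x + y) z = a * f x z + f y z.
Hypothesis f_herm : forall x y, f y x = ((f x y)^*)%C.
Hypothesis f_ge0 : forall x, 0 <= f x x.

Let fn x := Num.sqrt (complex.Re (f x x)).

Lemma form_linr a x y z : f z (a *: x + y) = (a^*)%C * f z x + f z y.
Proof. by rewrite f_herm f_linl rmorphD rmorphM /= -!f_herm. Qed.

Lemma form_sqrD a x y : complex.Re (f (a *: x + y) (a *: x + y)) =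
  cnorm a ^+ 2 * complex.Re (f x x) + complex.Re (f y y)
  + 2 * complex.Re (a * f x y).
Proof.
rewrite f_linl !form_linr !mulrDr mulrA mul_conj_cnorm.
rewrite !ReD Re_realM (f_herm x y) -rmorphM Re_conj.
by rewrite mulr2n mulrDl !mul1r; ring.
Qed.

Lemma form_sqr x : fn x ^+ 2 = complex.Re (f x x).
Proof. by rewrite sqr_sqrtr // Re_ge0. Qed.

(** The form is nonnegative at [y] minus a real multiple [l] of [(f x y)^* x], which gives a
    polynomial in [l]. The form may be degenerate, so [f x x = 0] is a separate case. *)
Lemma form_cauchy_schwarz_sqr x y :
  cnorm (f x y) ^+ 2 <= complex.Re (f x x) * complex.Re (f y y).
Proof.
have key (l : R) : 0 <= l ^+ 2 * cnorm (f x y) ^+ 2 * complex.Re (f x x)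
    + complex.Re (f y y) - 2 * l * cnorm (f x y) ^+ 2.
  have := f_ge0 ((- (l%:C)%C * ((f x y)^*)%C) *: x + y).
  move=> /Re_ge0; rewrite form_sqrD cnormM cnormN cnorm_real cnorm_conj.
  rewrite !mulNr -mulrA (mulrC _ (f x y)) mulrCA mul_conj_cnorm ReN Re_realM /=.
  by rewrite exprMn real_normK ?num_real // mulrN !mulrA.
have x0 := Re_ge0 (f_ge0 x); have y0 := Re_ge0 (f_ge0 y).
set c := cnorm (f x y) ^+ 2 in key *; have c0 : 0 <= c by exact: sqr_ge0.
set p := complex.Re _ in key x0 *; set q := complex.Re (f y y) in key y0 *.
have [p0|p0] := eqVneq p 0.
  rewrite p0 mul0r leNgt; apply/negP => cp.
  (* For [p = 0] the polynomial is affine in [l], and this [l] gives it the value [- q - 2]. *)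
  have := key ((q + 1) / c); rewrite p0 mulr0 add0r.
  have -> : 2 * ((q + 1) / c) * c = 2 * (q + 1) by field; lra.
  lra.
have pp : 0 < p by rewrite lt_neqAle eq_sym p0.
(* [l = 1 / p] minimises the quadratic polynomial. *)
have := key p^-1.
have -> : p^-1 ^+ 2 * c * p + q - 2 * p^-1 * c = (q * p - c) / p by field.
by rewrite pmulr_lge0 ?invr_gt0 // subr_ge0 mulrC.
Qed.

Lemma form_cauchy_schwarz x y : cnorm (f x y) <= fn x * fn y.
Proof.
rewrite -(ler_pXn2r (n := 2)) ?nnegrE ?cnorm_ge0 ?mulr_ge0 ?sqrtr_ge0 //.
by rewrite exprMn !form_sqr form_cauchy_schwarz_sqr.
Qed.

Lemma form_normD x y : fn (x + y) <= fn x + fn y.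
Proof.
rewrite -(ler_pXn2r (n := 2)) ?nnegrE ?addr_ge0 ?sqrtr_ge0 //.
have := form_sqrD 1 x y; rewrite scale1r mul1r (Normc.normc1 R) expr1n mul1r.
rewrite sqrrD !form_sqr => ->; rewrite addrAC lerD2r lerD2l -[leRHS]mulr_natl.
rewrite ler_pM2l // (le_trans (ler_norm _)) // (le_trans (cnorm_Re _)) //.
exact: form_cauchy_schwarz.
Qed.

Lemma form_normZ a x : fn (a *: x) = cnorm a * fn x.
Proof.
rewrite /fn -[a *: x]addr0 form_sqrD.
have f0 z : f 0 z = 0.
  by have := f_linl 1 0 0 z; rewrite scale1r addr0 mul1r => /(canLR (addKr _)); rewrite addNr.
have -> : f x 0 = 0 by rewrite f_herm f0 conjc0.
rewrite f0 mulr0 /= mulr0 !addr0 sqrtrM ?sqr_ge0 // sqrtr_sqr ger0_norm //.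
exact: cnorm_ge0.
Qed.

End SemiInnerProduct.

Section HilbertNorm.
Variables (R : realType) (H : hilbertSpace R).
Implicit Types x y z : H.
Local Notation dot := (hdot H).

Lemma hdot_linl a x y z : dot (a *: x + y) z = a * dot x z + dot y z.
Proof. by rewrite linearPl. Qed.

Lemma hdot_herm x y : dot y x = ((dot x y)^*)%C.
Proof. by rewrite hermC expr0 mul1r. Qed.

Lemma hdot_ge0 x : 0 <= dot x x.
Proof.
have [->|x0] := eqVneq x 0; first by rewrite linear0r.
exact/ltW/neq0_dnorm_gt0.
Qed.

Lemma hnorm_ge0 x : 0 <= hnorm x. Proof. exact: sqrtr_ge0. Qed.

Lemma hnorm_sqr x : hnorm x ^+ 2 = complex.Re (dot x x).
Proof. by rewrite sqr_sqrtr // Re_ge0 // hdot_ge0. Qed.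

Lemma hdot_cauchy_schwarz x y : cnorm (dot x y) <= hnorm x * hnorm y.
Proof. exact: (form_cauchy_schwarz hdot_linl hdot_herm hdot_ge0). Qed.

Lemma hnormD x y : hnorm (x + y) <= hnorm x + hnorm y.
Proof. exact: (form_normD hdot_linl hdot_herm hdot_ge0). Qed.

Lemma hnormZ a x : hnorm (a *: x) = cnorm a * hnorm x.
Proof. exact: (form_normZ hdot_linl hdot_herm). Qed.

Lemma hnorm0 : hnorm (0 : H) = 0.
Proof. by rewrite -(scale0r 0) hnormZ cnorm0 mul0r. Qed.

Lemma hnorm_eq0 x : hnorm x = 0 -> x = 0.
Proof.
move=> x0; apply/eqP; apply: contraT => xN0.
have := neq0_dnorm_gt0 (s := dot) x xN0.
by rewrite ltcE -hnorm_sqr x0 expr0n /= ltxx andbF.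
Qed.

Lemma hdot_inj x y : (forall z, dot x z = dot y z) -> x = y.
Proof.
move=> xy; apply/eqP; rewrite -subr_eq0; apply/eqP/hnorm_eq0.
by apply/eqP; rewrite -sqrf_eq0 hnorm_sqr linearBl /= xy subrr.
Qed.

End HilbertNorm.

Section OperatorNorm.
Variables (R : realType) (A : vonNeumannAlgebra R).
Implicit Types (a b : A) (x y : hspace A).

(** The adjoint is known only through [act_adj]; its algebraic rules all follow by comparing matrix
    coefficients, since the action is faithful. *)
Lemma act_inj_dot a b :
  (forall x y, hdot (hspace A) (act a x) y = hdot (hspace A) (act b x) y) ->
  a = b.
Proof.
by move=> ab; apply: act_inj; apply/funext => x; apply: hdot_inj => y.
Qed.

Lemma actD a b x : act (a + b) x = act a x + act b x.
Proof. by have := act_linear 1 a b x; rewrite !scale1r. Qed.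

Lemma act0 x : act (0 : A) x = 0.
Proof. by have /(canLR (addKr _)) := actD 0 0 x; rewrite addr0 addNr. Qed.

Lemma actZ (c : R[i]) a x : act (c *: a) x = c *: act a x.
Proof. by have := act_linear c a 0 x; rewrite !addr0 act0 addr0. Qed.

Lemma actB a b x : act (a - b) x = act a x - act b x.
Proof. by rewrite actD -[- b]scaleN1r actZ scaleN1r. Qed.

Lemma act_lin a (c : R[i]) x y : act a (c *: x + y) = c *: act a x + act a y.
Proof. by have [lin _] := act_bounded a; rewrite lin. Qed.

Lemma actxD a x y : act a (x + y) = act a x + act a y.
Proof. by have := act_lin a 1 x y; rewrite !scale1r. Qed.

Lemma actx0 a : act a 0 = 0.
Proof. by have /(canLR (addKr _)) := actxD a 0 0; rewrite addr0 addNr. Qed.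

Lemma actxZ a (c : R[i]) x : act a (c *: x) = c *: act a x.
Proof. by have := act_lin a c x 0; rewrite actx0 !addr0. Qed.

Lemma act_adjr a x y :
  hdot (hspace A) (act (adj a) x) y = hdot (hspace A) x (act a y).
Proof. by rewrite (hdot_herm y) -act_adj -hdot_herm. Qed.

Lemma adjK : involutive (@adj R A).
Proof. by move=> a; apply: act_inj_dot => x y; rewrite act_adjr act_adj. Qed.

Lemma adjM a b : adj (a * b) = adj b * adj a.
Proof.
by apply: act_inj_dot => x y; rewrite act_adjr !act_mul !act_adjr.
Qed.

Lemma adj_lin (c : R[i]) a b : adj (c *: a + b) = (c^*)%C *: adj a + adj b.
Proof.
apply: act_inj_dot => x y.
rewrite act_adjr !act_linear hdot_linl !act_adjr.
by rewrite (hdot_herm (c *: _ + _)) hdot_linl rmorphD rmorphM /= -!hdot_herm.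
Qed.

Lemma adjD a b : adj (a + b) = adj a + adj b.
Proof. by have := adj_lin 1 a b; rewrite conjc1 !scale1r. Qed.

Lemma adj0 : adj (0 : A) = 0.
Proof. by have /(canLR (addKr _)) := adjD 0 0; rewrite addr0 addNr. Qed.

Lemma adjZ (c : R[i]) a : adj (c *: a) = (c^*)%C *: adj a.
Proof. by have := adj_lin c a 0; rewrite adj0 !addr0. Qed.

Lemma adjN a : adj (- a) = - adj a.
Proof. by apply: (addIr (adj a)); rewrite -adjD !addNr adj0. Qed.

Lemma adj1 : adj (1 : A) = 1.
Proof. by apply: act_inj_dot => x y; rewrite act_adjr !act_one. Qed.

Lemma adj_sum (I : Type) (s : seq I) (P : pred I) (F : I -> A) :
  adj (\sum_(i <- s | P i) F i) = \sum_(i <- s | P i) adj (F i).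
Proof. by apply: (big_morph _ adjD adj0). Qed.

Let ball_image a := [set hnorm (act a x) | x in [set x : hspace A | hnorm x <= 1]].

Let ball_image_has_sup a : has_sup (ball_image a).
Proof.
split; first by exists (hnorm (act a 0)); exists 0 => //=; rewrite hnorm0.
have [_ [c cP]] := act_bounded a; exists `|c| => _ [x /= x1 <-].
rewrite (le_trans (cP x)) // (le_trans (ler_wpM2r _ (ler_norm c))) ?hnorm_ge0 //.
by rewrite ler_piMr.
Qed.

Lemma opnorm_ge0 a : 0 <= opnorm a.
Proof.
apply: (@le_trans _ _ (hnorm (act a 0))); first exact: hnorm_ge0.
by apply: (sup_upper_bound (ball_image_has_sup a)); exists 0 => //=; rewrite hnorm0.
Qed.

Lemma hnorm_act a x : hnorm (act a x) <= opnorm a * hnorm x.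
Proof.
have [->|x0] := eqVneq x 0; first by rewrite actx0 hnorm0 mulr0.
have nx : 0 < hnorm x.
  by rewrite lt_neqAle hnorm_ge0 andbT eq_sym; apply: contra x0 => /eqP/hnorm_eq0/eqP.
rewrite -ler_pdivrMr // mulrC.
have -> : (hnorm x)^-1 * hnorm (act a x) = hnorm (act a (((hnorm x)^-1)%:C%C *: x)).
  by rewrite actxZ hnormZ cnorm_real ger0_norm // invr_ge0 hnorm_ge0.
apply: (sup_upper_bound (ball_image_has_sup a)); eexists; last by [].
rewrite /= hnormZ cnorm_real ger0_norm ?invr_ge0 ?hnorm_ge0 //.
by rewrite mulVf // gt_eqF.
Qed.

Lemma opnorm_le a c : 0 <= c -> (forall x, hnorm (act a x) <= c * hnorm x) ->
  opnorm a <= c.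
Proof.
move=> c0 ac; apply: ge_sup; first by have [] := ball_image_has_sup a.
by move=> _ [x /= x1 <-]; rewrite (le_trans (ac x)) // ler_piMr.
Qed.

Lemma opnormD a b : opnorm (a + b) <= opnorm a + opnorm b.
Proof.
apply: opnorm_le => [|x]; first by rewrite addr_ge0 // opnorm_ge0.
by rewrite actD (le_trans (hnormD _ _)) // mulrDl lerD // hnorm_act.
Qed.

Lemma opnormM a b : opnorm (a * b) <= opnorm a * opnorm b.
Proof.
apply: opnorm_le => [|x]; first by rewrite mulr_ge0 // opnorm_ge0.
rewrite act_mul (le_trans (hnorm_act _ _)) // -mulrA ler_wpM2l ?opnorm_ge0 //.
exact: hnorm_act.
Qed.

Lemma opnormZ (c : R[i]) a : opnorm (c *: a) <= cnorm c * opnorm a.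
Proof.
apply: opnorm_le => [|x]; first by rewrite mulr_ge0 ?opnorm_ge0 ?cnorm_ge0.
by rewrite actZ hnormZ -mulrA ler_wpM2l ?cnorm_ge0 // hnorm_act.
Qed.

Lemma opnormN a : opnorm (- a) = opnorm a.
Proof.
have N b : opnorm (- b) <= opnorm b.
  by rewrite -scaleN1r (le_trans (opnormZ _ _)) // cnormN (Normc.normc1 R) mul1r.
by apply/le_anti; rewrite N -{1}(opprK a) N.
Qed.

Lemma opnormB a b : opnorm (a - b) <= opnorm a + opnorm b.
Proof. by rewrite -(opnormN b) opnormD. Qed.

Lemma opnorm1 : opnorm (1 : A) <= 1.
Proof. by apply: opnorm_le => // x; rewrite act_one mul1r. Qed.

Lemma opnorm0 : opnorm (0 : A) = 0.
Proof.
apply/le_anti; rewrite opnorm_ge0 andbT; apply: opnorm_le => // x.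
by rewrite act0 hnorm0 mul0r.
Qed.

Lemma opnormX a n : opnorm (a ^+ n) <= opnorm a ^+ n.
Proof.
elim: n => [|n IH]; first by rewrite !expr0 opnorm1.
by rewrite !exprS (le_trans (opnormM _ _)) // ler_wpM2l ?opnorm_ge0.
Qed.

Lemma opnorm_adj a : opnorm (adj a) = opnorm a.
Proof.
have adj_le b : opnorm (adj b) <= opnorm b.
  apply: opnorm_le => [|x]; first exact: opnorm_ge0.
  have [->|n0] := eqVneq (hnorm (act (adj b) x)) 0.
    by rewrite mulr_ge0 ?opnorm_ge0 ?hnorm_ge0.
  have np : 0 < hnorm (act (adj b) x) by rewrite lt_neqAle eq_sym n0 hnorm_ge0.
  rewrite -(ler_pM2r np) -expr2 hnorm_sqr act_adjr.
  rewrite (le_trans (ler_norm _)) // (le_trans (cnorm_Re _)) //.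
  rewrite (le_trans (hdot_cauchy_schwarz _ _)) // mulrC mulrAC.
  by rewrite ler_wpM2r ?hnorm_ge0 // hnorm_act.
by apply/le_anti; rewrite adj_le -{1}(adjK a) adj_le.
Qed.

Lemma star_generated_star_subalgebra (S : set A) : star_subalgebra (star_generated S).
Proof.
split=> [B [[]]//|c a b Ha Hb B SB|a b Ha Hb B SB|a Ha B SB].
- by have [[_ + _ _] _] := SB; apply; [exact: Ha|exact: Hb].
- by have [[_ _ + _] _] := SB; apply; [exact: Ha|exact: Hb].
- by have [[_ _ _ +] _] := SB; apply; exact: Ha.
Qed.

Lemma sub_star_generated (S : set A) : S `<=` star_generated S.
Proof. exact: sub_smallest. Qed.

Lemma star_generated_mono (S S' : set A) : S `<=` S' ->
  star_generated S `<=` star_generated S'.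
Proof. by move=> SS' a Ha B [B1 B2]; apply: Ha; split=> // x /SS'/B2. Qed.

Section StarSubalgebra.
Variables (M : set A) (hM : star_subalgebra M).

Lemma ssub1 : M 1. Proof. by case: hM. Qed.

Lemma ssubM a b : M a -> M b -> M (a * b).
Proof. by case: hM => _ _ + _; apply. Qed.

Lemma ssub_adj a : M a -> M (adj a).
Proof. by case: hM => _ _ _; apply. Qed.

Lemma ssub0 : M 0.
Proof.
by case: hM => M1 + _ _ => /(_ (-1) 1 1 M1 M1); rewrite scaleN1r addNr.
Qed.

Lemma ssubZ (c : R[i]) a : M a -> M (c *: a).
Proof.
by case: hM => _ + _ _ => /(_ c a 0) + Ma => /(_ Ma ssub0); rewrite addr0.
Qed.

Lemma ssubD a b : M a -> M b -> M (a + b).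
Proof.
by case: hM => _ + _ _ => /(_ 1 a b) + Ma Mb => /(_ Ma Mb); rewrite scale1r.
Qed.

Lemma ssubN a : M a -> M (- a).
Proof. by move=> Ma; rewrite -scaleN1r; exact: ssubZ. Qed.

Lemma ssubB a b : M a -> M b -> M (a - b).
Proof. by move=> Ma /ssubN; exact: ssubD. Qed.

Lemma ssubX a n : M a -> M (a ^+ n).
Proof.
by move=> Ma; elim: n => [|n IH]; [rewrite expr0; exact: ssub1|rewrite exprS; exact: ssubM].
Qed.

End StarSubalgebra.

End OperatorNorm.

Lemma ler_sqr_nneg (R : realType) (x y : R) : 0 <= x -> x <= y -> x ^+ 2 <= y ^+ 2.
Proof. by move=> x0 xy; rewrite lerXn2r // nnegrE // (le_trans x0 xy). Qed.

Lemma ler_of_sqr (R : realType) (x y : R) : 0 <= y -> x ^+ 2 <= y ^+ 2 -> x <= y.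
Proof. by move=> y0 xy; rewrite leNgt; apply/negP => yx; nra. Qed.

Section TraceNorm.
Variables (R : realType) (A : tracialSpace R).
Implicit Types a b x y : A.

Local Notation trform := (fun x y : A => tau (adj y * x)).

Lemma tauD a b : tau (a + b) = tau a + tau b. Proof. exact: linearD. Qed.
Lemma tauB a b : tau (a - b) = tau a - tau b. Proof. exact: linearB. Qed.
Lemma tauZ (c : R[i]) a : tau (c *: a) = c * tau a. Proof. exact: linearZ_LR. Qed.
Lemma tau0 : tau (0 : A) = 0. Proof. exact: linear0. Qed.

Lemma trform_linl c x y z :
  tau (adj z * (c *: x + y)) = c * tau (adj z * x) + tau (adj z * y).
Proof. by rewrite mulrDr -scalerAr tauD tauZ. Qed.

(** Polarisation: positivity makes the form real at [x + y] and at [i x + y], which fixes the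
    imaginary and the real part of the difference. *)
Lemma trform_herm x y : tau (adj x * y) = ((tau (adj y * x))^*)%C.
Proof.
have Im0 (z : A) : complex.Im (tau (adj z * z)) = 0 by apply: ger0_Im; exact: tau_ge0.
have e1 := Im0 (x + y); have e2 := Im0 ('i%C *: x + y).
rewrite adjD mulrDl !mulrDr !tauD !ImD !Im0 add0r addr0 in e1.
rewrite adjD mulrDl !mulrDr adjZ -!scalerAr -!scalerAl !tauD !tauZ in e2.
move: e2; rewrite !ImD mulrA ['i%C * _]mulrC.
case: (tau (adj x * y)) (tau (adj y * x)) (Im0 x) (Im0 y) e1 => a b [c d] /=.
case: (tau (adj x * x)) => p q; case: (tau (adj y * y)) => r s /= -> -> e1.
move=> e2; congr Complex; move: e1 e2; lra.
Qed.

Lemma tau_adj a : tau (adj a) = ((tau a)^*)%C.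
Proof. by have := trform_herm a 1; rewrite mulr1 adj1 mul1r. Qed.

Lemma norm2_ge0 a : 0 <= norm2 a. Proof. exact: sqrtr_ge0. Qed.

Lemma norm2_sqr a : norm2 a ^+ 2 = complex.Re (tau (adj a * a)).
Proof. by rewrite sqr_sqrtr // Re_ge0 // tau_ge0. Qed.

Lemma trform_cauchy_schwarz a b : cnorm (tau (adj b * a)) <= norm2 a * norm2 b.
Proof. exact: (@form_cauchy_schwarz _ _ trform (fun c x y z => trform_linl c x y z) trform_herm (@tau_ge0 R A)). Qed.

Lemma norm2D a b : norm2 (a + b) <= norm2 a + norm2 b.
Proof. exact: (@form_normD _ _ trform (fun c x y z => trform_linl c x y z) trform_herm (@tau_ge0 R A)). Qed.

Lemma norm2Z c a : norm2 (c *: a) = cnorm c * norm2 a.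
Proof. exact: (@form_normZ _ _ trform (fun c x y z => trform_linl c x y z) trform_herm). Qed.

Lemma norm2_0 : norm2 (0 : A) = 0.
Proof. by rewrite -(scale0r 0) norm2Z cnorm0 mul0r. Qed.

Lemma norm2N a : norm2 (- a) = norm2 a.
Proof. by rewrite -scaleN1r norm2Z cnormN (Normc.normc1 R) mul1r. Qed.

Lemma norm2B a b : norm2 (a - b) <= norm2 a + norm2 b.
Proof. by rewrite -(norm2N b) norm2D. Qed.

Lemma norm2_adj a : norm2 (adj a) = norm2 a.
Proof. by rewrite /norm2 adjK tauC. Qed.

Lemma norm2_1 : norm2 (1 : A) = 1.
Proof. by rewrite /norm2 adj1 mulr1 tau1 /= sqrtr1. Qed.

Lemma cnorm_tauM a b : cnorm (tau (a * b)) <= norm2 a * norm2 b.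
Proof. by rewrite -{1}(adjK a) (le_trans (trform_cauchy_schwarz _ _)) // norm2_adj mulrC. Qed.

Lemma cnorm_tau a : cnorm (tau a) <= norm2 a.
Proof. by have := cnorm_tauM a 1; rewrite mulr1 norm2_1 mulr1. Qed.

Lemma norm2_sqrD a b : norm2 (a + b) ^+ 2 <= 2 * norm2 a ^+ 2 + 2 * norm2 b ^+ 2.
Proof.
have := norm2D a b; have := norm2_ge0 (a + b); have := sqr_ge0 (norm2 a - norm2 b).
by move=> s0 p0 /(ler_sqr_nneg p0); nra.
Qed.

(** The constant is crude, from [|xi| |eta| <= |xi|^2 + |eta|^2]; its size is irrelevant because the
    power argument of [norm2M] removes it. *)
Lemma tau_bounded : exists2 C : R, 0 <= C & forall a, cnorm (tau a) <= C * opnorm a.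
Proof.
have [xi [eta [cxi ceta tauE]]] := tau_normal A.
pose S z := series (fun n => hnorm (z n : hspace A) ^+ 2).
have Sle z : cvgn (S z) -> forall N, S z N <= limn (S z).
  move=> cz N; apply: nondecreasing_cvgn_le => //; apply/nondecreasing_seqP => n.
  by rewrite /S /series /= big_nat_recr //= lerDl sqr_ge0.
pose C := limn (S xi) + limn (S eta).
have partial a N : cnorm (\sum_(n < N) hdot (hspace A) (act a (xi n)) (eta n))
    <= C * opnorm a.
  apply: (@le_trans _ _ ((S xi N + S eta N) * opnorm a)); last first.
    by rewrite ler_wpM2r ?opnorm_ge0 // lerD // Sle.
  rewrite /S /series /= !big_mkord -big_split /= mulr_suml.
  elim/big_ind2: _ => [|u u' v v' uu' vv'|i _]; first by rewrite cnorm0.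
    by rewrite (le_trans (cnormD _ _)) // lerD.
  rewrite (le_trans (hdot_cauchy_schwarz _ _)) //.
  rewrite (le_trans (ler_wpM2r (hnorm_ge0 _) (hnorm_act _ _))) //.
  rewrite -mulrA mulrC ler_wpM2r ?opnorm_ge0 //.
  by have := sqr_ge0 (hnorm (xi i) - hnorm (eta i));
    have := sqr_ge0 (hnorm (xi i)); have := sqr_ge0 (hnorm (eta i)); nra.
exists C => [|a].
  by rewrite addr_ge0 // (le_trans _ (Sle _ _ 0%N)) // /S /series /= big_geq.
apply/ler_addgt0Pr => e e0.
have /cvgrPdist_lt /(_ _ e0) [N _ /(_ N (leqnn N))] := tauE a.
rewrite sub0r normrN ger0_norm ?cnorm_ge0 // => lt.
rewrite -[tau a](subrK (\sum_(n < N) hdot (hspace A) (act a (xi n)) (eta n))).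
by rewrite (le_trans (cnormD _ _)) // addrC lerD // ltW.
Qed.

Lemma bounded_exp2_le1 (q K : R) : 0 <= q -> (forall n, q ^+ (2 ^ n) <= K) -> q <= 1.
Proof.
move=> q0 qK; rewrite leNgt; apply/negP => q1.
have bern m : m%:R * (q - 1) <= q ^+ m.
  suff : 1 + m%:R * (q - 1) <= q ^+ m by apply: le_trans; rewrite lerDr.
  elim: m => [|m IH]; first by rewrite mul0r addr0 expr0.
  rewrite exprS (le_trans _ (ler_wpM2l q0 IH)) // -natr1.
  have : 0 <= m%:R * (q - 1) * (q - 1) by rewrite !mulr_ge0 ?ler0n ?subr_ge0 ?ltW.
  lra.
have qp : 0 < q - 1 by rewrite subr_gt0.
(* By Bernoulli [2 ^ n * (q - 1) <= q ^ (2 ^ n)], and [2 ^ n > n > K / (q - 1)]. *)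
set n := (Num.Def.trunc (K / (q - 1))).+1.
have := qK n; apply/negP; rewrite -ltNge.
apply: (@lt_le_trans _ _ ((2 ^ n)%N%:R * (q - 1))); last exact: bern.
apply: (@lt_le_trans _ _ (n%:R * (q - 1))).
  by rewrite -ltr_pdivrMr // truncnS_gt.
by rewrite ler_pM2r // ler_nat ltnW // ltn_expl.
Qed.

(* Cauchy-Schwarz iterated along the powers x ^ (2 ^ n) of x = a^* a; the
   trace is norm-bounded because it is normal. *)
Lemma norm2M a b : norm2 (a * b) <= opnorm a * norm2 b.
Proof.
have [C C0 tauC0] := tau_bounded.
set x := adj a * a; set P := norm2 b ^+ 2; set M := opnorm a ^+ 2.
have adjx n : adj (x ^+ n) = x ^+ n.
  elim: n => [|n IH]; first by rewrite !expr0 adj1.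
  by rewrite {1}exprS adjM IH exprSr; congr (_ * _); rewrite adjM adjK.
(* The moments of [x] in the vector state given by [b]: the claim concerns [c 1], Cauchy-Schwarz
   doubles the index ([cS]), and boundedness of the trace controls the growth ([c_le]). *)
pose c n := complex.Re (tau (adj b * x ^+ n * b)).
have cE : norm2 (a * b) ^+ 2 = c 1%N by rewrite norm2_sqr /c expr1 adjM /x !mulrA.
have cS n : c n ^+ 2 <= c (n * 2)%N * P.
  have := trform_cauchy_schwarz (x ^+ n * b) b; rewrite mulrA.
  move=> /(le_trans (cnorm_Re _)) le; rewrite -/(c n) in le.
  have := ler_sqr_nneg (normr_ge0 _) le.
  rewrite real_normK ?num_real // exprMn -/P norm2_sqr adjM adjx.
  by rewrite mulrA -(mulrA (adj b)) -exprD addnn -muln2.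
have c_le n : c n <= C * opnorm b ^+ 2 * M ^+ n.
  rewrite (le_trans (ler_norm _)) // (le_trans (cnorm_Re _)) //.
  rewrite (le_trans (tauC0 _)) // -[leRHS]mulrA ler_wpM2l //.
  rewrite (le_trans (opnormM _ _)) // expr2 [leRHS]mulrAC ler_wpM2r ?opnorm_ge0 //.
  rewrite (le_trans (opnormM _ _)) // opnorm_adj ler_wpM2l ?opnorm_ge0 //.
  rewrite (le_trans (opnormX _ _)) // lerXn2r ?nnegrE ?opnorm_ge0 ?sqr_ge0 //.
  by rewrite (le_trans (opnormM _ _)) // opnorm_adj /M expr2.
have P0 : 0 <= P by exact: sqr_ge0.
have M0 : 0 <= M by exact: sqr_ge0.
suff : c 1%N <= M * P.
  by rewrite -cE /M /P -exprMn ler_pXn2r // nnegrE ?norm2_ge0 ?mulr_ge0 ?norm2_ge0 ?opnorm_ge0.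
have [Pz|Pn] := eqVneq P 0.
  by have := cS 1%N; rewrite Pz !mulr0; nra.
have Pp : 0 < P by rewrite lt_neqAle eq_sym Pn.
rewrite -ler_pdivrMr //; set q := c 1%N / P.
have q0 : 0 <= q by rewrite divr_ge0 // -cE sqr_ge0.
(* Dividing by [P] makes the doubling inequality purely geometric. With [c_le], the powers
   [(q / M) ^ (2 ^ n)] stay bounded, which forces [q <= M]. *)
have qc n : P * q ^+ (2 ^ n) <= c (2 ^ n)%N.
  elim: n => [|n IH]; first by rewrite expr1 /q mulrC divfK.
  have Pq0 : 0 <= P * q ^+ (2 ^ n) by rewrite mulr_ge0 // exprn_ge0.
  have := le_trans (ler_sqr_nneg Pq0 IH) (cS _).
  have -> : (P * q ^+ (2 ^ n)) ^+ 2 = P * q ^+ (2 ^ n.+1) * P.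
    by rewrite exprMn -(exprM q) -expnSr [RHS]mulrAC.
  by rewrite -(expnSr 2 n) ler_pM2r.
have [Mz|Mn] := eqVneq M 0.
  have := le_trans (qc 0%N) (c_le _); rewrite Mz !expr1 mulr0 => Pq.
  by rewrite leNgt; apply/negP => qp; move: Pq; rewrite leNgt mulr_gt0.
have Mp : 0 < M by rewrite lt_neqAle eq_sym Mn.
rewrite -(mul1r M) -ler_pdivrMr //.
apply: (@bounded_exp2_le1 _ (C * opnorm b ^+ 2 / P)) => [|n].
  by rewrite divr_ge0.
rewrite expr_div_n ler_pdivrMr; last exact: exprn_gt0.
rewrite -[leRHS]mulrA (mulrC P^-1) [leRHS]mulrA ler_pdivlMr // mulrC.
exact: le_trans (qc n) (c_le _).
Qed.

Lemma norm2Mr a b : norm2 (a * b) <= norm2 a * opnorm b.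
Proof. by rewrite -norm2_adj adjM mulrC -(norm2_adj a) -(opnorm_adj b) norm2M. Qed.

Lemma norm2_opnorm a : norm2 a <= opnorm a.
Proof. by have := norm2M a 1; rewrite mulr1 norm2_1 mulr1. Qed.

Lemma cnorm_tau_opnorm a : cnorm (tau a) <= opnorm a.
Proof. exact: le_trans (cnorm_tau a) (norm2_opnorm a). Qed.

End TraceNorm.

(** * Increments of the stochastic and time integrals *)

Section Semicircle.
Variable R : realType.

Lemma Rintegral_FTC2 (f F : R -> R) (a b : R) : a < b ->
  continuous f -> continuous F ->
  (forall x, a < x < b -> is_derive x 1 F (f x)) ->
  \int[lebesgue_measure]_(x in `[a, b]) f x = F b - F a.
Proof.
move=> ab cf cF dF; rewrite /Rintegral (@continuous_FTC2 _ f F a b ab) //=.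
- exact: continuous_subspaceT.
- split => [x|  |].
  + by rewrite in_itv /= => /dF [].
  + exact/cvg_at_right_filter/cF.
  + exact/cvg_at_left_filter/cF.
- by move=> x; rewrite in_itv /= => /dF dFx; rewrite derive1E derive_val.
Qed.

Variable v : R.
Hypothesis v0 : 0 < v.

Let w (s : R) := Num.sqrt (4 * v - s ^+ 2) / (2 * pi * v).

Let radius_gt0 : 0 < 2 * Num.sqrt v.
Proof. by rewrite mulr_gt0 // sqrtr_gt0. Qed.

Let w_edge (s : R) : s ^+ 2 = 4 * v -> w s = 0.
Proof. by move=> e; rewrite /w e subrr sqrtr0 mul0r. Qed.

Let w_sqr (s : R) : `|s| = 2 * Num.sqrt v -> s ^+ 2 = 4 * v.
Proof.
move=> e; rewrite -(real_normK (num_real s)) e exprMn sqr_sqrtr ?ltW //.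
by rewrite -natrX.
Qed.

Let w_continuous : continuous w.
Proof.
move=> s; apply: cvgMl.
apply: (@continuous_comp _ _ _ (fun s : R => 4 * v - s ^+ 2) Num.sqrt); last exact: sqrt_continuous.
by apply: cvgB; [exact: cvg_cst|exact: exprn_continuous].
Qed.

Let w_derive (s : R) : - (2 * Num.sqrt v) < s < 2 * Num.sqrt v ->
  is_derive s 1 w (- (s * w s / (4 * v - s ^+ 2))) /\ 4 * v - s ^+ 2 != 0.
Proof.
rewrite -ltr_norml => sv.
have s2 : 0 < 4 * v - s ^+ 2.
  rewrite subr_gt0 -(real_normK (num_real s)).
  have -> : 4 * v = (2 * Num.sqrt v) ^+ 2 by rewrite (w_sqr (ger0_norm (ltW radius_gt0))).
  by rewrite ltrXn2r // ?nnegrE // ltW.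
split; last by rewrite gt_eqF.
have sq : Num.sqrt (4 * v - s ^+ 2) ^+ 2 = 4 * v - s ^+ 2 by rewrite sqr_sqrtr // ltW.
have sq0 : Num.sqrt (4 * v - s ^+ 2) != 0 by rewrite gt_eqF // sqrtr_gt0.
have d1 : is_derive s 1 (fun s : R => 4 * v - s ^+ 2) (- (2 * s)).
  by apply: is_derive_eq; rewrite /GRing.scale /=; ring.
have d2 := is_derive1_sqrt s2.
have d3 := @is_derive1_comp _ Num.sqrt (fun s : R => 4 * v - s ^+ 2) s _ _ d2 d1.
have -> : w = (fun s : R => (2 * pi * v)^-1 *: (Num.sqrt \o (fun s : R => 4 * v - s ^+ 2)) s).
  by apply/funext => x; rewrite /w /GRing.scale /= mulrC.
apply: is_derive_eq.
rewrite /GRing.scale /= /w.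
have := lt0r_neq0 (pi_gt0 R); move: pi => p p0.
set r := Num.sqrt _ in sq sq0 *; rewrite -sq; field.
by rewrite sq0 p0 lt0r_neq0.
Qed.

Let edges (s : R) : s = 2 * Num.sqrt v \/ s = - (2 * Num.sqrt v) -> w s = 0.
Proof.
move=> s_edge; apply/w_edge/w_sqr.
by case: s_edge => ->; rewrite ?normrN ger0_norm // ltW.
Qed.

Let edges_lt : - (2 * Num.sqrt v) < 2 * Num.sqrt v.
Proof. by rewrite gtrN. Qed.

Let q_continuous : continuous (fun s : R => 4 * v - s ^+ 2).
Proof. by move=> s; apply: cvgB; [exact: cvg_cst|exact: exprn_continuous]. Qed.

Let FTC2 (f F : R -> R) :
  (forall s : R, - (2 * Num.sqrt v) < s < 2 * Num.sqrt v -> is_derive s 1 F (f s) : Prop) ->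
  continuous F -> continuous f ->
  \int[lebesgue_measure]_(s in `[- (2 * Num.sqrt v), 2 * Num.sqrt v]) f s
  = F (2 * Num.sqrt v) - F (- (2 * Num.sqrt v)).
Proof. by move=> dF cF cf; apply: Rintegral_FTC2 edges_lt cf cF dF. Qed.

Lemma semicircle_mean :
  \int[lebesgue_measure]_(s in `[- (2 * Num.sqrt v), 2 * Num.sqrt v]) (s * w s) = 0.
Proof.
(* A multiple of [(4 v - s^2)^(3/2)], which vanishes at both ends of the support. *)
pose F (s : R) : R := - 3^-1 * ((4 * v - s ^+ 2) * w s).
have dF (s : R) : - (2 * Num.sqrt v) < s < 2 * Num.sqrt v -> is_derive s 1 F (s * w s).
  move=> /w_derive [dw q0]; apply: is_derive_eq.
  by rewrite /GRing.scale /=; field; rewrite q0.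
have cF : continuous F.
  by move=> s; apply: cvgMr; apply: cvgM; [exact: q_continuous|exact: w_continuous].
have cf : continuous (fun s : R => s * w s).
  by move=> s; apply: cvgM; [exact: cvg_id|exact: w_continuous].
by rewrite (FTC2 dF cF cf) /F !edges; [rewrite !mulr0 subrr|right|left].
Qed.

(** The difference of the two sides is the integral of the derivative of [s (4 v - s^2) w / 4]. The
    total mass of [w] is not computed: it is read off the moment of order 0, where [tau 1 = 1]. *)
Lemma semicircle_variance :
  \int[lebesgue_measure]_(s in `[- (2 * Num.sqrt v), 2 * Num.sqrt v]) (s ^+ 2 * w s)
  = v * \int[lebesgue_measure]_(s in `[- (2 * Num.sqrt v), 2 * Num.sqrt v]) w s.
Proof.
have [cw cs2w] : continuous w /\ continuous (fun s : R => s ^+ 2 * w s).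
  split=> [|s]; first exact: w_continuous.
  by apply: cvgM; [exact: exprn_continuous|exact: w_continuous].
have int (f : R -> R) : continuous f -> lebesgue_measure.-integrable
    `[- (2 * Num.sqrt v), 2 * Num.sqrt v] (EFin \o f).
  move=> cf; apply: continuous_compact_integrable; first exact: segment_compact.
  exact: continuous_subspaceT.
rewrite -RintegralZl //; last exact: int.
apply/eqP; rewrite eq_sym -subr_eq0 -RintegralB //; last 2 first.
  by apply: int => s; apply: cvgMr; exact: w_continuous.
  exact: int.
pose F (s : R) : R := 4^-1 * (s * ((4 * v - s ^+ 2) * w s)).
have dF (s : R) : - (2 * Num.sqrt v) < s < 2 * Num.sqrt v ->
    is_derive s 1 F (v * w s - s ^+ 2 * w s).
  move=> /w_derive [dw q0]; apply: is_derive_eq.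
  by rewrite /GRing.scale /=; field; rewrite q0.
have cF : continuous F.
  move=> s; apply: cvgMr; apply: cvgM; first exact: cvg_id.
  by apply: cvgM; [exact: q_continuous|exact: w_continuous].
have cf : continuous (fun s : R => v * w s - s ^+ 2 * w s).
  by move=> s; apply: cvgB; [apply: cvgMr; exact: w_continuous|exact: cs2w].
by rewrite (FTC2 dF cF cf) /F !edges; [rewrite !mulr0 subrr|right|left].
Qed.

End Semicircle.

Section SemicircularMoments.
Variables (R : realType) (A : tracialSpace R) (v : R) (x : A).
Hypotheses (v0 : 0 < v) (x_sc : semicircular v x).

Lemma semicircular_tau : tau x = 0.
Proof.
have [_ /(_ 1%N)] := x_sc; rewrite expr1 => ->.
by under eq_Rintegral do rewrite expr1; rewrite semicircle_mean.
Qed.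

Lemma semicircular_tau_sqr : tau (x * x) = v%:C%C.
Proof.
have [_ xm] := x_sc; have := xm 0%N; rewrite expr0 tau1.
under eq_Rintegral do rewrite expr0 mul1r.
move=> /complexI w1; rewrite -expr2 xm semicircle_variance //.
by rewrite -w1 mulr1.
Qed.

End SemicircularMoments.

Lemma mul_add_scalars (K : comNzRingType) (B : algType K) (x y D : B) (a b : K) :
  (x + a%:A) * D * (y + b%:A) * D =
  x * D * y * D + a *: (D * y * D) + b *: ((x + a%:A) * D * D).
Proof.
set P := (x + a%:A) * D.
have -> : P * (y + b%:A) * D = P * y * D + b *: (P * D).
  by rewrite mulrDr mulrDl -scalerAr mulr1 -scalerAl.
by rewrite {1}/P !mulrDl -!scalerAl mul1r.
Qed.

(** * Freeness and the increments of a free Brownian motion *)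

Section Freeness.
Variables (R : realType) (A : tracialSpace R).

Definition centered (a : A) : A := a - (tau a)%:A.

Lemma tau_scalar (c : R[i]) : tau (c%:A : A) = c.
Proof. by rewrite tauZ tau1 mulr1. Qed.

Lemma tau_centered a : tau (centered a) = 0.
Proof. by rewrite tauB tau_scalar subrr. Qed.

Lemma centeredK a : a = centered a + (tau a)%:A.
Proof. by rewrite subrK. Qed.

Lemma tau_center_split a x b :
  tau (a * (x * b)) = tau (a * (centered x * b)) + tau x * tau (a * b).
Proof.
rewrite {1}(centeredK x) mulrDl mulrDr tauD; congr (_ + _).
by rewrite -scalerAl mul1r -scalerAr tauZ.
Qed.

Lemma ssub_centered (M : set A) a : star_subalgebra M -> M a -> M (centered a).
Proof. by move=> hM Ma; apply: ssubB => //; apply: ssubZ => //; exact: ssub1. Qed.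

(** Freeness restated for lists: the relation is not transitive, but [sorted] compares neighbours
    only, which is exactly the condition on the indices. *)
Lemma star_free_seq (I : eqType) (S : I -> set A) (l : seq (I * A)) :
  star_free S -> l != [::] ->
  sorted (fun x y : I * A => x.1 != y.1) l ->
  (forall x, x \in l -> star_generated (S x.1) x.2 /\ tau x.2 = 0) ->
  tau (\prod_(x <- l) x.2) = 0.
Proof.
case: l => // x l hS _ /(pathP x) xl lS.
have := hS (size l) (fun j => (nth x (x :: l) j).1) (fun j => (nth x (x :: l) j).2).
rewrite (big_nth x); apply => j jl; first by apply/lS/mem_nth.
exact/eqP/xl.
Qed.

End Freeness.

Section FilteredBrownianMotion.
Variables (R : realType) (A : tracialSpace R) (X : R -> A).
Hypothesis hX : free_additive_BM X.
Implicit Types (r s t u : R) (a b x y : A).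

(** The generated algebra is taken because [star_free] speaks about generated algebras; closure
    under the operations is then immediate. *)
Definition past s : set A := star_generated (natural_filtration X s).

Lemma past_ssub s : star_subalgebra (past s).
Proof. exact: star_generated_star_subalgebra. Qed.

Lemma commutant_sub (H : hilbertSpace R) (B C : set (H -> H)) : B `<=` C ->
  commutant C `<=` commutant B.
Proof. by move=> BC T [bT TC]; split=> // S /BC/TC. Qed.

Lemma past_mono s t : s <= t -> past s `<=` past t.
Proof.
move=> st; apply: star_generated_mono => a.
apply/commutant_sub/commutant_sub => T [b bS <-]; exists b => //.
by case: bS => [[r /andP[r0 rs] <-]|[_ [r /andP[r0 rs] <-] <-]]; [left|right];
  [|exists (X r) => //]; exists r => //=; rewrite r0 (le_trans rs).
Qed.

Lemma past_BM r s : 0 <= r -> r <= s -> past s (X r).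
Proof.
move=> r0 rs; apply: sub_star_generated; split; first exact: act_bounded.
by move=> S [_ Sc]; rewrite Sc //; exists (X r) => //; left; exists r => //=; rewrite r0.
Qed.

Lemma past_incr r s t : 0 <= r -> r <= s -> s <= t -> past t (X s - X r).
Proof.
move=> r0 rs st; apply: (ssubB (past_ssub t)).
  by apply: past_BM => //; exact: le_trans rs.
by apply: past_BM => //; exact: le_trans st.
Qed.

Lemma adj_incr s t : 0 <= s -> s <= t -> adj (X t - X s) = X t - X s.
Proof.
have [_ sa _ _] := hX => s0 st.
by rewrite adjD adjN !sa // (le_trans s0).
Qed.

Section Increment.
Variables s t : R.
Hypotheses (s0 : 0 <= s) (st : s <= t).
Let D := X t - X s.

Let freeD : s < t -> star_free (fun b : bool => if b then [set D] else natural_filtration X s).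
Proof. by move=> lt; have [_ _ _] := hX; apply; rewrite s0. Qed.

Lemma incr_mean : tau D = 0.
Proof.
have [e|ne] := eqVneq s t; first by rewrite /D e subrr tau0.
have lt : s < t by rewrite lt_neqAle ne.
have [_ _ /(_ s t) + _] := hX; rewrite s0 lt => /(_ isT).
by apply: semicircular_tau; rewrite subr_gt0.
Qed.

Lemma incr_variance : tau (D * D) = (t - s)%:C%C.
Proof.
have [e|ne] := eqVneq s t; first by rewrite /D e !subrr mul0r tau0.
have lt : s < t by rewrite lt_neqAle ne.
have [_ _ /(_ s t) + _] := hX; rewrite s0 lt => /(_ isT).
by apply: semicircular_tau_sqr; rewrite subr_gt0.
Qed.

Let D_eq0 : s = t -> D = 0.
Proof. by move=> e; rewrite /D e subrr. Qed.

Let D_gen : star_generated [set D] D.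
Proof. exact: sub_star_generated. Qed.

Let tau_past_mul x y : s < t -> past s x -> star_generated [set D] y -> tau y = 0 ->
  tau (x * y) = 0.
Proof.
move=> lt Fx Dy y0; rewrite (centeredK x) mulrDl tauD -scalerAl tauZ mul1r y0 mulr0 addr0.
have := @star_free_seq _ _ _ _ [:: (false, centered x); (true, y)] (freeD lt).
rewrite !big_cons big_nil mulr1; apply=> // z; rewrite !inE => /orP[] /eqP -> /=.
  by split; [apply: (ssub_centered (past_ssub s))|exact: tau_centered].
by [].
Qed.

Lemma tau_past_incr x : past s x -> tau (x * D) = 0.
Proof.
move=> Fx; have [/D_eq0 ->|ne] := eqVneq s t; first by rewrite mulr0 tau0.
by apply: tau_past_mul => //; [rewrite lt_neqAle ne|exact: incr_mean].
Qed.

Lemma tau_past_incr_sqr x : past s x -> tau (x * D * D) = (t - s)%:C%C * tau x.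
Proof.
move=> Fx; have [e|ne] := eqVneq s t.
  by rewrite (D_eq0 e) mulr0 tau0 e subrr mul0r.
have lt : s < t by rewrite lt_neqAle ne.
have DD : D * D = centered (D * D) + (t - s)%:C%C%:A by rewrite -incr_variance -centeredK.
rewrite -mulrA DD mulrDr tauD -scalerAr mulr1 tauZ tau_past_mul ?add0r //.
  apply: (ssub_centered (star_generated_star_subalgebra _)).
  exact: (ssubM (star_generated_star_subalgebra _)).
exact: tau_centered.
Qed.

(** The free Ito rule in integrated form. With both factors centered the word alternates between the
    past and the increment, so its trace is 0; the mean of [x] leaves [D y D] with [y] centered,
    also of trace 0; only the mean of [y] contributes. *)
Lemma tau_past_incr_incr x y : past s x -> past s y ->
  tau (x * D * y * D) = (t - s)%:C%C * (tau x * tau y).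
Proof.
move=> Fx Fy; have [e|ne] := eqVneq s t.
  by rewrite (D_eq0 e) !mulr0 tau0 e subrr mul0r.
have lt : s < t by rewrite lt_neqAle ne.
have Fcx := ssub_centered (past_ssub s) Fx; have Fcy := ssub_centered (past_ssub s) Fy.
have -> : x * D * y * D = centered x * D * centered y * D
    + tau x *: (D * centered y * D) + tau y *: (x * D * D).
  by have := mul_add_scalars (centered x) (centered y) D (tau x) (tau y); rewrite -!centeredK.
rewrite !tauD !tauZ tau_past_incr_sqr //.
have -> : tau (centered x * D * centered y * D) = 0.
  have := @star_free_seq _ _ _ _ [:: (false, centered x); (true, D); (false, centered y); (true, D)] (freeD lt).
  rewrite !big_cons big_nil mulr1 !mulrA; apply=> // z.
  have D0 := incr_mean.
  by rewrite !inE => /or4P[] /eqP -> /=; split; rewrite ?tau_centered.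
have -> : tau (D * centered y * D) = 0.
  by rewrite -mulrA tauC tau_past_incr_sqr // tau_centered mulr0.
by rewrite mulr0 !add0r; ring.
Qed.

End Increment.

(* Triples (u, u', a) stand for the step process a 1_[u, u'[. *)
Implicit Types (e f : R * R * A) (L : seq (R * R * A)).

Definition adapted lo hi L := forall e, e \in L ->
  [/\ lo <= e.1.1, e.1.1 <= e.1.2, e.1.2 <= hi & past e.1.1 e.2].

Definition step L s : A := \sum_(e <- L | s \in `[e.1.1, e.1.2[%R) e.2.

Definition step_int L : A := \sum_(e <- L) e.2 * (X e.1.2 - X e.1.1).

Definition overlap e f : R :=
  Num.max 0 (Num.min e.1.2 f.1.2 - Num.max e.1.1 f.1.1).

End FilteredBrownianMotion.

(** * The Ito isometry for step processes *)

Section StepIsometry.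
Variables (R : realType) (A : tracialSpace R) (X : R -> A).
Hypothesis hX : free_additive_BM X.
Implicit Types (r s t u : R) (a b x y : A).
Implicit Types (e f : R * R * A) (L : seq (R * R * A)).

(** The increments are cut at the endpoints of the common interval. Pieces over disjoint intervals
    have trace 0, the later one being centered and free from its past; the common piece contributes
    its variance. *)
Let tau_incr_mul u u' w w' c : 0 <= u -> u <= w -> u <= u' -> w <= w' -> past X w c ->
  tau ((X u' - X u) * c * (X w' - X w)) =
  (Num.max 0 (Num.min u' w' - w))%:C%C * tau c.
Proof.
move=> u0 uw uu' ww' Fc.
have w0 := le_trans u0 uw.
have Fi p q r : 0 <= p -> p <= q -> q <= r -> past X r (X q - X p) by exact: past_incr.
have FM r x y : past X r x -> past X r y -> past X r (x * y) by exact: (ssubM (past_ssub X r)).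
have FW r r' x : r <= r' -> past X r x -> past X r' x by move=> rr'; exact: past_mono.
have mulD2 (p q d : A) : (p + q) * c * d = p * c * d + q * c * d.
  by rewrite !mulrDl.
have mulD3 (p q r d : A) : (p + q + r) * c * d = p * c * d + q * c * d + r * c * d.
  by rewrite !mulrDl.
have [u'w|wu'] := leP u' w.
  rewrite tau_past_incr //; last by apply: FM => //; apply: Fi.
  by rewrite max_l ?mul0r // subr_le0 ge_min u'w.
have P : tau ((X w - X u) * c * (X w' - X w)) = 0.
  by rewrite tau_past_incr //; apply: FM => //; exact: Fi.
have [w'u'|u'w'] := leP w' u'.
  have -> : X u' - X u = (X w - X u) + (X w' - X w) + (X u' - X w').
    by rewrite [RHS]addrC (addrC (X w - X u)) !addrA !subrK.
  rewrite mulD3 !tauD P add0r -[(X w' - X w) * c * _]mulrA tauC tau_past_incr_sqr //.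
  have -> : tau ((X u' - X w') * c * (X w' - X w)) = 0.
    rewrite -mulrA tauC tau_past_incr // ?(le_trans w0) //.
    by apply: FM; [exact: FW ww' Fc|exact: Fi].
  by rewrite addr0 max_r // subr_ge0.
have uu'0 := le_trans u0 uu'.
have -> : X w' - X w = (X u' - X w) + (X w' - X u') by rewrite [RHS]addrC addrA subrK.
rewrite mulrDr tauD.
have -> : tau ((X u' - X u) * c * (X w' - X u')) = 0.
  by apply: (tau_past_incr hX uu'0 (ltW u'w')); apply: FM; [exact: Fi|exact: FW (ltW wu') Fc].
have -> : X u' - X u = (X w - X u) + (X u' - X w) by rewrite [RHS]addrC addrA subrK.
rewrite mulD2 tauD.
have -> : tau ((X w - X u) * c * (X u' - X w)) = 0.
  by apply: (tau_past_incr hX w0 (ltW wu')); apply: FM => //; exact: Fi.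
rewrite add0r addr0 -mulrA tauC (tau_past_incr_sqr hX w0 (ltW wu')) //.
by rewrite max_r // subr_ge0 ltW.
Qed.

Let tau_step_mul e f : 0 <= e.1.1 -> e.1.1 <= e.1.2 -> past X e.1.1 e.2 ->
  0 <= f.1.1 -> f.1.1 <= f.1.2 -> past X f.1.1 f.2 ->
  tau (adj (e.2 * (X e.1.2 - X e.1.1)) * (f.2 * (X f.1.2 - X f.1.1))) =
  (overlap e f)%:C%C * tau (adj e.2 * f.2).
Proof.
wlog ef : e f / e.1.1 <= f.1.1.
  move=> H e0 ee Fe f0 ff Ff.
  have [|fe] := leP e.1.1 f.1.1; first by move=> ef; exact: H.
  rewrite trform_herm H //; last exact: ltW.
  rewrite rmorphM [in RHS]trform_herm /overlap (minC f.1.2) (maxC f.1.1); congr (_ * _).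
  exact: conjc_real.
case: e f ef => [[u u'] a] [[w w'] b] /= uw u0 uu' Fa w0 ww' Fb.
rewrite adjM adj_incr // mulrA -(mulrA _ (adj a)) tau_incr_mul //.
  by rewrite /overlap /= (max_r uw).
apply: (ssubM (past_ssub X w)) => //; apply: (ssub_adj (past_ssub X w)).
exact: past_mono Fa.
Qed.

Let itvI_co e f r : (r \in `[e.1.1, e.1.2[%R) && (r \in `[f.1.1, f.1.2[%R) =
  (r \in `[Num.max e.1.1 f.1.1, Num.min e.1.2 f.1.2[%R).
Proof.
by rewrite !in_itv /= ge_max lt_min; exact: andbACA.
Qed.

Lemma integral_indic_sum lo hi (P : seq (R * (R * R))) :
  (forall p, p \in P -> lo <= p.2.1 /\ p.2.2 <= hi) ->
  (\int[lebesgue_measure]_(r in `[lo, hi])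
     (\sum_(p <- P) p.1 * (r \in `[p.2.1, p.2.2[%R)%:R)%:E)%E
  = (\sum_(p <- P) p.1 * Num.max 0 (p.2.2 - p.2.1))%:E.
Proof.
move=> PP.
have int (p : R * (R * R)) : lebesgue_measure.-integrable `[lo, hi]
    (fun r => (p.1%:E * (\1_(`[p.2.1, p.2.2[%classic) r)%:E)%E).
  apply: integrableZl => //; apply: (integrableS (E := setT)) => //.
  exact: integrable_indic_itv.
transitivity (\int[lebesgue_measure]_(r in `[lo, hi])
    (\sum_(p <- P) (p.1%:E * (\1_(`[p.2.1, p.2.2[%classic) r)%:E)))%E.
  apply: eq_integral => r _; rewrite -sumEFin; apply: eq_bigr => p _.
  by rewrite -EFinM indicE mem_setE.
rewrite integral_sum //= -sumEFin big_seq [RHS]big_seq; apply: eq_bigr => p /PP[lop phi].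
rewrite integralZl //; last first.
  apply: (integrableS (E := setT)) => //; exact: integrable_indic_itv.
rewrite integral_indic // EFinM; congr (_ * _)%E.
rewrite setIidl; last first.
  move=> r /=; rewrite !in_itv /= => /andP[pr rp].
  by rewrite (le_trans lop pr) (le_trans (ltW rp) phi).
apply: (etrans (lebesgue_measure_itv _)); rewrite /= lte_fin; have [pp|pp] := ltP p.2.1 p.2.2.
  by rewrite -EFinB max_r // subr_ge0 ltW.
by rewrite max_l // subr_le0.
Qed.

Lemma sum_mul_sum (I J : Type) (s : seq I) (t : seq J) (P : pred I) (Q : pred J)
    (F : I -> A) (G : J -> A) :
  (\sum_(i <- s | P i) F i) * (\sum_(j <- t | Q j) G j) =
  \sum_(i <- s | P i) \sum_(j <- t | Q j) F i * G j.
Proof. by rewrite mulr_suml; apply: eq_bigr => i _; rewrite mulr_sumr. Qed.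

Lemma tau_sum (I : Type) (s : seq I) (P : pred I) (F : I -> A) :
  tau (\sum_(i <- s | P i) F i) = \sum_(i <- s | P i) tau (F i).
Proof. exact: linear_sum. Qed.

Lemma Re_sum (I : Type) (s : seq I) (P : pred I) (F : I -> R[i]) :
  complex.Re (\sum_(i <- s | P i) F i) = \sum_(i <- s | P i) complex.Re (F i).
Proof. by apply: (big_morph _ (@ReD R)). Qed.

(** Both sides expand into the same sum over pairs of pieces, weighted by the length of their
    overlap. The pieces need not be disjoint, so sums and differences of step processes are plain
    concatenations of lists. *)
Lemma step_isometry lo hi L : 0 <= lo -> adapted X lo hi L ->
  (\int[lebesgue_measure]_(r in `[lo, hi]) (norm2 (step L r) ^+ 2)%:E)%E
  = (norm2 (step_int X L) ^+ 2)%:E.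
Proof.
move=> lo0 LL.
pose c (ef : (R * R * A) * (R * R * A)) :=
  (complex.Re (tau (adj ef.1.2 * ef.2.2)),
   (Num.max ef.1.1.1 ef.2.1.1, Num.min ef.1.1.2 ef.2.1.2)).
pose P := [seq c ef | ef <- [seq (e, f) | e <- L, f <- L]].
transitivity (\int[lebesgue_measure]_(r in `[lo, hi])
     (\sum_(p <- P) p.1 * (r \in `[p.2.1, p.2.2[%R)%:R)%:E)%E.
  apply: eq_integral => r _; congr EFin; rewrite norm2_sqr /step adj_sum sum_mul_sum.
  rewrite tau_sum Re_sum big_map big_allpairs_dep /= big_mkcond; apply: eq_bigr => e _.
  case: ifP => er; last first.
    rewrite big1 // => f _; rewrite -itvI_co er mulr0 //.
  rewrite tau_sum Re_sum big_mkcond; apply: eq_bigr => f _.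
  by rewrite -itvI_co er /=; case: ifP; rewrite ?mulr1 ?mulr0.
rewrite integral_indic_sum; last first.
  move=> _ /mapP[ef /allpairsP[[e f] [/= eL fL ->]] ->] /=.
  have [loe _ ehi _] := LL _ eL.
  by rewrite le_max loe ge_min ehi.
congr EFin; rewrite norm2_sqr /step_int adj_sum sum_mul_sum tau_sum Re_sum.
rewrite big_map big_allpairs_dep /= big_seq [RHS]big_seq; apply: eq_bigr => e eL.
rewrite tau_sum Re_sum big_seq [RHS]big_seq; apply: eq_bigr => f fL.
have [loe ee _ Fe] := LL _ eL; have [lof ff _ Ff] := LL _ fL.
by rewrite tau_step_mul ?(le_trans lo0) // Re_realM mulrC.
Qed.

End StepIsometry.

(** * Increments of the stochastic integral *)

Section StochasticIncrement.
Variables (R : realType) (A : tracialSpace R) (X U : R -> A).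
Hypothesis hX : free_additive_BM X.
Hypothesis U_past : forall s, 0 <= s -> past X s (U s).
Hypothesis U_cont : forall t, 0 <= t ->
  opnorm (U s - U t) @[s --> within [set s | 0 <= s] (nbhs t)] --> (0 : R).
Implicit Types (r s t lo hi : R) (a b c : A) (L : seq (R * R * A)).
Local Notation mu := (@lebesgue_measure R).

Lemma norm2_dist a b : `|norm2 a - norm2 b| <= norm2 (a - b).
Proof.
have := norm2D (a - b) b; have := norm2D (b - a) a.
rewrite !subrK -(norm2N (b - a)) opprB ler_norml => ba ab.
by rewrite lerBlDr ab lerNl opprB lerBlDr ba.
Qed.

Let shift_continuous lo hi c : 0 <= lo ->
  {within `[lo, hi], continuous (fun r => norm2 (U r + c))}.
Proof.
move=> lo0; apply/subspace_continuousP => t /=; rewrite in_itv /= => /andP[lot thi].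
apply/cvgrPdist_le => e e0.
have t0 := le_trans lo0 lot.
have /cvgrPdist_lt /(_ _ e0) := U_cont t0.
rewrite !near_withinE /=; apply: filterS => r rP rlo.
have r0 : 0 <= r by move: rlo; rewrite in_itv /= => /andP[+ _]; exact: le_trans.
have := rP r0; rewrite sub0r normrN ger0_norm ?opnorm_ge0 // => /ltW re.
rewrite distrC (le_trans (norm2_dist _ _)) // opprD addrACA subrr addr0.
exact: le_trans (norm2_opnorm _) re.
Qed.

(** Only real-valued functions are ever measured. The constant [c] is generalised because on the
    interval of the first piece that piece merely shifts [c]. *)
Let step_measurable (V : R -> A) lo hi L c :
  (forall c', measurable_fun `[lo, hi] (fun r => norm2 (V r + c'))) ->
  measurable_fun `[lo, hi] (fun r => norm2 (V r + c - step L r)).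
Proof.
move=> mV; elim: L c => [|e L IH] c.
  apply: (eq_measurable_fun (fun r => norm2 (V r + c))) => //.
  by move=> r _; rewrite /step big_nil subr0.
apply: (eq_measurable_fun (fun r => if r \in `[e.1.1, e.1.2[%R
    then norm2 (V r + (c - e.2) - step L r) else norm2 (V r + c - step L r))).
  by move=> r _; rewrite /step big_cons; case: ifP => // _; rewrite opprD !addrA.
have mI : measurable (`[lo, hi]%classic `&`
    (fun r => r \in `[e.1.1, e.1.2[%R) @^-1` [set true]).
  apply: measurableI => //.
  rewrite (_ : _ @^-1` _ = `[e.1.1, e.1.2[%classic) //.
apply: measurable_fun_if => //; first exact: (measurable_fun_bool true).
- by apply: measurable_funS (IH _) => //; exact: subIsetl.
- by apply: measurable_funS (IH _) => //; exact: subIsetl.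
Qed.

Let step_dist_measurable lo hi L : 0 <= lo ->
  measurable_fun `[lo, hi] (EFin \o (fun r => norm2 (U r - step L r) ^+ 2)).
Proof.
move=> lo0; apply/measurable_EFinP/measurable_funX.
apply: (eq_measurable_fun (fun r => norm2 (U r + 0 - step L r))).
  by move=> r _; rewrite addr0.
apply: step_measurable => c.
by apply: subspace_continuous_measurable_fun => //; exact: shift_continuous.
Qed.

Let step_norm_measurable lo hi L :
  measurable_fun `[lo, hi] (EFin \o (fun r => norm2 (step L r) ^+ 2)).
Proof.
apply/measurable_EFinP/measurable_funX.
apply: (eq_measurable_fun (fun r => norm2 ((fun=> 0) r + 0 - step L r))).
  by move=> r _; rewrite /= addr0 sub0r norm2N.
by apply: step_measurable => c; exact: measurable_cst.
Qed.

Lemma stochastic_integral_lists t J : 0 <= t -> is_stochastic_integral X U t J ->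
  forall eta : R, 0 < eta -> exists L, [/\ adapted X 0 t L,
    (\int[mu]_(r in `[0%R, t]) (norm2 (U r - step L r) ^+ 2)%:E <= eta%:E)%E &
    norm2 (J - step_int X L) <= eta].
Proof.
move=> t0 [m [u [a [sa int_lim J_lim]]]] eta eta0.
have /cvgrPdist_lt /(_ _ eta0) JN := J_lim.
have IN : \forall n \near \oo,
    (\int[mu]_(s in `[0%R, t]) (norm2 (U s - step_process (m n) (u n) (a n) s)%R ^+ 2)%:E
      <= eta%:E)%E.
  have /fine_cvgP[fin /cvgrPdist_lt /(_ _ eta0) dist] := int_lim.
  move: fin dist; apply: filterS2 => n fn; rewrite sub0r normrN.
  by move=> /(le_lt_trans (ler_norm _))/ltW dn; rewrite -(fineK fn) lee_fin.
have [n [nJ nI]] : exists n, (`|0 - norm2 (J - step_stochastic_integral X (m n) (u n) (a n))| < eta)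
   /\ (\int[mu]_(s in `[0%R, t]) (norm2 (U s - step_process (m n) (u n) (a n) s)%R ^+ 2)%:E
      <= eta%:E)%E.
  by have [N _ /(_ N (leqnn N))] := filterI JN IN; exists N.
exists [seq (u n i, u n i.+1, a n i) | i <- iota 0 (m n)].
have stepE s : step [seq (u n i, u n i.+1, a n i) | i <- iota 0 (m n)] s
    = step_process (m n) (u n) (a n) s.
  rewrite /step big_map -[m n as X in iota 0 X]subn0 /step_process.
  by rewrite -(big_mkord (fun i => s \in `[u n i, u n i.+1[%R) (a n)).
split.
- move=> e /mapP[j]; rewrite mem_iota /= add0n => im ->.
  have [u0 um umono Fa] := sa n.
  have mono p q : (p <= q)%N -> (q <= m n)%N -> u n p <= u n q.
    elim: q => [|q IH]; first by rewrite leqn0 => /eqP ->.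
    rewrite leq_eqVlt => /orP[/eqP ->//|pq] qm.
    by rewrite (le_trans (IH pq (ltnW qm))) // umono.
  split=> /=.
  + by rewrite (le_trans u0) // mono // ltnW.
  + exact: umono.
  + by rewrite (le_trans _ um) // mono.
  + exact: (sub_star_generated (Fa _ im)).
- by under eq_integral do rewrite stepE.
- rewrite sub0r normrN ger0_norm ?norm2_ge0 // in nJ.
  rewrite /step_int big_map -[m n as Z in iota 0 Z]subn0.
  by rewrite (big_mkord xpredT (fun i => a n i * (X (u n i.+1) - X (u n i)))) ltW.
Qed.

(** The filter is needed for the restriction before [s], since truncating a piece that starts after
    [s] would reverse its endpoints. In [step_after] a piece ending before [s] becomes the empty
    interval [[s, s[], which is still adapted. *)
Definition step_before s L := [seq (e.1.1, Num.min e.1.2 s, e.2) | e <- L & e.1.1 < s].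
Definition step_after s L := [seq (Num.max e.1.1 s, Num.max e.1.2 s, e.2) | e <- L].

Let adapted_before s t L : s <= t -> adapted X 0 t L -> adapted X 0 s (step_before s L).
Proof.
move=> st LL e /mapP[f]; rewrite mem_filter => /andP[fs /LL[f0 ff ft Ff]] -> /=.
by split=> //; rewrite ?le_min ?ff ?(ltW fs) // ge_min lexx orbT.
Qed.

Let adapted_after s t L : s <= t -> adapted X 0 t L -> adapted X s t (step_after s L).
Proof.
move=> st LL e /mapP[f] /LL[f0 ff ft Ff] -> /=; split.
- by rewrite le_max lexx orbT.
- by rewrite ge_max !le_max ff lexx !orbT.
- by rewrite ge_max ft st.
- by apply: past_mono Ff; rewrite le_max lexx.
Qed.

Let step_int_split s t L : adapted X 0 t L ->
  step_int X L = step_int X (step_before s L) + step_int X (step_after s L).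
Proof.
elim: L => [|e L IH] LL; first by rewrite /step_int !big_nil addr0.
have /IH {}IH : adapted X 0 t L by move=> f fL; apply: LL; rewrite inE fL orbT.
have [_ ee _ _] : [/\ 0 <= e.1.1, e.1.1 <= e.1.2, e.1.2 <= t & past X e.1.1 e.2].
  by apply: LL; rewrite inE eqxx.
rewrite /step_int /step_before /step_after /= big_cons -/(step_int X L) IH.
case: ltP => es; rewrite /= !big_cons /=.
  rewrite addrACA; congr (_ + _); rewrite -mulrDr; congr (_ * _).
  have [e2s|se2] := leP e.1.2 s; first by rewrite subrr addr0.
  by rewrite [RHS]addrC addrA subrK.
by rewrite addrCA max_l // (le_trans es).
Qed.

Let step_before_lt s L r : r < s -> step (step_before s L) r = step L r.
Proof.
move=> rs; rewrite /step /step_before big_map big_filter_cond.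
apply: eq_bigl => e; rewrite !in_itv /= lt_min rs andbT.
by case: (ltP e.1.1 s) => //= es; rewrite leNgt (lt_le_trans rs es).
Qed.

Let step_ge s L r : s <= r -> adapted X 0 s L -> step L r = 0.
Proof.
move=> sr LL; rewrite /step big_seq_cond big1 // => e /andP[/LL[_ _ es _]].
by rewrite in_itv /= => /andP[_ /lt_le_trans/(_ es)]; rewrite ltNge sr.
Qed.

Let step_after_ge s L r : s <= r -> step (step_after s L) r = step L r.
Proof.
move=> sr; rewrite /step /step_after big_map; apply: eq_bigl => e /=.
by rewrite !in_itv /= ge_max sr andbT lt_max [r < s]ltNge sr orbF.
Qed.

Definition step_opp L := [seq (e.1.1, e.1.2, - e.2) | e <- L].

Let adapted_opp lo hi L : adapted X lo hi L -> adapted X lo hi (step_opp L).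
Proof.
move=> LL e /mapP[f] /LL[lof ff fhi Ff] -> /=; split=> //.
exact: (ssubN (past_ssub X _)).
Qed.

Let step_opp_val L r : step (step_opp L) r = - step L r.
Proof. by rewrite /step big_map -sumrN. Qed.

Let step_int_opp L : step_int X (step_opp L) = - step_int X L.
Proof. by rewrite /step_int big_map -sumrN; apply: eq_bigr => e _; rewrite mulNr. Qed.

Let step_cat L1 L2 r : step (L1 ++ L2) r = step L1 r + step L2 r.
Proof. by rewrite /step big_cat. Qed.

Let step_int_cat L1 L2 : step_int X (L1 ++ L2) = step_int X L1 + step_int X L2.
Proof. by rewrite /step_int big_cat. Qed.

Let adapted_cat lo hi L1 L2 : adapted X lo hi L1 -> adapted X lo hi L2 ->
  adapted X lo hi (L1 ++ L2).
Proof. by move=> L1L L2L e; rewrite mem_cat => /orP[/L1L|/L2L]. Qed.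

(** Typically [L] is the difference of [L1] and [L2], both approximating [U]; the isometry turns the
    closeness of the processes into closeness of the integrals. *)
Let step_integral_le lo hi L L1 L2 (eta1 eta2 : R) : 0 <= lo ->
  (forall r, lo <= r -> r <= hi -> norm2 (step L r) ^+ 2 <=
    2 * norm2 (U r - step L1 r) ^+ 2 + 2 * norm2 (U r - step L2 r) ^+ 2) ->
  adapted X lo hi L ->
  (\int[mu]_(r in `[lo, hi]) (norm2 (U r - step L1 r) ^+ 2)%:E <= eta1%:E)%E ->
  (\int[mu]_(r in `[lo, hi]) (norm2 (U r - step L2 r) ^+ 2)%:E <= eta2%:E)%E ->
  norm2 (step_int X L) ^+ 2 <= 2 * eta1 + 2 * eta2.
Proof.
move=> lo0 Lle LL le1 le2.
rewrite -lee_fin -(step_isometry hX lo0 LL).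
have m1 := step_dist_measurable (hi := hi) L1 lo0.
have m2 := step_dist_measurable (hi := hi) L2 lo0.
have Z L' : measurable_fun `[lo, hi] (EFin \o (fun r => norm2 (U r - step L' r) ^+ 2)) ->
    measurable_fun `[lo, hi] (fun r => (2%:E * (norm2 (U r - step L' r) ^+ 2)%:E)%E) /\
    (\int[mu]_(r in `[lo, hi]) (2%:E * (norm2 (U r - step L' r) ^+ 2)%:E) =
    2%:E * \int[mu]_(r in `[lo, hi]) (norm2 (U r - step L' r) ^+ 2)%:E)%E.
  move=> mL'; split; first exact: measurable_funeM.
  by rewrite ge0_integralZl_EFin // => r _; rewrite lee_fin sqr_ge0.
have [mZ1 Z1] := Z _ m1; have [mZ2 Z2] := Z _ m2.
have n2 a : (0 <= 2%:E * (norm2 a ^+ 2)%:E)%E by rewrite -EFinM lee_fin mulr_ge0 // sqr_ge0.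
apply: (@le_trans _ _ (\int[mu]_(r in `[lo, hi])
   (2%:E * (norm2 (U r - step L1 r) ^+ 2)%:E + 2%:E * (norm2 (U r - step L2 r) ^+ 2)%:E))%E).
  apply: ge0_le_integral => //.
  - by move=> r _; rewrite lee_fin sqr_ge0.
  - exact: step_norm_measurable.
  - exact: emeasurable_funD.
  - move=> r; rewrite /= in_itv /= => /andP[lor rhi].
    by rewrite -!EFinM -EFinD lee_fin Lle.
rewrite ge0_integralD // Z1 Z2 (EFinD (2 * eta1)) (EFinM 2 eta1) (EFinM 2 eta2).
by apply: leeD; apply: lee_wpmul2l.
Qed.

Let norm2_sqr_sub a b c : norm2 (a - b) ^+ 2 <= 2 * norm2 (c - a) ^+ 2 + 2 * norm2 (c - b) ^+ 2.
Proof.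
have -> : a - b = (c - b) - (c - a) by rewrite opprB [RHS]addrC addrA subrK.
by rewrite addrC -(norm2N (c - a)); exact: norm2_sqrD.
Qed.

Section Increment.
Variables (s t : R) (J J' : A).
Hypotheses (s0 : 0 <= s) (st : s <= t).
Hypotheses (hJ : is_stochastic_integral X U s J) (hJ' : is_stochastic_integral X U t J').

(** [J] and [J'] come with unrelated approximations [Z] and [Y]. On [[0, s]] both approximate [U],
    so the integral of their difference is small, and the part of [Y] after [s] is left to
    approximate [J' - J]. *)
Lemma stochastic_increment_lists (eta : R) : 0 < eta -> exists L, [/\ adapted X s t L,
    (\int[mu]_(r in `[s, t]) (norm2 (U r - step L r) ^+ 2)%:E <= (eta ^+ 2)%:E)%E &
    norm2 (J' - J - step_int X L) <= eta].
Proof.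
move=> eta0; have eta2 : 0 < eta ^+ 2 by exact: exprn_gt0.
(* The second bound gives [4 e <= (eta / 4)^2] in [N2]; the three errors then add up to at most
   [3 eta / 4]. *)
pose e := Num.min (eta / 4) (eta ^+ 2 / 64).
have e0 : 0 < e by rewrite lt_min !divr_gt0.
have e1 : e <= eta / 4 by rewrite ge_min lexx.
have e2 : e <= eta ^+ 2 / 64 by rewrite ge_min lexx orbT.
have [Y [YL Yint YJ]] := stochastic_integral_lists (le_trans s0 st) hJ' e0.
have [Z [ZL Zint ZJ]] := stochastic_integral_lists s0 hJ e0.
have sub_le lo hi : 0 <= lo -> hi <= t ->
    (\int[mu]_(r in `[lo, hi]) (norm2 (U r - step Y r) ^+ 2)%:E <= e%:E)%E.
  move=> lo0 hit; apply: (le_trans _ Yint); apply: ge0_subset_integral => //.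
  - exact: step_dist_measurable.
  - by move=> r _; rewrite lee_fin sqr_ge0.
  - by move=> r /=; rewrite !in_itv /= => /andP[/(le_trans lo0) -> /le_trans ->].
exists (step_after s Y); split.
- exact: adapted_after.
- have <- : (\int[mu]_(r in `[s, t]) (norm2 (U r - step Y r) ^+ 2)%:E =
      \int[mu]_(r in `[s, t]) (norm2 (U r - step (step_after s Y) r) ^+ 2)%:E)%E.
    apply: eq_integral => r; rewrite mem_setE in_itv /= => /andP[sr _].
    by rewrite step_after_ge.
  by apply: (le_trans (sub_le _ _ s0 (lexx t))); rewrite lee_fin; lra.
pose N := step_before s Y ++ step_opp Z.
have NL : adapted X 0 s N.
  by apply: adapted_cat; [exact: adapted_before YL|exact: adapted_opp].
have N2 : norm2 (step_int X N) ^+ 2 <= 2 * e + 2 * e.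
  apply: (step_integral_le (lexx 0) _ NL (sub_le _ _ (lexx 0) st) Zint) => r r0 rs.
  have [rlt|sr] := ltP r s.
    by rewrite step_cat step_before_lt // step_opp_val; exact: norm2_sqr_sub.
  by rewrite (step_ge sr NL) norm2_0 expr0n /= addr_ge0 // mulr_ge0 // sqr_ge0.
have N1 : norm2 (step_int X N) <= eta / 4.
  apply: ler_of_sqr; first by rewrite divr_ge0 // ltW.
  by apply: (le_trans N2); rewrite expr_div_n; lra.
have -> : J' - J - step_int X (step_after s Y) =
    (J' - step_int X Y) - (J - step_int X Z) + step_int X N.
  rewrite (step_int_split s YL) step_int_cat step_int_opp.
  rewrite !opprB opprD !addrA.
  by rewrite [RHS](ACl (1 * 5 * 3 * (2 * 6) * (4 * 7)))%AC /= addNr subrr !addr0.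
apply: (le_trans (norm2D _ _)); have := norm2B (J' - step_int X Y) (J - step_int X Z).
lra.
Qed.

Lemma tau_past_stochastic_increment b : past X s b -> tau (b * (J' - J)) = 0.
Proof.
move=> Fb; apply: Normc.eq0_normc; apply/eqP; rewrite eq_le cnorm_ge0 andbT.
have b0 := norm2_ge0 b.
have b1 : 0 < norm2 b + 1 by lra.
apply/ler_addgt0Pr => e e0; rewrite add0r.
have [L [LL _ JL]] := stochastic_increment_lists (divr_gt0 e0 b1).
have L0 : tau (b * step_int X L) = 0.
  rewrite /step_int mulr_sumr tau_sum big_seq big1 // => f /LL[sf ff _ Ff].
  rewrite mulrA tau_past_incr // ?(le_trans s0) //.
  by apply: (ssubM (past_ssub X f.1.1)) => //; exact: past_mono Fb.
rewrite -[J' - J](subrK (step_int X L)) mulrDr tauD L0 addr0.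
apply: (le_trans (cnorm_tauM _ _)).
apply: (@le_trans _ _ (norm2 b * (e / (norm2 b + 1)))); first by rewrite ler_wpM2l.
by rewrite mulrA ler_pdivrMr //; nra.
Qed.

(** The left side is the integral of [U r - U s] over [[s, t]], of squared norm at most
    [eps^2 (t - s)] by the isometry; the factor 4 is the price of two uses of
    [(a + b)^2 <= 2 a^2 + 2 b^2]. *)
Lemma norm2_stochastic_increment (eps : R) : 0 <= eps ->
  (forall r, s <= r -> r <= t -> norm2 (U r - U s) <= eps) ->
  norm2 (J' - J - U s * (X t - X s)) ^+ 2 <= 4 * eps ^+ 2 * (t - s).
Proof.
move=> eps0 Ueps; apply/ler_addgt0Pr => e e0.
(* The approximation costs [6 d^2] in total, and [d <= 1] bounds it by [6 d <= e]. *)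
pose d := Num.min 1 (e / 6).
have d0 : 0 < d by rewrite lt_min ltr01 divr_gt0.
have d1 : d <= 1 by rewrite ge_min lexx.
have d2 : d <= e / 6 by rewrite ge_min lexx orbT.
have [L [LL Lint JL]] := stochastic_increment_lists d0.
pose K := L ++ [:: (s, t, - U s)].
have KL : adapted X s t K.
  apply: adapted_cat => // f; rewrite inE => /eqP ->; split=> //=.
  exact: (ssubN (past_ssub X s) (U_past s0)).
(* The endpoint [t + 1] makes this process equal to [U s] on the whole closed interval, although
   pieces are half-open. *)
have Us_int : (\int[mu]_(r in `[s, t]) (norm2 (U r - step [:: (s, t + 1, U s)] r) ^+ 2)%:E
    <= (eps ^+ 2 * (t - s))%:E)%E.
  have -> : (eps ^+ 2 * (t - s))%:E = (\int[mu]_(r in `[s, t]) (cst (eps ^+ 2)%:E) r)%E.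
    rewrite integral_cst // EFinM; congr (_ * _)%E; apply: esym.
    apply: (etrans (lebesgue_measure_itv _)); rewrite /= lte_fin.
    by case: ltgtP st => // <- _; rewrite subrr.
  apply: ge0_le_integral => //.
  - by move=> r _; rewrite lee_fin sqr_ge0.
  - exact: step_dist_measurable.
  - move=> r; rewrite /= in_itv /= => /andP[sr rt].
    rewrite /step big_mkcond big_seq1 in_itv /= sr (le_lt_trans rt) ?ltrDl //=.
    by rewrite lee_fin ler_sqr_nneg ?norm2_ge0 // Ueps.
have K2 : norm2 (step_int X K) ^+ 2 <= 2 * d ^+ 2 + 2 * (eps ^+ 2 * (t - s)).
  apply: (step_integral_le s0 _ KL Lint Us_int) => r sr rt.
  have [rlt|tr] := ltP r t; last first.
    have rE : r = t by apply: le_anti; rewrite rt tr.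
    have -> : step K r = 0.
      rewrite /step big_seq_cond big1 // => f /andP[/KL[_ _ ft _]].
      by rewrite in_itv /= rE [t < _]ltNge ft andbF.
    by rewrite norm2_0 expr0n /= addr_ge0 // mulr_ge0 // sqr_ge0.
  have -> : step K r = step L r - step [:: (s, t + 1, U s)] r.
    rewrite step_cat; congr (_ + _).
    rewrite /step !(big_mkcond (fun e => r \in _)) !big_seq1 !in_itv /= sr rlt /=.
    by rewrite (lt_trans rlt) ?ltrDl.
  exact: norm2_sqr_sub.
have -> : J' - J - U s * (X t - X s) = (J' - J - step_int X L) + step_int X K.
  by rewrite step_int_cat addrA subrK /step_int big_seq1 mulNr.
apply: (le_trans (norm2_sqrD _ _)).
have := ler_sqr_nneg (norm2_ge0 _) JL.
have : d ^+ 2 <= d by rewrite expr2 ler_piMr // ltW.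
lra.
Qed.

End Increment.

End StochasticIncrement.

(** * Increments of the time integral *)

Section TimeIncrement.
Variable R : realType.
Local Notation mu := (@lebesgue_measure R).

Lemma Rintegral_increment (g : R -> R) (s t d : R) : 0 <= s -> s <= t ->
  {within `[0, t], continuous g} ->
  (forall r, s <= r -> r <= t -> `|g r - g s| <= d) ->
  `|\int[mu]_(r in `[0, t]) g r - \int[mu]_(r in `[0, s]) g r - (t - s) * g s| <= d * (t - s).
Proof.
move=> s0 st gc gd.
have gi : mu.-integrable `[0, t] (EFin \o g).
  by apply: continuous_compact_integrable => //; exact: segment_compact.
have gi' : mu.-integrable `]s, t] (EFin \o g).
  apply: integrableS gi => // r /=; rewrite !in_itv /= => /andP[sr ->].
  by rewrite (le_trans s0) // ltW.
rewrite Rintegral_itvB ?bnd_simp //.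
have ci c : mu.-integrable `]s, t] (EFin \o cst c).
  have c0 : mu.-integrable `[0, t] (EFin \o cst c).
    apply: continuous_compact_integrable => //; first exact: segment_compact.
    by apply: continuous_subspaceT => x; exact: cvg_cst.
  apply: integrableS c0 => // r /=; rewrite !in_itv /= => /andP[sr ->].
  by rewrite (le_trans s0) // ltW.
have cint c : \int[mu]_(r in `]s, t]) (cst c) r = c * (t - s).
  rewrite Rintegral_cst // -[X in _ = _ * X]/(fine (t - s)%:E); congr (_ * fine _).
  apply: (etrans (lebesgue_measure_itv _)); rewrite /= lte_fin.
  by case: ltgtP st => // <- _; rewrite subrr.
have lo : (g s - d) * (t - s) <= \int[mu]_(r in `]s, t]) g r.
  rewrite -cint; apply: le_Rintegral => // r /=; rewrite in_itv /= => /andP[sr rt].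
  by have := gd r (ltW sr) rt; rewrite ler_norml; lra.
have hi : \int[mu]_(r in `]s, t]) g r <= (g s + d) * (t - s).
  rewrite -cint; apply: le_Rintegral => // r /=; rewrite in_itv /= => /andP[sr rt].
  by have := gd r (ltW sr) rt; rewrite ler_norml; lra.
move: lo hi; move: (\int[mu]_(r in `]s, t]) g r) (g s) => I c.
by move=> lo hi; rewrite ler_norml; apply/andP; split; lra.
Qed.

Variables (A : tracialSpace R) (U : R -> A).
Hypothesis U_cont : forall t, 0 <= t ->
  opnorm (U s - U t) @[s --> within [set s | 0 <= s] (nbhs t)] --> (0 : R).

Let coef x y r := hdot (hspace A) (act (U r) x) y.

Let coef_dist x y r s : cnorm (coef x y r - coef x y s) <=
  opnorm (U r - U s) * (hnorm x * hnorm y).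
Proof.
have -> : coef x y r - coef x y s = hdot (hspace A) (act (U r - U s) x) y.
  by rewrite actB linearBl.
by rewrite (le_trans (hdot_cauchy_schwarz _ _)) // mulrA ler_wpM2r ?hnorm_ge0 // hnorm_act.
Qed.

Let coef_continuous (h : R[i] -> R) x y t :
  (forall z w, `|h z - h w| <= cnorm (z - w)) ->
  {within `[0, t], continuous (fun r => h (coef x y r))}.
Proof.
move=> hL; apply/subspace_continuousP => s /=; rewrite in_itv /= => /andP[s0 sT].
have N0 : 0 <= hnorm x * hnorm y by rewrite mulr_ge0 // hnorm_ge0.
apply/cvgrPdist_le => e e0.
have e1 : 0 < e / (hnorm x * hnorm y + 1) by rewrite divr_gt0 // ltr_wpDl.
have /cvgrPdist_lt /(_ _ e1) := U_cont s0.
rewrite !near_withinE /=; apply: filterS => r rP; rewrite in_itv /= => /andP[r0 _].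
have := rP r0; rewrite sub0r normrN ger0_norm ?opnorm_ge0 // => /ltW re.
rewrite distrC (le_trans (hL _ _)) // (le_trans (coef_dist _ _ _ _)) //.
apply: (le_trans (ler_wpM2r N0 re)).
by rewrite mulrAC ler_pdivrMr ?ltr_wpDl //; nra.
Qed.

(** The time integral is known only through its matrix coefficients; the choice [y = D x] recovers
    the operator norm. The factor 2 comes from estimating real and imaginary parts separately. *)
Lemma opnorm_time_increment (s t eps : R) (K K' : A) : 0 <= s -> s <= t ->
  is_time_integral U s K -> is_time_integral U t K' ->
  (forall r, s <= r -> r <= t -> opnorm (U r - U s) <= eps) ->
  opnorm (K' - K - (t - s)%:C%C *: U s) <= 2 * eps * (t - s).
Proof.
move=> s0 st hK hK' Ueps; set D := _ - _ - _.
have eps0 : 0 <= eps by apply: (le_trans (opnorm_ge0 (U s - U s))); exact: Ueps.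
have Dxy x y : cnorm (hdot (hspace A) (act D x) y) <= 2 * eps * (t - s) * (hnorm x * hnorm y).
  have -> : hdot (hspace A) (act D x) y = hdot (hspace A) (act K' x) y
      - hdot (hspace A) (act K x) y - (t - s)%:C%C * coef x y s.
    by rewrite /D !actB actZ !linearBl /= linearZl_LR.
  have Uxy (h : R[i] -> R) : (forall z w, `|h z - h w| <= cnorm (z - w)) ->
      `|\int[mu]_(r in `[0, t]) h (coef x y r) - \int[mu]_(r in `[0, s]) h (coef x y r)
        - (t - s) * h (coef x y s)| <= eps * (hnorm x * hnorm y) * (t - s).
    move=> hL; apply: (Rintegral_increment (g := fun r => h (coef x y r))) => //.
      exact: coef_continuous.
    move=> r sr rt; rewrite (le_trans (hL _ _)) // (le_trans (coef_dist _ _ _ _)) //.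
    by rewrite ler_wpM2r ?mulr_ge0 ?hnorm_ge0 // Ueps.
  have ReL (z w : R[i]) : `|complex.Re z - complex.Re w| <= cnorm (z - w).
    by rewrite -ReN -ReD; exact: cnorm_Re.
  have ImL (z w : R[i]) : `|complex.Im z - complex.Im w| <= cnorm (z - w).
    by rewrite -ImN -ImD; exact: cnorm_Im.
  have -> : 2 * eps * (t - s) * (hnorm x * hnorm y) =
      eps * (hnorm x * hnorm y) * (t - s) + eps * (hnorm x * hnorm y) * (t - s) by ring.
  apply: le_trans (lerD (Uxy _ ReL) (Uxy _ ImL)); rewrite hK hK'.
  by apply: (le_trans (cnorm_ReIm _)); rewrite !ReD !ReN !ImD !ImN Re_realM Im_realM.
apply: opnorm_le => [|x]; first by rewrite !mulr_ge0 // subr_ge0.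
have [->|n0] := eqVneq (hnorm (act D x)) 0.
  by rewrite !mulr_ge0 ?hnorm_ge0 // subr_ge0.
have np : 0 < hnorm (act D x) by rewrite lt_neqAle eq_sym n0 hnorm_ge0.
rewrite -(ler_pM2r np) -expr2 hnorm_sqr (le_trans (ler_norm _)) //.
by rewrite (le_trans (cnorm_Re _)) // -[leRHS]mulrA.
Qed.

End TimeIncrement.

(** * Free Ito calculus *)

Section NearIncrements.
Variables (R : realType).

(** Both endpoints vary near [t]: expansions run forward from [s], so the left derivative at [t]
    requires increments that end at [t] rather than start there. *)
Definition near_incr (t : R) (P : R -> R -> Prop) :=
  exists2 d : R, 0 < d & forall s s', 0 <= s -> t - d < s -> s <= s' -> s' < t + d -> P s s'.

Lemma near_incr_and t P Q : near_incr t P -> near_incr t Q ->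
  near_incr t (fun s s' => P s s' /\ Q s s').
Proof.
move=> [d d0 dP] [e e0 eQ]; exists (Num.min d e); first by rewrite lt_min d0.
move=> s s' s0 ts ss' s't.
have md : Num.min d e <= d by rewrite ge_min lexx.
have me : Num.min d e <= e by rewrite ge_min lexx orbT.
by split; [apply: dP|apply: eQ] => //; lra.
Qed.

Lemma near_incr_sub t (P Q : R -> R -> Prop) :
  (forall s s', 0 <= s -> s <= s' -> P s s' -> Q s s') ->
  near_incr t P -> near_incr t Q.
Proof.
move=> PQ [d d0 dP]; exists d => // s s' s0 ts ss' s't.
by apply: PQ => //; exact: dP.
Qed.

Lemma near_incr_small t (e : R) : 0 < e -> near_incr t (fun s s' => s' - s <= e).
Proof. by move=> e0; exists (e / 2); [rewrite divr_gt0|move=> s s' *; lra]. Qed.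

Lemma near_incr_derive (f : R -> R) (t l : R) : 0 < t ->
  (forall e, 0 < e -> near_incr t (fun s s' => `|f s' - f s - (s' - s) * l| <= e * (s' - s))) ->
  is_derive t 1 f l.
Proof.
move=> t0 fl.
have lim : h^-1 *: ((f \o shift t) (h *: (1 : R^o)) - f t) @[h --> (0 : R)^'] --> (l : R^o).
  apply/cvgrPdist_le => e e0; have [d d0 dP] := fl _ e0.
  near=> h.
  have h0 : h != 0 by near: h; exact: nbhs_dnbhs_neq.
  have [hd ht] : `|h| < d /\ `|h| < t.
    split; near: h; apply: dnbhs0_lt => //.
  rewrite /= /GRing.scale /= mulr1.
  have -> : l - h^-1 * (f (h + t) - f t) = - ((f (h + t) - f t - h * l) / h) by field.
  rewrite normrN normrM normfV ler_pdivrMr ?normr_gt0 //.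
  have [hp|hn] := ltP 0 h.
    rewrite (ger0_norm (ltW hp)) in hd *.
    by have := dP t (h + t); rewrite addrK => dPh; apply: dPh; lra.
  have hlt : h < 0 by rewrite lt_neqAle h0.
  rewrite (ltr0_norm hlt) in hd ht *.
  have := dP (h + t) t; rewrite opprD addrCA subrr addr0 => dPh.
  have -> : f (h + t) - f t - h * l = - (f t - f (h + t) - - h * l) by ring.
  by rewrite normrN; apply: dPh; lra.
have dv : derivable f t 1 by apply/cvg_ex; exists l.
by apply: DeriveDef => //; rewrite /derive; apply: cvg_lim.
Unshelve. all: by end_near. Qed.

Variable A : vonNeumannAlgebra R.
Implicit Types f g : R -> A.

Definition norm_continuous (t : R) f := forall e : R, 0 < e ->
  exists2 d : R, 0 < d & forall s, 0 <= s -> `|s - t| < d -> opnorm (f s - f t) <= e.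

Lemma norm_continuous_cst t (a : A) : norm_continuous t (fun=> a).
Proof.
by move=> e e0; exists 1 => // s _ _; rewrite subrr opnorm0 ltW.
Qed.

Lemma norm_continuousD t f g : norm_continuous t f -> norm_continuous t g ->
  norm_continuous t (fun s => f s + g s).
Proof.
move=> cf cg e e0; have e2 : 0 < e / 2 by rewrite divr_gt0.
have [d d0 dP] := cf _ e2; have [d' d'0 d'P] := cg _ e2.
exists (Num.min d d'); first by rewrite lt_min d0.
move=> s s0; rewrite lt_min => /andP[sd sd'].
rewrite opprD addrACA (le_trans (opnormD _ _)) //.
by have := dP _ s0 sd; have := d'P _ s0 sd'; lra.
Qed.

Lemma norm_continuous_bounded t f : norm_continuous t f ->
  exists M : R, [/\ 0 <= M, opnorm (f t) <= M & exists2 d : R, 0 < d &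
    forall s, 0 <= s -> `|s - t| < d -> opnorm (f s) <= M].
Proof.
move=> /(_ _ ltr01)[d d0 dP]; exists (opnorm (f t) + 1).
have f0 := opnorm_ge0 (f t).
split; [lra|lra|exists d => // s s0 sd].
rewrite -[f s](subrK (f t)) (le_trans (opnormD _ _)) // addrC lerD2l.
exact: dP.
Qed.

Lemma norm_continuousM t f g : norm_continuous t f -> norm_continuous t g ->
  norm_continuous t (fun s => f s * g s).
Proof.
move=> cf cg e e0.
have [M [M0 Mt [b b0 fM]]] := norm_continuous_bounded cf.
have [N [N0 Nt [b' b'0 gN]]] := norm_continuous_bounded cg.
have MN : 0 < M + N + 1 by lra.
have [d d0 dP] := cf _ (divr_gt0 e0 MN); have [d' d'0 d'P] := cg _ (divr_gt0 e0 MN).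
exists (Num.min b (Num.min d d')); first by rewrite !lt_min b0 d0.
move=> s s0; rewrite !lt_min => /and3P[sb sd sd'].
have -> : f s * g s - f t * g t = f s * (g s - g t) + (f s - f t) * g t.
  by rewrite mulrBr mulrBl addrA subrK.
have e' : (M + N + 1) * (e / (M + N + 1)) = e by field; rewrite gt_eqF.
rewrite (le_trans (opnormD _ _)) //.
have h1 := ler_pM (opnorm_ge0 _) (opnorm_ge0 _) (fM _ s0 sb) (d'P _ s0 sd').
have h2 := ler_pM (opnorm_ge0 _) (opnorm_ge0 _) (dP _ s0 sd) Nt.
have := opnormM (f s) (g s - g t); have := opnormM (f s - f t) (g t).
have := divr_gt0 e0 MN; move: (e / _) e' h1 h2 => k e' h1 h2 k0.
move: h1 h2; move: (opnorm (f s - f t) * opnorm _) (opnorm (f s) * _) => u v *.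
nra.
Qed.

Lemma norm_continuousZ t (c : R[i]) f : norm_continuous t f ->
  norm_continuous t (fun s => c *: f s).
Proof.
move=> cf e e0; have c0 := cnorm_ge0 c.
have c1 : 0 < cnorm c + 1 by lra.
have [d d0 dP] := cf _ (divr_gt0 e0 c1); exists d => // s s0 sd.
rewrite -scalerBr (le_trans (opnormZ _ _)) //.
apply: (le_trans (ler_wpM2l c0 (dP _ s0 sd))).
by rewrite mulrA ler_pdivrMr //; nra.
Qed.

Lemma norm_continuous_adj t f : norm_continuous t f ->
  norm_continuous t (fun s => adj (f s)).
Proof.
move=> cf e e0; have [d d0 dP] := cf _ e0; exists d => // s s0 sd.
by rewrite -adjN -adjD opnorm_adj; exact: dP.
Qed.

Lemma norm_continuous_incr t f e : 0 < e -> norm_continuous t f ->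
  near_incr t (fun s s' => opnorm (f s' - f s) <= e).
Proof.
move=> e0 cf; have e2 : 0 < e / 2 by rewrite divr_gt0.
have [d d0 dP] := cf _ e2; exists d => // s s' s0 ts ss' s't.
have -> : f s' - f s = (f s' - f t) - (f s - f t) by rewrite opprB addrA subrK.
rewrite (le_trans (opnormB _ _)) //.
have := dP s s0; have := dP s' (le_trans s0 ss'); rewrite !ltr_norml.
by move=> h1 h2; have := h1 ltac:(apply/andP; split; lra); have := h2 ltac:(apply/andP; split; lra); lra.
Qed.

Lemma norm_continuous_near_bounded t f : norm_continuous t f ->
  exists2 M : R, 0 <= M & near_incr t (fun s _ => opnorm (f s) <= M).
Proof.
move=> /norm_continuous_bounded[M [M0 _ [d d0 dP]]]; exists M => //.
exists d => // s s' s0 ts ss' s't; apply: dP => //.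
by rewrite ltr_norml; apply/andP; split; lra.
Qed.

End NearIncrements.

(** * Formal Ito differentials and their product *)

Section ItoData.
Variables (R : realType) (A : tracialSpace R) (I : eqType).

(* Formal Ito differential dZ = sum_n p_n dX_(i_n) q_n + drift dt. *)
Record itoData := ItoData {
  proc : R -> A;
  noise : seq (I * ((R -> A) * (R -> A)));
  drift : R -> A }.
Implicit Types (D E F : itoData) (S T : seq (I * ((R -> A) * (R -> A)))).

Definition noise_mull (z : R -> A) S :=
  [seq (n.1, (fun s => z s * n.2.1 s, n.2.2)) | n <- S].

Definition noise_mulr (z : R -> A) S :=
  [seq (n.1, (n.2.1, fun s => n.2.2 s * z s)) | n <- S].

Definition bracket S T (s : R) : A := \sum_(m <- S) \sum_(n <- T | m.1 == n.1)
  tau (m.2.2 s * n.2.1 s) *: (m.2.1 s * n.2.2 s).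

Lemma bracket_catl S S' T s : bracket (S ++ S') T s = bracket S T s + bracket S' T s.
Proof. by rewrite /bracket big_cat. Qed.

Lemma bracket_catr S T T' s : bracket S (T ++ T') s = bracket S T s + bracket S T' s.
Proof. by rewrite /bracket -big_split; apply: eq_bigr => m _; rewrite big_cat. Qed.

Lemma bracket_nill T s : bracket [::] T s = 0. Proof. by rewrite /bracket big_nil. Qed.

Lemma bracket_nilr S s : bracket S [::] s = 0.
Proof. by rewrite /bracket big1 // => m _; rewrite big_nil. Qed.

Lemma bracket_mull z S T s : bracket (noise_mull z S) T s = z s * bracket S T s.
Proof.
rewrite /bracket big_map mulr_sumr; apply: eq_bigr => m _ /=.
by rewrite mulr_sumr; apply: eq_bigr => n _; rewrite -mulrA scalerAr.
Qed.

Lemma bracket_mulr z S T s : bracket S (noise_mulr z T) s = bracket S T s * z s.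
Proof.
rewrite /bracket mulr_suml; apply: eq_bigr => m _.
by rewrite big_map mulr_suml; apply: eq_bigr => n _ /=; rewrite mulrA scalerAl.
Qed.

Lemma bracket_mid z S T s : bracket (noise_mulr z S) T s = bracket S (noise_mull z T) s.
Proof.
rewrite /bracket big_map; apply: eq_bigr => m _ /=.
by rewrite big_map; apply: eq_bigr => n _ /=; rewrite mulrA.
Qed.

Definition ito_cst (a : A) := ItoData (fun=> a) [::] (fun=> 0).

(* The free Ito product formula, with dX_i a dX_j = [i = j] tau(a) dt. *)
Definition ito_mul D E := ItoData (fun s => proc D s * proc E s)
  (noise_mulr (proc E) (noise D) ++ noise_mull (proc D) (noise E))
  (fun s => drift D s * proc E s + proc D s * drift E s + bracket (noise D) (noise E) s).

(** Associativity is an equality of records, so words can be regrouped with the big-operator lemmas.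
    Its core is [bracket_mid]: a factor between two noises may be attached to either of them. *)
Lemma ito_mulA : associative ito_mul.
Proof.
move=> D E F; congr ItoData.
- by apply/funext => s /=; rewrite mulrA.
- rewrite /noise_mulr /noise_mull /= !map_cat -!map_comp -catA.
  congr (_ ++ _); last congr (_ ++ _).
  + apply: eq_map => -[i [p q]] /=; congr (_, (_, _)).
    by apply/funext => s; rewrite mulrA.
  + apply: eq_map => -[i [p q]] /=; congr (_, (_, _)).
    by apply/funext => s; rewrite mulrA.
- apply/funext => s /=.
  rewrite bracket_catl bracket_catr bracket_mid bracket_mull bracket_mulr.
  rewrite !mulrDl !mulrDr !mulrA.
  by rewrite [LHS](AC (1*3*2) ((1*2*5)*3*(6*4)))%AC.
Qed.

Lemma ito_mul1 : left_id (ito_cst 1) ito_mul.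
Proof.
case=> z S d; congr ItoData => /=.
- by apply/funext => s /=; rewrite mul1r.
- rewrite -[RHS]map_id; apply: eq_map => -[i [p q]] /=; congr (_, (_, _)).
  by apply/funext => s; rewrite mul1r.
- by apply/funext => s; rewrite mul0r mul1r add0r bracket_nill addr0.
Qed.

Lemma ito_muld1 : right_id (ito_cst 1) ito_mul.
Proof.
case=> z S d; congr ItoData => /=.
- by apply/funext => s /=; rewrite mulr1.
- rewrite cats0 -[RHS]map_id; apply: eq_map => -[i [p q]] /=; congr (_, (_, _)).
  by apply/funext => s; rewrite mulr1.
- by apply/funext => s; rewrite mulr0 mulr1 addr0 bracket_nilr addr0.
Qed.

HB.instance Definition _ := Monoid.isLaw.Build itoData (ito_cst 1) ito_mul ito_mulA ito_mul1 ito_muld1.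

Definition ito_adj D := ItoData (fun s => adj (proc D s))
  [seq (n.1, (fun s => adj (n.2.2 s), fun s => adj (n.2.1 s))) | n <- noise D]
  (fun s => adj (drift D s)).

(** The noise is unchanged because the trace of the process has no martingale part: its differential
    is the trace of the drift. *)
Definition ito_centered D := ItoData (fun s => centered (proc D s)) (noise D)
  (fun s => centered (drift D s)).

Definition ito_add D E := ItoData (fun s => proc D s + proc E s) (noise D ++ noise E)
  (fun s => drift D s + drift E s).

End ItoData.

(** * Processes with an Ito expansion driven by one Brownian motion *)

Section ItoProcess.
Variables (R : realType) (A : tracialSpace R) (I : eqType) (X : R -> A) (j : I) (t : R).
Hypothesis hX : free_additive_BM X.
Local Notation itoData := (itoData A I).
Implicit Types (D E : itoData).

Definition noise_incr (S : seq (I * ((R -> A) * (R -> A)))) (s s' : R) : A :=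
  \sum_(n <- S) n.2.1 s * (X s' - X s) * n.2.2 s.

Definition ito_error D (s s' : R) : A :=
  proc D s' - proc D s - noise_incr (noise D) s s' - (s' - s)%:C%C *: drift D s.

(* The L^2 bound keeps products of increments negligible; the bound against the
   past is the one that differentiates traces. *)
Definition negligible (e : R -> R -> A) := forall c : R, 0 < c -> near_incr t (fun s s' =>
  norm2 (e s s') <= c * Num.sqrt (s' - s) /\
  forall b, past X s b -> cnorm (tau (b * e s s')) <= c * (s' - s) * opnorm b).

Definition regular (f : R -> A) :=
  (forall s, 0 <= s -> past X s (f s)) /\ norm_continuous t f.

(** All noise carries the single index [j]: true expansions are only established for one Brownian
    motion at a time. *)
Fixpoint regular_noise (S : seq (I * ((R -> A) * (R -> A)))) :=
  if S is n :: S' then [/\ n.1 = j, regular n.2.1, regular n.2.2 & regular_noise S'] else True.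

Record is_ito D : Prop := IsIto {
  ito_proc : regular (proc D);
  ito_noise : regular_noise (noise D);
  ito_drift : regular (drift D);
  ito_negl : negligible (ito_error D) }.

Lemma regularM f g : regular f -> regular g -> regular (fun s => f s * g s).
Proof.
move=> [Ff cf] [Fg cg]; split; last exact: norm_continuousM.
by move=> s s0; apply: (ssubM (past_ssub X s)); [exact: Ff|exact: Fg].
Qed.

Lemma regularD f g : regular f -> regular g -> regular (fun s => f s + g s).
Proof.
move=> [Ff cf] [Fg cg]; split; last exact: norm_continuousD.
by move=> s s0; apply: (ssubD (past_ssub X s)); [exact: Ff|exact: Fg].
Qed.

Lemma regularZ c f : regular f -> regular (fun s => c *: f s).
Proof.
move=> [Ff cf]; split; last exact: norm_continuousZ.
by move=> s s0; apply: (ssubZ (past_ssub X s)); exact: Ff.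
Qed.

Lemma regular_adj f : regular f -> regular (fun s => adj (f s)).
Proof.
move=> [Ff cf]; split; last exact: norm_continuous_adj.
by move=> s s0; apply: (ssub_adj (past_ssub X s)); exact: Ff.
Qed.

Lemma regular_cst c : regular (fun=> c%:A).
Proof.
split; last exact: norm_continuous_cst.
by move=> s s0; apply: (ssubZ (past_ssub X s)); exact: (ssub1 (past_ssub X s)).
Qed.

Lemma regular_tau f : regular f -> regular (fun s => (tau (f s))%:A).
Proof.
move=> [Ff cf]; split=> [s s0|e e0].
  by apply: (ssubZ (past_ssub X s)); exact: (ssub1 (past_ssub X s)).
have [d d0 dP] := cf _ e0; exists d => // s s0 sd.
rewrite -scalerBl -tauB (le_trans (opnormZ _ _)) //.
apply: (le_trans (ler_wpM2l (cnorm_ge0 _) (opnorm1 A))); rewrite mulr1.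
exact: le_trans (cnorm_tau_opnorm _) (dP _ s0 sd).
Qed.

Lemma regular_centered f : regular f -> regular (fun s => centered (f s)).
Proof.
move=> rf; have := regularD rf (regularZ (-1) (regular_tau rf)).
by under eq_fun do rewrite scaleN1r.
Qed.

Lemma regular_noise_cat S T : regular_noise S -> regular_noise T -> regular_noise (S ++ T).
Proof. by elim: S => //= n S IH [nj rp rq rS] rT; split=> //; exact: IH. Qed.

Lemma regular_noise_mull z S : regular z -> regular_noise S -> regular_noise (noise_mull z S).
Proof.
by move=> rz; elim: S => //= n S IH [nj rp rq rS]; split=> //; [exact: regularM|exact: IH].
Qed.

Lemma regular_noise_mulr z S : regular z -> regular_noise S -> regular_noise (noise_mulr z S).
Proof.
by move=> rz; elim: S => //= n S IH [nj rp rq rS]; split=> //; [exact: regularM|exact: IH].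
Qed.

Lemma regular_bracket S T : regular_noise S -> regular_noise T -> regular (bracket S T).
Proof.
move=> rS rT; rewrite /bracket; elim: S rS => [_|m S IH /= [_ rp rq rS]].
  by under eq_fun do rewrite big_nil -(scale0r 1); exact: regular_cst.
under eq_fun do rewrite big_cons; apply: regularD; last exact: IH.
elim: T rT {IH} => [_|n T IH /= [_ rp' rq' rT]].
  by under eq_fun do rewrite big_nil -(scale0r 1); exact: regular_cst.
under eq_fun do rewrite big_cons; case: (m.1 == n.1); last exact: IH.
apply: regularD; last exact: IH.
have := regularM (regular_tau (regularM rq rp')) (regularM rp rq').
by under eq_fun do rewrite -scalerAl mul1r.
Qed.

Lemma noise_incr_cat S T s s' :
  noise_incr (S ++ T) s s' = noise_incr S s s' + noise_incr T s s'.
Proof. by rewrite /noise_incr big_cat. Qed.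

Lemma noise_incr_mull z S s s' :
  noise_incr (noise_mull z S) s s' = z s * noise_incr S s s'.
Proof.
by rewrite /noise_incr big_map mulr_sumr; apply: eq_bigr => n _ /=; rewrite !mulrA.
Qed.

Lemma noise_incr_mulr z S s s' :
  noise_incr (noise_mulr z S) s s' = noise_incr S s s' * z s.
Proof.
by rewrite /noise_incr big_map mulr_suml; apply: eq_bigr => n _ /=; rewrite !mulrA.
Qed.

Lemma norm2_incr s s' : 0 <= s -> s <= s' -> norm2 (X s' - X s) = Num.sqrt (s' - s).
Proof. by move=> s0 ss'; rewrite /norm2 adj_incr // incr_variance. Qed.

Lemma norm2_noise_incr S : regular_noise S -> exists2 M : R, 0 <= M &
  near_incr t (fun s s' => norm2 (noise_incr S s s') <= M * Num.sqrt (s' - s)).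
Proof.
elim: S => [_|n S IH /= [_ [_ cp] [_ cq] /IH[M M0 nM]]].
  exists 0 => //; exists 1 => // s s' *.
  by rewrite /noise_incr big_nil norm2_0 mul0r.
have [P P0 nP] := norm_continuous_near_bounded cp.
have [Q Q0 nQ] := norm_continuous_near_bounded cq.
exists (P * Q + M); first by rewrite addr_ge0 ?mulr_ge0.
apply: near_incr_sub (near_incr_and nM (near_incr_and nP nQ)) => s s' s0 ss' [h1 [h2 h3]].
rewrite /noise_incr big_cons (le_trans (norm2D _ _)) // mulrDl lerD //.
apply: (le_trans (norm2Mr _ _)); apply: (le_trans (ler_wpM2r (opnorm_ge0 _) (norm2M _ _))).
rewrite norm2_incr // mulrAC ler_wpM2r ?sqrtr_ge0 //.
by rewrite ler_pM ?opnorm_ge0.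
Qed.

Lemma tau_noise_incr S s s' b : regular_noise S -> 0 <= s -> s <= s' -> past X s b ->
  tau (b * noise_incr S s s') = 0.
Proof.
move=> + s0 ss' Fb; rewrite /noise_incr mulr_sumr tau_sum.
elim: S => [|n S IH /= [_ [Fp _] [Fq _] rS]]; first by rewrite big_nil.
rewrite big_cons IH // addr0 2!mulrA tauC mulrA tau_past_incr //.
by apply: (ssubM (past_ssub X s)); [exact: Fq|apply: (ssubM (past_ssub X s)) => //; exact: Fp].
Qed.

(** Traciality moves the last factor in front of [b], which leaves past, increment, past, increment,
    as in [tau_past_incr_incr]. The identity is exact, with no remainder. *)
Lemma tau_noise_incr_mul S T s s' b : regular_noise S -> regular_noise T ->
  0 <= s -> s <= s' -> past X s b ->
  tau (b * (noise_incr S s s' * noise_incr T s s')) = (s' - s)%:C%C * tau (b * bracket S T s).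
Proof.
move=> + + s0 ss' Fb; rewrite /noise_incr /bracket.
have [Dx DxE] : exists d, d = X s' - X s by exists (X s' - X s).
rewrite -DxE; elim: S => [|m S IH /= [mj [Fp _] [Fq _] rS] rT].
  by move=> _ _; rewrite !big_nil !(mul0r, mulr0) tau0 mulr0.
rewrite !big_cons mulrDl !mulrDr !tauD mulrDr IH //; congr (_ + _).
elim: T rT {IH} => [_|n T IH /= [nj [Fp' _] [Fq' _] rT]].
  by rewrite !big_nil !(mul0r, mulr0) tau0 mulr0.
rewrite !big_cons mj nj eqxx !mulrDr !tauD mulrDr -[in X in _ = _ + X]mj IH //; congr (_ + _).
have -> : b * (m.2.1 s * Dx * m.2.2 s * (n.2.1 s * Dx * n.2.2 s)) =
    (b * m.2.1 s * Dx * (m.2.2 s * n.2.1 s) * Dx) * n.2.2 s by rewrite !mulrA.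
rewrite tauC; have -> : n.2.2 s * (b * m.2.1 s * Dx * (m.2.2 s * n.2.1 s) * Dx) =
    n.2.2 s * (b * m.2.1 s) * Dx * (m.2.2 s * n.2.1 s) * Dx by rewrite !mulrA.
have FM x y : past X s x -> past X s y -> past X s (x * y) by exact: (ssubM (past_ssub X s)).
rewrite DxE tau_past_incr_incr //; last 2 first.
- by apply: (FM); [exact: Fq'|apply: (FM) => //; exact: Fp].
- by apply: FM; [exact: Fq|exact: Fp'].
congr (_ * _); rewrite -scalerAr tauZ mulrC; congr (_ * _).
by rewrite tauC mulrA.
Qed.

End ItoProcess.

(** * Stability under adjoints, centering and products *)

Section ItoClosure.
Variables (R : realType) (A : tracialSpace R) (I : eqType) (X : R -> A) (j : I) (t : R).
Hypothesis hX : free_additive_BM X.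
Local Notation itoData := (itoData A I).
Local Notation is_ito := (is_ito X j t).
Local Notation regular := (regular X t).
Local Notation regular_noise := (regular_noise X j t).
Local Notation negligible := (negligible X t).
Implicit Types (D E : itoData).

(** Absorbs the constant accumulated by an estimate; assuming [c <= 1] also lets higher powers of
    [c] be dropped. *)
Lemma negligible_bound (C : R) (e : R -> R -> A) : 0 <= C ->
  (forall c, 0 < c -> c <= 1 -> near_incr t (fun s s' =>
    norm2 (e s s') <= C * c * Num.sqrt (s' - s) /\
    forall b, past X s b -> cnorm (tau (b * e s s')) <= C * c * (s' - s) * opnorm b)) ->
  negligible e.
Proof.
move=> C0 Ce c c0; have C1 : 0 < C + 1 by lra.
pose k := Num.min 1 (c / (C + 1)).
have k0 : 0 < k by rewrite lt_min ltr01 divr_gt0.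
have k1 : k <= 1 by rewrite ge_min lexx.
have Ck : C * k <= c.
  have : k <= c / (C + 1) by rewrite ge_min lexx orbT.
  by rewrite ler_pdivlMr //; nra.
apply: near_incr_sub (Ce _ k0 k1) => s s' s0 ss' [h1 h2]; split=> [|b Fb].
  by rewrite (le_trans h1) // ler_wpM2r // sqrtr_ge0.
by rewrite (le_trans (h2 b Fb)) // ler_wpM2r ?opnorm_ge0 // ler_wpM2r // subr_ge0.
Qed.

Lemma is_ito_cst (c : R[i]) : is_ito (ito_cst I (c%:A : A)).
Proof.
split=> //=; first exact: regular_cst.
  by have := regular_cst X t 0; under eq_fun do rewrite scale0r.
move=> e e0; exists 1 => // s s' _ _ ss' _.
rewrite /ito_error /noise_incr /= big_nil scaler0 !subrr norm2_0; split.
  by rewrite mulr_ge0 ?sqrtr_ge0 // ltW.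
by move=> b _; rewrite mulr0 tau0 cnorm0 !mulr_ge0 ?opnorm_ge0 ?subr_ge0 // ltW.
Qed.

Lemma is_ito_adj D : is_ito D -> is_ito (ito_adj D).
Proof.
move=> [rz rS rd nD]; split => /=; [exact: regular_adj| |exact: regular_adj|].
  by elim: (noise D) rS => //= n S IH [nj rp rq /IH]; split=> //; exact: regular_adj.
move=> c /nD; apply: near_incr_sub => s s' s0 ss' [h1 h2].
have -> : ito_error X (ito_adj D) s s' = adj (ito_error X D s s').
  rewrite /ito_error !adjD !adjN adjZ conjc_real /=; congr (_ - _ - _).
  rewrite /noise_incr adj_sum big_map; apply: eq_bigr => n _ /=.
  by rewrite !adjM (adj_incr hX s0 ss') mulrA.
rewrite norm2_adj; split=> // b Fb.
rewrite -[b]adjK -adjM tau_adj cnorm_conj tauC opnorm_adj.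
by apply: h2; exact: (ssub_adj (past_ssub X s)).
Qed.

Lemma centeredB (a b : A) : centered (a - b) = centered a - centered b.
Proof. by rewrite /centered tauB scalerBl !opprD !opprK addrACA. Qed.

Lemma centeredZ (c : R[i]) (a : A) : centered (c *: a) = c *: centered a.
Proof. by rewrite /centered tauZ scalerBr scalerA. Qed.

Lemma ito_error_centered D s s' : regular_noise (noise D) -> 0 <= s -> s <= s' ->
  ito_error X (ito_centered D) s s' = centered (ito_error X D s s').
Proof.
move=> rS s0 ss'; rewrite /ito_error !centeredB centeredZ.
have N0 : tau (noise_incr X (noise D) s s') = 0.
  by rewrite -[noise_incr _ _ _ _]mul1r (tau_noise_incr hX rS) //; exact: (ssub1 (past_ssub X s)).
by rewrite [centered (noise_incr _ _ _ _)]/centered N0 scale0r subr0.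
Qed.

Lemma is_ito_centered D : is_ito D -> is_ito (ito_centered D).
Proof.
move=> [rz rS rd nD]; split=> //=; [exact: regular_centered|exact: regular_centered|].
apply: (@negligible_bound 2) => // c c0 c1.
apply: near_incr_sub (nD _ c0) => s s' s0 ss' [h1 h2].
rewrite ito_error_centered // /centered.
set e := ito_error X D s s' in h1 h2 *.
have c2 : 2 * c = c + c by rewrite mulr2n mulrDl mul1r.
split=> [|b Fb].
  rewrite c2 mulrDl (le_trans (norm2B _ _)) // lerD // norm2Z norm2_1 mulr1.
  exact: le_trans (cnorm_tau _) h1.
rewrite mulrBr tauB -scalerAr mulr1 tauZ c2 !mulrDl (le_trans (cnormB _ _)) // lerD ?h2 //.
rewrite cnormM ler_pM ?cnorm_ge0 ?cnorm_tau_opnorm //.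
have := h2 1 (ssub1 (past_ssub X s)); rewrite mul1r => /le_trans; apply.
by rewrite ler_piMr ?opnorm1 // mulr_ge0 ?subr_ge0 // ltW.
Qed.

(** A discrete Leibniz rule. It isolates the product of the two increments, which the bracket has to
    compensate. *)
Lemma ito_error_mul D E s s' : ito_error X (ito_mul D E) s s' =
  ito_error X D s s' * proc E s + proc D s * ito_error X E s s'
  + ((proc D s' - proc D s) * (proc E s' - proc E s)
     - (s' - s)%:C%C *: bracket (noise D) (noise E) s).
Proof.
rewrite /ito_error /= noise_incr_cat noise_incr_mull noise_incr_mulr.
move: (proc D s) (proc E s) (proc D s') (proc E s') => z w z' w'.
move: (noise_incr X (noise D) s s') (noise_incr X (noise E) s s') => S T.
move: (drift D s) (drift E s) (bracket _ _ _) ((s' - s)%:C%C) => d f B h.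
have -> : z' * w' - z * w = (z' - z) * w + z * (w' - w) + (z' - z) * (w' - w).
  by rewrite addrAC -mulrDr [w + _]addrC subrK mulrBl mulrBr addrA subrK.
move: (z' - z) (w' - w) => P Q.
rewrite !mulrBl !mulrBr -!scalerAl -!scalerAr !scalerDr !opprD !addrA.
by rewrite [LHS](ACl (1*4*6*2*5*7*3*8))%AC.
Qed.

Lemma is_ito_mul D E : is_ito D -> is_ito E -> is_ito (ito_mul D E).
Proof.
move=> [rz rS rd nD] [rw rT rf nE]; split=> /=.
- exact: regularM.
- by apply: regular_noise_cat; [exact: regular_noise_mulr|exact: regular_noise_mull].
- apply: regularD; last exact: (regular_bracket rS rT).
  by apply: regularD; exact: regularM.
have rB := regular_bracket rS rT.
have [M1 M10 nz] := norm_continuous_near_bounded rz.2.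
have [M2 M20 nw] := norm_continuous_near_bounded rw.2.
have [M3 M30 nd] := norm_continuous_near_bounded rd.2.
have [M4 M40 nf] := norm_continuous_near_bounded rf.2.
have [M5 M50 nB] := norm_continuous_near_bounded rB.2.
have [M6 M60 nS] := norm2_noise_incr hX rS.
have [M7 M70 nT] := norm2_noise_incr hX rT.
have [M M0 [l1 l2 l3 [l4 l5 l6 l7]]] : exists2 M : R, 0 <= M &
    [/\ M1 <= M, M2 <= M, M3 <= M & [/\ M4 <= M, M5 <= M, M6 <= M & M7 <= M]].
  exists (Num.max M1 (Num.max M2 (Num.max M3 (Num.max M4 (Num.max M5 (Num.max M6 M7)))))).
    by rewrite le_max M10.
  by split; [..|split]; rewrite !le_max lexx ?orbT.
(* Dominates both requirements: [5 M + 1] for the L^2 bound, and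
   [2 M + M (1 + M) + (1 + M) (2 M + 1)] for the bound against the past. *)
apply: (@negligible_bound (7 * M + 1 + M * (1 + M) + (1 + M) * (2 * M + 1))).
  by rewrite !addr_ge0 ?mulr_ge0 ?addr_ge0 ?mulr_ge0.
move=> c c0 c1.
have nzc := norm_continuous_incr c0 rz.2.
(* Then [r = (s' - s)^(1/2) <= c], so a drift term of order [s' - s = r^2] is at most [c r]. *)
have nh : near_incr t (fun s s' : R => s' - s <= c ^+ 2).
  by apply: near_incr_small; exact: exprn_gt0.
apply: near_incr_sub (near_incr_and (near_incr_and (near_incr_and nz nw) (near_incr_and nd nf))
  (near_incr_and (near_incr_and nB (near_incr_and nS nT))
  (near_incr_and (near_incr_and (nD _ c0) (nE _ c0)) (near_incr_and nzc nh)))) => s s' s0 ss'.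
move=> [[[hz hw] [hd hf]] [[hB [hS hT]] [[[hD hD'] [hE hE']] [hzc hh]]]].
rewrite ito_error_mul.
set z := proc D s in hz hzc *; set w := proc E s in hw *.
set dz := proc D s' - z in hzc *; set dw := proc E s' - w.
set B := bracket _ _ s in hB *; set eD := ito_error X D s s' in hD hD' *.
set eE := ito_error X E s s' in hE hE' *.
have h0 : 0 <= s' - s by rewrite subr_ge0.
set h := s' - s in hh h0 hD hE hD' hE' hS hT *.
have [r r0 rh] : exists2 r : R, 0 <= r & r ^+ 2 = h.
  by exists (Num.sqrt h); [exact: sqrtr_ge0|rewrite sqr_sqrtr].
have rE : Num.sqrt h = r by rewrite -rh sqrtr_sqr ger0_norm.
have rc : r <= c by apply: ler_of_sqr; [exact: ltW|rewrite rh].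
rewrite rE in hD hE hS hT *.
set S := noise_incr X (noise D) s s' in hS; set T := noise_incr X (noise E) s s' in hT.
have [rD rDE] : exists y, y = eD + h%:C%C *: drift D s by exists (eD + h%:C%C *: drift D s).
have [rE' rEE] : exists y, y = eE + h%:C%C *: drift E s by exists (eE + h%:C%C *: drift E s).
have dzE : dz = S + rD by rewrite rDE /eD /ito_error -/S -/h subrK addrC subrK.
have dwE : dw = T + rE' by rewrite rEE /eE /ito_error -/T -/h subrK addrC subrK.
have normh (a : A) : norm2 (h%:C%C *: a) <= h * opnorm a.
  by rewrite norm2Z cnorm_real ger0_norm // ler_wpM2l // norm2_opnorm.
have {}hz := le_trans hz l1; have {}hw := le_trans hw l2; have {}hd := le_trans hd l3.
have {}hf := le_trans hf l4; have {}hB := le_trans hB l5.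
have {}hS : norm2 S <= M * r by rewrite (le_trans hS) // ler_wpM2r.
have {}hT : norm2 T <= M * r by rewrite (le_trans hT) // ler_wpM2r.
have hrc : h <= c * r by rewrite -rh expr2 ler_wpM2r.
have scale_le (a : A) : opnorm a <= M -> norm2 (h%:C%C *: a) <= M * (c * r).
  move=> aM; rewrite (le_trans (normh a)) // mulrC.
  by rewrite ler_pM ?opnorm_ge0.
have hrD : norm2 rD <= (1 + M) * (c * r).
  by rewrite rDE mulrDl mul1r (le_trans (norm2D _ _)) // lerD // scale_le.
have hrE : norm2 rE' <= (1 + M) * (c * r).
  by rewrite rEE mulrDl mul1r (le_trans (norm2D _ _)) // lerD // scale_le.
have hdw : norm2 dw <= (2 * M + 1) * r.
  rewrite dwE (le_trans (norm2D _ _)) //.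
  have : (1 + M) * (c * r) <= (1 + M) * r by rewrite ler_wpM2l ?addr_ge0 // ler_piMl.
  by move: hT hrE; lra.
have hrM (a b : A) : norm2 a <= (1 + M) * (c * r) -> norm2 b <= (2 * M + 1) * r ->
    norm2 a * norm2 b <= (1 + M) * (2 * M + 1) * c * h.
  move=> ha hb; apply: (le_trans (ler_pM (norm2_ge0 _) (norm2_ge0 _) ha hb)).
  by rewrite -rh le_eqVlt; apply/orP; left; apply/eqP; ring.
have cr0 : 0 <= c * r by rewrite mulr_ge0 // ltW.
have ch0 : 0 <= c * h by rewrite mulr_ge0 // ltW.
split=> [|b Fb].
  have e1 : norm2 (eD * w) <= (c * r) * M.
    by rewrite (le_trans (norm2Mr _ _)) // ler_pM ?norm2_ge0 ?opnorm_ge0.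
  have e2 : norm2 (z * eE) <= M * (c * r).
    by rewrite (le_trans (norm2M _ _)) // ler_pM ?norm2_ge0 ?opnorm_ge0.
  (* The L^2 size of both factors would not bound the L^2 norm of the product; the smallness comes
     from the norm continuity of the first process. *)
  have e3 : norm2 (dz * dw) <= c * ((2 * M + 1) * r).
    by rewrite (le_trans (norm2M _ _)) // ler_pM ?norm2_ge0 ?opnorm_ge0.
  have e4 := scale_le _ hB.
  have e5 := norm2D (eD * w + z * eE) (dz * dw - h%:C%C *: B).
  have e6 := norm2D (eD * w) (z * eE).
  have e7 := norm2B (dz * dw) (h%:C%C *: B).
  have e8 : 0 <= M * (c * r) by rewrite mulr_ge0.
  have e9 : 0 <= M * M * (c * r) by rewrite (mulr_ge0 (mulr_ge0 M0 M0)).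
  clear -e1 e2 e3 e4 e5 e6 e7 e8 e9 cr0.
  apply: (le_trans e5); lra.
have b0 := opnorm_ge0 b.
have Fz : past X s z by exact: rz.1.
have Fw : past X s w by exact: rw.1.
have e1 : cnorm (tau (b * (eD * w))) <= c * h * (M * opnorm b).
  rewrite mulrA tauC mulrA (le_trans (hD' _ _)) //; first exact: (ssubM (past_ssub X s)).
  rewrite ler_wpM2l // (le_trans (opnormM _ _)) // ler_wpM2r //.
have e2 : cnorm (tau (b * (z * eE))) <= c * h * (M * opnorm b).
  rewrite mulrA (le_trans (hE' _ _)) //; first exact: (ssubM (past_ssub X s)).
  by rewrite ler_wpM2l // (le_trans (opnormM _ _)) // mulrC ler_wpM2r.
(* The product [S * T] of the noises is cancelled exactly by the bracket; each remaining product has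
   one factor of order [c r] and one of order [r]. *)
have e3 : tau (b * (dz * dw - h%:C%C *: B)) = tau (b * (S * rE')) + tau (b * (rD * dw)).
  have -> : dz * dw = S * T + S * rE' + rD * dw.
    by rewrite {1}dzE mulrDl {1}dwE mulrDr.
  rewrite mulrBr !mulrDr !tauB !tauD (tau_noise_incr_mul hX rS rT) //.
  by rewrite -/h -/B -scalerAr tauZ -(addrA _ (tau _)) addrAC subrr add0r.
have nb (x y : A) : cnorm (tau (b * (x * y))) <= opnorm b * (norm2 x * norm2 y).
  rewrite mulrA (le_trans (cnorm_tauM _ _)) // mulrA ler_wpM2r ?norm2_ge0 //.
  exact: norm2M.
have e4 : cnorm (tau (b * (S * rE'))) <= opnorm b * (M * (1 + M) * c * h).
  rewrite (le_trans (nb _ _)) // ler_wpM2l //.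
  apply: (le_trans (ler_pM (norm2_ge0 _) (norm2_ge0 _) hS hrE)).
  by rewrite -rh le_eqVlt; apply/orP; left; apply/eqP; ring.
have e5 : cnorm (tau (b * (rD * dw))) <= opnorm b * ((1 + M) * (2 * M + 1) * c * h).
  by rewrite (le_trans (nb _ _)) // ler_wpM2l // hrM.
rewrite mulrDr tauD e3 mulrDr tauD.
have e6 := cnormD (tau (b * (eD * w)) + tau (b * (z * eE))) (tau (b * (S * rE')) + tau (b * (rD * dw))).
have e7 := cnormD (tau (b * (eD * w))) (tau (b * (z * eE))).
have e8 := cnormD (tau (b * (S * rE'))) (tau (b * (rD * dw))).
have e9 : 0 <= c * h * opnorm b by rewrite mulr_ge0.
have e10 : 0 <= c * h * opnorm b * M by rewrite mulr_ge0.
apply: (le_trans e6); clear -e1 e2 e4 e5 e7 e8 e9 e10; lra.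
Qed.

End ItoClosure.

(** * Derivatives of traces, and the expansion of the free unitary Brownian motion *)

Section ItoDerivative.
Variables (R : realType) (A : tracialSpace R) (I : eqType) (X : R -> A) (j : I) (t : R).
Hypothesis hX : free_additive_BM X.
Hypothesis t0 : 0 < t.
Implicit Types (D E : itoData A I).

Lemma is_ito_derive D : is_ito X j t D ->
  is_complex_derive (fun s => tau (proc D s)) t (tau (drift D t)).
Proof.
move=> [_ rS [_ cd] nD].
(* [h] stands for the real or the imaginary part. Only the bound tested against [b = 1] is needed
   here. *)
have main (h : R[i] -> R) : (forall z, `|h z| <= cnorm z) ->
    (forall z w, h (z + w) = h z + h w) -> (forall (x : R) z, h (x%:C%C * z) = x * h z) ->
    is_derive t 1 (fun s => h (tau (proc D s))) (h (tau (drift D t))).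
  move=> hle hD hZ; have hN z : h (- z) = - h z.
    have N1 : ((-1 : R)%:C)%C = -1 by apply/eqP; rewrite eq_complex /= oppr0 !eqxx.
    by have := hZ (-1) z; rewrite N1 !mulN1r.
  apply: near_incr_derive => // e e0; have e2 : 0 < e / 2 by rewrite divr_gt0.
  have [d d0 dP] := cd _ e2.
  have nd : near_incr t (fun s _ => opnorm (drift D s - drift D t) <= e / 2).
    exists d => // s s' s0 ts ss' s't; apply: dP => //.
    by rewrite ltr_norml; apply/andP; split; lra.
  apply: near_incr_sub (near_incr_and (nD _ e2) nd) => s s' s0 ss' [[_ h2] h3].
  have := h2 1 (ssub1 (past_ssub X s)); rewrite mul1r {h2} => h2.
  have h0 : 0 <= s' - s by rewrite subr_ge0.
  have {}h2 : cnorm (tau (ito_error X D s s')) <= e / 2 * (s' - s).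
    by apply: (le_trans h2); rewrite ler_piMr ?opnorm1 // mulr_ge0 // ltW.
  have -> : h (tau (proc D s')) - h (tau (proc D s)) - (s' - s) * h (tau (drift D t))
      = h (tau (ito_error X D s s')) + (s' - s) * h (tau (drift D s - drift D t)).
    have N0 : tau (noise_incr X (noise D) s s') = 0.
      by rewrite -[noise_incr _ _ _ _]mul1r (tau_noise_incr hX rS) //; exact: (ssub1 (past_ssub X s)).
    rewrite /ito_error !tauB N0 subr0 tauZ !hD !hN hZ.
    by move: (h _) (h _) (h _) (h _) => *; ring.
  rewrite (le_trans (ler_normD _ _)) //.
  have := le_trans (hle _) h2.
  have : `|(s' - s) * h (tau (drift D s - drift D t))| <= (s' - s) * (e / 2).
    rewrite normrM ger0_norm // ler_wpM2l //.
    exact: le_trans (hle _) (le_trans (cnorm_tau_opnorm _) h3).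
  by move: (`|h _|) (`|_ * _|) => *; lra.
split; apply: main.
- exact: cnorm_Re.
- exact: ReD.
- exact: Re_realM.
- exact: cnorm_Im.
- exact: ImD.
- exact: Im_realM.
Qed.

Lemma near_incr_between (P : R -> R -> Prop) : near_incr t P ->
  near_incr t (fun s s' => forall r, s <= r -> r <= s' -> P s r).
Proof.
move=> [d d0 dP]; exists d => // s s' s0 ts ss' s't r sr rs'.
by apply: dP => //; exact: le_lt_trans s't.
Qed.

Definition ito_unitary (U : R -> A) : itoData A I :=
  ItoData U [:: (j, (fun s => ('i%C : R[i]) *: U s, fun=> 1))]
    (fun s => (- 2^-1 : R[i]) *: U s).

Variable U : R -> A.
Hypothesis hU : free_unitary_BM X U.

Lemma unitary_past s : 0 <= s -> past X s (U s).
Proof. by case: hU => _ Fu _ _ s0; apply: sub_star_generated; exact: Fu. Qed.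

Lemma unitary_continuous s : 0 <= s -> norm_continuous s U.
Proof.
case: hU => _ _ Uc _ s0 e e0; have /cvgrPdist_lt /(_ _ e0) := Uc s s0.
rewrite near_withinE => -[d /= d0 dP]; exists d => // r r0 rs.
have := dP r; rewrite /= distrC sub0r normrN (ger0_norm (opnorm_ge0 _)) => h.
exact/ltW/h.
Qed.

(** [U] is frozen at time [s] in both integrals. The stochastic remainder [dJ] is small in L^2 and
    orthogonal to the past; the time remainder [dK] is small in operator norm. *)
Lemma is_ito_unitary : is_ito X j t (ito_unitary U).
Proof.
have rU : regular X t U by split; [exact: unitary_past|exact/unitary_continuous/ltW].
have r1 : regular X t (fun=> 1) by rewrite -(scale1r 1); exact: regular_cst.
split => //=; [by split=> //; exact: regularZ|exact: regularZ|].
(* [2 c] from the stochastic remainder, plus half of the [2 c] from the time remainder, once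
   [s' - s <= 1]. *)
apply: (@negligible_bound _ _ _ _ 3) => // c c0 c1.
have nU := near_incr_between (norm_continuous_incr c0 rU.2).
apply: near_incr_sub (near_incr_and nU (near_incr_small t ltr01)) => s s' s0 ss' [Us h1].
have [_ _ Uc Usde] := hU.
have [J [K [hJ hK UE]]] := Usde s s0.
have [J' [K' [hJ' hK' UE']]] := Usde s' (le_trans s0 ss').
have h0 : 0 <= s' - s by rewrite subr_ge0.
pose dJ := J' - J - U s * (X s' - X s).
pose dK := K' - K - (s' - s)%:C%C *: U s.
have eE : ito_error X (ito_unitary U) s s' = ('i%C : R[i]) *: dJ - (2^-1 : R[i]) *: dK.
  rewrite /ito_error /noise_incr /= big_seq1 /= mulr1 -scalerAl scaleNr scalerN opprK.
  rewrite /dJ /dK !scalerBr [in LHS]UE' [X in _ - X - _ + _]UE.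
  rewrite !scalerA [(s' - s)%:C%C * _]mulrC.
  move: ('i%C *: (U s * (X s' - X s))) (_ *: U s) => u v.
  move: (_ *: J') (_ *: J) (_ *: K') (_ *: K) => a b c' d.
  rewrite !opprD !opprK !addrA.
  by rewrite [LHS](ACl (1*4*2*5*7*3*6*8))%AC /= subrr add0r.
have nK : opnorm dK <= 2 * c * (s' - s).
  by apply: (opnorm_time_increment Uc s0 ss' hK hK') => r sr rs'; exact: Us.
have nJ : norm2 dJ <= 2 * c * Num.sqrt (s' - s).
  apply: ler_of_sqr; first by rewrite !mulr_ge0 ?sqrtr_ge0 // ltW.
  have -> : (2 * c * Num.sqrt (s' - s)) ^+ 2 = 4 * c ^+ 2 * (s' - s).
    by rewrite !exprMn sqr_sqrtr //; ring.
  apply: (norm2_stochastic_increment hX unitary_past Uc s0 ss' hJ hJ' (ltW c0)) => r sr rs'.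
  exact: le_trans (norm2_opnorm _) (Us _ sr rs').
have half : cnorm (2^-1 : R[i]) = 2^-1.
  by rewrite Normc.normcV -(rmorph_nat (real_complex R)) cnorm_real ger0_norm.
have imag : cnorm ('i%C : R[i]) = 1 by rewrite /= expr0n add0r expr1n sqrtr1.
rewrite eE; split=> [|b Fb].
  rewrite (le_trans (norm2B _ _)) // !norm2Z imag half mul1r.
  have hs : s' - s <= Num.sqrt (s' - s).
    rewrite -[X in X <= _](sqr_sqrtr h0) expr2 ler_piMl ?sqrtr_ge0 //.
    by apply: ler_of_sqr => //; rewrite sqr_sqrtr // expr1n.
  have := norm2_opnorm dK.
  have : c * (s' - s) <= c * Num.sqrt (s' - s) by rewrite ler_wpM2l // ltW.
  by move: nK nJ; clear; lra.
rewrite mulrBr tauB -!scalerAr !tauZ.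
have -> : tau (b * dJ) = 0.
  rewrite /dJ mulrBr tauB (tau_past_stochastic_increment hX Uc s0 ss' hJ hJ' Fb) sub0r.
  rewrite mulrA tau_past_incr ?oppr0 //.
  by apply: (ssubM (past_ssub X s)) => //; exact: unitary_past.
rewrite mulr0 sub0r cnormN cnormM half.
have : cnorm (tau (b * dK)) <= opnorm b * (2 * c * (s' - s)).
  apply: (le_trans (cnorm_tau_opnorm _)); apply: (le_trans (opnormM _ _)).
  by rewrite ler_wpM2l ?opnorm_ge0.
have : 0 <= c * (s' - s) * opnorm b by rewrite !mulr_ge0 ?opnorm_ge0 // ltW.
by move: (cnorm _) => *; lra.
Qed.

End ItoDerivative.

(** * Words in free variables *)

(** By recursion rather than by membership, so that letters need no decidable equality. *)
Fixpoint allP (T : Type) (Q : T -> Prop) (l : seq T) : Prop :=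
  if l is x :: l' then Q x /\ allP Q l' else True.

Lemma allP_cat (T : Type) (Q : T -> Prop) l1 l2 :
  allP Q (l1 ++ l2) <-> allP Q l1 /\ allP Q l2.
Proof. by elim: l1 => /= [|x l1 ->]; tauto. Qed.

Lemma allP_mem (T : eqType) (Q : T -> Prop) (l : seq T) :
  allP Q l -> forall x, x \in l -> Q x.
Proof.
elim: l => //= y l IH [Qy Ql] x; rewrite inE => /orP[/eqP -> //|xl].
exact: IH.
Qed.

Definition alternating (I : eqType) : rel I := fun i j => i != j.

(** * Reduction of words to alternating centered words *)

Section FreeInduction.
Variables (I : eqType) (M : Type) (mul : M -> M -> M) (cen : M -> M).
Variables (Alg : I -> M -> Prop) (Cent : M -> Prop) (P : seq M -> Prop).
Hypothesis Alg_mul : forall j x y, Alg j x -> Alg j y -> Alg j (mul x y).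
Hypothesis Alg_cen : forall j x, Alg j x -> Alg j (cen x) /\ Cent (cen x).
Hypothesis P_merge : forall l1 x y l2, P (l1 ++ mul x y :: l2) -> P (l1 ++ x :: y :: l2).
Hypothesis P_center : forall j l1 x l2, Alg j x ->
  P (l1 ++ cen x :: l2) -> P (l1 ++ l2) -> P (l1 ++ x :: l2).
Hypothesis P_alternating : forall l : seq (I * M),
  sorted (@alternating I) (map fst l) ->
  allP (fun x => Alg x.1 x.2 /\ Cent x.2) l -> P (map snd l).

Local Notation letters := (allP (fun x : I * M => Alg x.1 x.2)).

Let not_alternating (l : seq (I * M)) : ~~ sorted (@alternating I) (map fst l) ->
  exists l1 i x y l2, l = l1 ++ (i, x) :: (i, y) :: l2.
Proof.
elim: l => [//|[i x] [//|[i' y] l] IH] /=.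
rewrite negb_and negbK => /orP[/eqP <-|/IH]; first by exists [::], i, x, y, l.
by move=> [l1 [i0 [x0 [y0 [l2 ->]]]]]; exists ((i, x) :: l1), i0, x0, y0, l2.
Qed.

(* Induction on the length of the word: merging two neighbouring letters of the
   same algebra, or replacing a letter by its mean, shortens it. *)
Lemma free_induction (l : seq (I * M)) : letters l -> P (map snd l).
Proof.
have [n] := ubnP (size l); elim: n l => // n IH l; rewrite ltnS => ln Al.
have [sl|/not_alternating[l1 [i [x [y [l2 lE]]]]]] := boolP (sorted (@alternating I) (map fst l)); last first.
  rewrite lE map_cat; apply: P_merge; have := IH (l1 ++ (i, mul x y) :: l2).
  rewrite map_cat; apply.
    by move: ln; rewrite lE !size_cat /= !addnS.
  by move: Al; rewrite lE => /allP_cat[A1 /= [Ax [Ay A2]]]; apply/allP_cat; do !split => //; exact: Alg_mul.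
(* The letters of [c] are already centered, those of [u] not yet. Centering changes neither the
   indices nor the length, and dropping a letter falls under the outer induction. *)
suff gen c u : sorted (@alternating I) (map fst (c ++ u)) -> (size (c ++ u) <= n)%N ->
    allP (fun x => Alg x.1 x.2 /\ Cent x.2) c -> letters u -> P (map snd (c ++ u)).
  exact: (gen [::]).
elim: u c => [|[i x] u IHu] c sc nc Ac Au; first by rewrite cats0 in sc *; exact: P_alternating.
have [Ax Au'] := Au; rewrite map_cat; have [Acx Cx] := Alg_cen Ax.
apply: (P_center Ax).
  have := IHu (rcons c (i, cen x)); rewrite cat_rcons [map snd _]map_cat; apply=> //.
  - by move: sc; rewrite !map_cat.
  - by move: nc; rewrite !size_cat.
  - by rewrite -cats1; apply/allP_cat.
have := IH (c ++ u); rewrite map_cat; apply.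
  by move: nc; rewrite !size_cat /= addnS.
by apply/allP_cat; split=> //; elim: c Ac {sc nc IHu} => //= z c IHc [[? _] /IHc].
Qed.

Variable add : M -> M -> M.
Hypothesis P_add : forall l1 x y l2,
  P (l1 ++ x :: l2) -> P (l1 ++ y :: l2) -> P (l1 ++ add x y :: l2).

(** Needed for letters such as G and its adjoint, which are sums over all indices and lie in no
    single algebra. *)
Inductive letter_sum : M -> Prop :=
| LetterSum1 j x of Alg j x : letter_sum x
| LetterSumD x y of letter_sum x & letter_sum y : letter_sum (add x y).

Lemma free_induction_sum (l : seq M) : allP letter_sum l -> P l.
Proof.
suff gen c : letters c -> allP letter_sum l -> P (map snd c ++ l) by exact: (gen [::]).
elim: l c => [|x l IH] c Ac; first by rewrite cats0 => _; exact: free_induction.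
move=> /= [Sx Sl]; elim: Sx => [j y Ay|y z _ Py _ Pz]; last exact: P_add.
have := IH (rcons c (j, y)); rewrite map_rcons cat_rcons; apply=> //.
by rewrite -cats1; apply/allP_cat.
Qed.

End FreeInduction.

(** * The formal drift of an alternating centered word has trace zero *)

Section FreeDrift.
Variables (R : realType) (A : tracialSpace R) (I : eqType) (t : R).
Variables (G : I -> set A).
Hypothesis G_free : star_free G.
Local Notation B i := (star_generated (G i)).
Implicit Types (D E : itoData A I) (l : seq (I * itoData A I)) (v : seq (I * A)).

Let B_ssub i : star_subalgebra (B i).
Proof. exact: star_generated_star_subalgebra. Qed.

Definition free_word v := sorted (@alternating I) (map fst v) /\
  allP (fun x => B x.1 x.2 /\ tau x.2 = 0) v.

Lemma tau_free_word v : free_word v -> v != [::] -> tau (\prod_(x <- v) x.2) = 0.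
Proof.
move=> [sv /allP_mem Bv] v0; apply: (star_free_seq G_free v0) => //.
by move: sv; rewrite sorted_map.
Qed.

Definition noise_in (i : I) (s : R) := allP (fun n : I * ((R -> A) * (R -> A)) =>
  [/\ n.1 = i, B i (n.2.1 s) & B i (n.2.2 s)]).

(** The process is constrained at all times, because its traces must vanish around [t] to be
    differentiated; noise and drift enter only at time [t]. *)
Definition ito_in (i : I) D := [/\ forall s, 0 <= s -> B i (proc D s),
  noise_in i t (noise D) & B i (drift D t)].

Definition ito_zero_mean D := (forall s, 0 <= s -> tau (proc D s) = 0) /\ tau (drift D t) = 0.

Definition ito_prod l : itoData A I := \big[@ito_mul R A I/ito_cst I 1]_(x <- l) x.2.

Let letters l := allP (fun x => ito_in x.1 x.2 /\ ito_zero_mean x.2) l.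
Hypothesis t0 : 0 <= t.

Let free_word_rcons v i a : free_word v -> B i a -> tau a = 0 ->
  sorted (@alternating I) (rcons (map fst v) i) -> free_word (rcons v (i, a)).
Proof.
move=> [_ Av] Ba a0 sv; split; first by rewrite map_rcons.
by rewrite -cats1; apply/allP_cat.
Qed.

Let prod_rcons v i (a : A) : \prod_(x <- rcons v (i, a)) x.2 = (\prod_(x <- v) x.2) * a.
Proof. by rewrite -cats1 big_cat big_seq1. Qed.

Let noise_cons i D l : noise (ito_prod ((i, D) :: l)) =
  noise_mulr (proc (ito_prod l)) (noise D) ++ noise_mull (proc D) (noise (ito_prod l)).
Proof. by rewrite /ito_prod big_cons. Qed.

Let allP_map T U (f : T -> U) (Q : U -> Prop) s : allP Q (map f s) <-> allP (fun x => Q (f x)) s.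
Proof. by elim: s => //= x s IH; tauto. Qed.

Let allP_sub T (Q Q' : T -> Prop) s : (forall x, Q x -> Q' x) -> allP Q s -> allP Q' s.
Proof. by move=> QQ'; elim: s => //= x s IH [/QQ' Qx /IH]. Qed.

(* Traciality moves p to the left of a; the word (p a) v is then alternating,
   and both its centered part and its mean contribute 0. *)
Lemma tau_noise_free i (a : A) v l : B i a -> free_word v -> v != [::] ->
  sorted (@alternating I) (i :: map fst v ++ map fst l) -> letters l ->
  allP (fun n => n.1 = i -> tau (a * (\prod_(x <- v) x.2) * n.2.1 t) = 0) (noise (ito_prod l)).
Proof.
move=> Ba; elim: l v => [|[k D] l IH] v fv v0 sv /=; first by rewrite /ito_prod big_nil.
move=> [[[BD nD BdD] [zD _]] Ll]; rewrite noise_cons; apply/allP_cat; split.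
  rewrite /noise_mulr; apply/allP_map; apply: allP_sub nD => n [nk Bp Bq] /= ni.
  have Bpa : B i (n.2.1 t * a) by apply: (ssubM (B_ssub i)) => //; rewrite -ni nk.
  rewrite tauC mulrA (centeredK (n.2.1 t * a)) mulrDl tauD -scalerAl mul1r tauZ.
  rewrite (tau_free_word fv v0) mulr0 addr0.
  have := @tau_free_word ((i, centered (n.2.1 t * a)) :: v).
  rewrite big_cons; apply=> //; split.
    move: sv => /=; rewrite cat_path => /andP[+ _].
    by [].
  split; last exact: fv.2.
  by split; [exact: (ssub_centered (B_ssub i))|exact: tau_centered].
rewrite /noise_mull; apply/allP_map.
have rv : map fst (rcons v (k, proc D t)) ++ map fst l = map fst v ++ k :: map fst l.
  by rewrite map_rcons cat_rcons.
have := IH (rcons v (k, proc D t)); rewrite rv prod_rcons => /(_ _ _ _ Ll) H.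
apply: allP_sub (H _ _ _).
- by move=> n /= + ni => /(_ ni); rewrite -!mulrA.
- apply: free_word_rcons => //; [exact: BD|exact: zD|].
  move: sv => /= /path_sorted; by rewrite -cat_rcons => /cat_sorted2[].
- by case: (v).
- exact: sv.
Qed.

Lemma proc_ito_prod l s : proc (ito_prod l) s = \prod_(x <- l) proc x.2 s.
Proof. by rewrite /ito_prod; elim: l => [|x l IH]; rewrite ?big_nil // !big_cons /= IH. Qed.

Let free_word_cat v l : free_word v -> letters l ->
  sorted (@alternating I) (map fst v ++ map fst l) ->
  free_word (v ++ [seq (x.1, proc x.2 t) | x <- l]).
Proof.
move=> [_ Av] Ll sv; split; first by rewrite map_cat -map_comp.
apply/allP_cat; split=> //; apply/allP_map; apply: allP_sub Ll => x [[BD _ _] [zD _]] /=.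
by split; [exact: BD|exact: zD].
Qed.

(** A bracket pairs noises of equal index. The next letter has another index and pairs to nothing; a
    later letter of index [k] is separated from [D] by a nonempty alternating centered word, so
    [tau_noise_free] kills the trace factor. *)
Lemma bracket_free k D l : ito_in k D -> letters l -> sorted (@alternating I) (k :: map fst l) ->
  bracket (noise D) (noise (ito_prod l)) t = 0.
Proof.
move=> [_ nD _]; case: l => [|[k2 E] l] /=; first by rewrite /ito_prod big_nil bracket_nilr.
move=> [[[BE nE _] [zE _]] Ll] /andP[kk2 sl]; rewrite noise_cons bracket_catr.
have zero S T : allP (fun m => allP (fun n => m.1 = n.1 -> tau (m.2.2 t * n.2.1 t) = 0) T) S ->
    bracket S T t = 0.
  move=> H; rewrite /bracket; elim: S H => [|m S IHS /= [Hm HS]]; first by rewrite big_nil.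
  rewrite big_cons IHS // addr0; elim: T Hm {IHS HS} => [|n T IHT /= [Hn HT]].
    by rewrite big_nil.
  by rewrite big_cons IHT // addr0; case: eqP => // /Hn ->; rewrite scale0r.
rewrite !zero ?addr0 //; apply: allP_sub nD => m [mk Bp Bq].
  apply/allP_map; have := @tau_noise_free k (m.2.2 t) [:: (k2, proc E t)] l Bq.
  rewrite big_seq1 => H; apply: allP_sub (H _ _ _ Ll) => //.
  - by move=> n /= + mn => /(_ (etrans (esym mn) mk)); rewrite mulrA.
  - by split=> //=; do !split => //; [exact: BE|exact: zE].
  - by rewrite /= kk2.
apply/allP_map; apply: allP_sub nE => n [nk2 _ _] /= mn.
by move: kk2; rewrite /alternating -mk mn nk2 eqxx.
Qed.

(** [v] collects the letters already passed. Each Leibniz term replaces one letter by its drift,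
    which is centered and in the same algebra, so the word remains alternating; the brackets vanish
    by [bracket_free]. *)
Lemma tau_drift_free v l : free_word v -> letters l ->
  sorted (@alternating I) (map fst v ++ map fst l) ->
  tau ((\prod_(x <- v) x.2) * drift (ito_prod l) t) = 0.
Proof.
elim: l v => [|[k D] l IH] v fv; first by rewrite /ito_prod big_nil /= mulr0 tau0.
move=> Ll sv; have [[iD [zD dD0]] Ll'] := Ll.
have skl : sorted (@alternating I) (k :: map fst l).
  by move: sv => /cat_sorted2[].
have -> : drift (ito_prod ((k, D) :: l)) t = drift D t * proc (ito_prod l) t
   + proc D t * drift (ito_prod l) t + bracket (noise D) (noise (ito_prod l)) t.
  by rewrite /ito_prod big_cons.
rewrite (bracket_free iD Ll' skl) addr0 mulrDr tauD.
have [BD _ BdD] := iD.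
have sk : sorted (@alternating I) (rcons (map fst v) k).
  by move: sv; rewrite /= -cat_rcons => /cat_sorted2[].
have skv a : map fst (rcons v (k, a)) ++ map fst l = map fst v ++ k :: map fst l.
  by rewrite map_rcons cat_rcons.
have -> : tau ((\prod_(x <- v) x.2) * (drift D t * proc (ito_prod l) t)) = 0.
  have fr : free_word (rcons v (k, drift D t)) by exact: free_word_rcons.
  have := @tau_free_word (rcons v (k, drift D t) ++ [seq (x.1, proc x.2 t) | x <- l]).
  rewrite big_cat prod_rcons big_map -proc_ito_prod mulrA; apply.
    by apply: free_word_cat => //; rewrite skv.
  by case: (v).
rewrite add0r mulrA -(prod_rcons v k); apply: IH => //; last by rewrite skv.
by apply: free_word_rcons => //; [exact: BD|exact: zD].
Qed.

Lemma tau_drift_alternating l : sorted (@alternating I) (map fst l) -> letters l ->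
  tau (drift (ito_prod l) t) = 0.
Proof.
move=> sl Ll; have := @tau_drift_free [::] l.
by rewrite big_nil mul1r; apply.
Qed.

Lemma tau_proc_alternating l s : 0 <= s -> sorted (@alternating I) (map fst l) -> letters l ->
  (0 < size l)%N -> tau (proc (ito_prod l) s) = 0.
Proof.
move=> s0 sl Ll l0; rewrite proc_ito_prod.
have := @tau_free_word [seq (x.1, proc x.2 s) | x <- l]; rewrite big_map; apply.
  split; first by rewrite -map_comp.
  apply/allP_map; apply: allP_sub Ll => x [[BD _ _] [zD _]] /=.
  by split; [exact: BD|exact: zD].
by case: (l) l0.
Qed.

End FreeDrift.

Section ComplexDerivative.
Variables (R : realType) (t : R).
Implicit Types (f g : R -> R[i]) (a b : R[i]).

Lemma ReM (z w : R[i]) :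
  complex.Re (z * w) = complex.Re z * complex.Re w - complex.Im z * complex.Im w.
Proof. by case: z; case: w. Qed.

Lemma ImM (z w : R[i]) :
  complex.Im (z * w) = complex.Re z * complex.Im w + complex.Im z * complex.Re w.
Proof. by case: z; case: w. Qed.

Lemma is_complex_deriveD f g a b : is_complex_derive f t a -> is_complex_derive g t b ->
  is_complex_derive (fun s => f s + g s) t (a + b).
Proof.
move=> [f1 f2] [g1 g2]; split.
  by under eq_fun do rewrite ReD; rewrite ReD; exact: is_deriveD.
by under eq_fun do rewrite ImD; rewrite ImD; exact: is_deriveD.
Qed.

Lemma is_complex_deriveM f g a b : is_complex_derive f t a -> is_complex_derive g t b ->
  is_complex_derive (fun s => f s * g s) t (a * g t + f t * b).
Proof.
move=> [f1 f2] [g1 g2]; split.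
  under eq_fun do rewrite ReM; apply: is_derive_eq.
  by rewrite /GRing.scale /= ReD !ReM; ring.
under eq_fun do rewrite ImM; apply: is_derive_eq.
by rewrite /GRing.scale /= ImD !ImM; ring.
Qed.

Lemma is_complex_derive0 f : 0 < t -> (forall s, 0 <= s -> f s = f 0) -> is_complex_derive f t 0.
Proof.
move=> t0 f0; split=> /=; apply: near_incr_derive => // e e0; exists 1 => // s s' s0 _ ss' _.
all: rewrite (f0 s) // (f0 s') ?(le_trans s0) // subrr sub0r mulr0 normrN normr0.
all: by rewrite mulr_ge0 ?subr_ge0 // ltW.
Qed.

End ComplexDerivative.

(** * The Ito formula under the trace for words in several free processes *)

Section JointDerivative.
Variables (R : realType) (A : tracialSpace R) (I : eqType) (t : R).
Variables (X : I -> R -> A) (G : I -> set A).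
Hypothesis hX : forall j, free_additive_BM (X j).
Hypothesis G_free : star_free G.
Hypothesis t0 : 0 < t.
Implicit Types (D E : itoData A I) (l : seq (itoData A I)).
Implicit Types (S T : seq (I * ((R -> A) * (R -> A)))).
Local Notation B i := (star_generated (G i)).

Let B_ssub i : star_subalgebra (B i).
Proof. exact: star_generated_star_subalgebra. Qed.

Definition free_ito j D := is_ito (X j) j t D /\ ito_in t G j D.

Definition prod_ito l := \big[@ito_mul R A I/ito_cst I 1]_(D <- l) D.

Let noise_in_map j (f g : R -> A -> A) (S : seq (I * ((R -> A) * (R -> A)))) :
  (forall a, B j a -> B j (f t a)) -> (forall a, B j a -> B j (g t a)) ->
  noise_in G j t S ->
  noise_in G j t [seq (n.1, (fun s => f s (n.2.1 s), fun s => g s (n.2.2 s))) | n <- S].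
Proof.
move=> Bf Bg; elim: S => //= n S IH [[nj Bp Bq] /IH]; split=> //.
by split=> //; [exact: Bf|exact: Bg].
Qed.

Let bracket_in j S T : noise_in G j t S -> noise_in G j t T -> B j (bracket S T t).
Proof.
move=> BS BT; rewrite /bracket; elim: S BS => [_|m S IH [[_ Bp Bq] BS]].
  by rewrite big_nil; exact: (ssub0 (B_ssub j)).
rewrite big_cons; apply: (ssubD (B_ssub j)); last exact: IH.
elim: T BT {IH} => [_|n T IH [[_ Bp' Bq'] BT]].
  by rewrite big_nil; exact: (ssub0 (B_ssub j)).
rewrite big_cons; case: (m.1 == n.1); last exact: IH.
apply: (ssubD (B_ssub j)); last exact: IH.
by apply: (ssubZ (B_ssub j)); exact: (ssubM (B_ssub j)).
Qed.

Lemma free_ito_mul j D E : free_ito j D -> free_ito j E -> free_ito j (ito_mul D E).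
Proof.
move=> [iD [zD nD dD]] [iE [zE nE dE]]; split; first exact: is_ito_mul.
have BM x y : B j x -> B j y -> B j (x * y) by exact: (ssubM (B_ssub j)).
have zDt := zD t (ltW t0); have zEt := zE t (ltW t0).
split=> /=.
- by move=> s s0; apply: (BM); [exact: zD|exact: zE].
- apply/allP_cat; split.
    apply: (@noise_in_map j (fun s a => a) (fun s a => a * proc E s)) => // a Ba.
    exact: BM.
  apply: (@noise_in_map j (fun s a => proc D s * a) (fun s a => a)) => // a Ba.
  exact: BM.
- have BD x y : B j x -> B j y -> B j (x + y) by exact: (ssubD (B_ssub j)).
  by apply: (BD); [apply: (BD); exact: (BM)|exact: bracket_in].
Qed.

Lemma free_ito_centered j D : free_ito j D ->
  free_ito j (ito_centered D) /\ ito_zero_mean t (ito_centered D).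
Proof.
move=> [iD [zD nD dD]]; split; last by split=> [s s0|]; exact: tau_centered.
split; first exact: is_ito_centered.
split=> //= [s s0|]; first by apply: (ssub_centered (B_ssub j)); exact: zD.
exact: (ssub_centered (B_ssub j)).
Qed.

Lemma free_ito_cst j (c : R[i]) : free_ito j (ito_cst I (c%:A : A)).
Proof.
split; first exact: is_ito_cst.
split=> //= [s s0|]; last exact: (ssub0 (B_ssub j)).
by apply: (ssubZ (B_ssub j)); exact: (ssub1 (B_ssub j)).
Qed.

Lemma free_ito_adj j D : free_ito j D -> free_ito j (ito_adj D).
Proof.
move=> [iD [zD nD dD]]; split; first exact: is_ito_adj.
have Badj a : B j a -> B j (adj a) by exact: (ssub_adj (B_ssub j)).
split=> /= [s s0||]; [exact: (Badj _ (zD _ s0))| |exact: (Badj _ dD)].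
by elim: (noise D) nD => //= n S IH [[nj Bp Bq] /IH]; split=> //; split=> //; exact: (Badj).
Qed.

Lemma drift_sandwich D1 D E s : drift (ito_mul D1 (ito_mul D E)) s =
  drift D1 s * proc D s * proc E s + proc D1 s * drift D s * proc E s
  + proc D1 s * proc D s * drift E s + proc D1 s * bracket (noise D) (noise E) s
  + bracket (noise D1) (noise D) s * proc E s
  + bracket (noise D1) (noise_mull (proc D) (noise E)) s.
Proof.
by rewrite /= bracket_catr bracket_mulr !mulrDr !mulrA !addrA.
Qed.

Lemma bracket_mull_lin (c : R[i]) x y z S T (s : R) : z s = c *: x s + y s ->
  bracket S (noise_mull z T) s =
  c *: bracket S (noise_mull x T) s + bracket S (noise_mull y T) s.
Proof.
move=> zE; rewrite /bracket scaler_sumr -big_split; apply: eq_bigr => m _ /=.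
rewrite !big_map /= scaler_sumr -big_split; apply: eq_bigr => n _ /=.
by rewrite zE mulrDl mulrDr tauD scalerDl -scalerAl -scalerAr tauZ scalerA.
Qed.

Lemma bracket_mull1 S T (s : R) : bracket S (noise_mull (fun=> 1) T) s = bracket S T s.
Proof.
rewrite /bracket; apply: eq_bigr => m _; rewrite big_map; apply: eq_bigr => n _ /=.
by rewrite mul1r.
Qed.

Lemma proc_centered_split D1 D E s : tau (proc (ito_mul D1 (ito_mul D E)) s) =
  tau (proc (ito_mul D1 (ito_mul (ito_centered D) E)) s)
  + tau (proc D s) * tau (proc (ito_mul D1 E) s).
Proof. exact: tau_center_split. Qed.

(** The formal derivative of [proc_centered_split]: the centering step of the induction thus acts
    alike on the trace and on its candidate derivative. *)
Lemma drift_centered_split D1 D E s : drift (ito_mul D1 (ito_mul D E)) s =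
  drift (ito_mul D1 (ito_mul (ito_centered D) E)) s
  + (tau (drift D s) *: proc (ito_mul D1 E) s + tau (proc D s) *: drift (ito_mul D1 E) s).
Proof.
rewrite !drift_sandwich /=.
have zE : proc D s = tau (proc D s) *: 1 + centered (proc D s) by rewrite addrC -centeredK.
have dE : drift D s = tau (drift D s) *: 1 + centered (drift D s) by rewrite addrC -centeredK.
rewrite (@bracket_mull_lin _ (fun=> 1) (fun s => centered (proc D s)) (proc D) _ _ _ zE).
rewrite bracket_mull1.
move: (tau (proc D s)) (tau (drift D s)) (centered (proc D s)) (centered (drift D s)) zE dE.
move=> c c' z d -> ->.
move: (proc D1 s) (proc E s) (drift D1 s) (drift E s) => a b da db.
move: (bracket _ _ s) (bracket (noise D1) (noise D) s) (bracket (noise D1) (noise E) s)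
  (bracket _ (noise_mull _ _) s) => B1 B2 B3 B4.
rewrite !(mulrDl, mulrDr) -!scalerAr -!scalerAl !mulr1 !scalerDr !addrA.
by rewrite [LHS](ACl (2*4*6*7*8*10*3*1*5*9))%AC.
Qed.

Lemma drift_add_split D1 D D' E s : drift (ito_mul D1 (ito_mul (ito_add D D') E)) s =
  drift (ito_mul D1 (ito_mul D E)) s + drift (ito_mul D1 (ito_mul D' E)) s.
Proof.
rewrite !drift_sandwich /= bracket_catl bracket_catr.
rewrite (@bracket_mull_lin 1 (proc D) (proc D')) ?scale1r //.
by rewrite !(mulrDl, mulrDr) !addrA [LHS](ACl (1*3*5*7*9*11*2*4*6*8*10*12))%AC.
Qed.

Let P l := is_complex_derive (fun s => tau (proc (prod_ito l) s)) t (tau (drift (prod_ito l) t)).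

Lemma prod_ito_cat_cons l1 D l2 : prod_ito (l1 ++ D :: l2) =
  ito_mul (prod_ito l1) (ito_mul D (prod_ito l2)).
Proof. by rewrite /prod_ito big_cat big_cons. Qed.

(** Merging two letters does not change the formal product, by associativity, so it preserves the
    claim; on alternating centered words the trace is constant and the drift has trace 0. *)
Lemma prod_ito_derive l : allP (letter_sum free_ito (@ito_add R A I)) l ->
  is_complex_derive (fun s => tau (proc (prod_ito l) s)) t (tau (drift (prod_ito l) t)).
Proof.
apply: (@free_induction_sum I _ (@ito_mul R A I) (@ito_centered R A I) free_ito (@ito_zero_mean R A I t) P).
- exact: free_ito_mul.
- exact: free_ito_centered.
- move=> l1 D E l2; rewrite /P.
  by rewrite !prod_ito_cat_cons [in prod_ito (E :: l2)]/prod_ito big_cons -!ito_mulA.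
- move=> j l1 D l2 [iD _]; rewrite /P !prod_ito_cat_cons => H1 H2.
  (* Here the expansions enter: the mean of the letter being removed is differentiated by the
     formula for a single Brownian motion. *)
  have dD := is_ito_derive (hX j) t0 iD.
  have H3 : is_complex_derive (fun s => tau (proc (ito_mul (prod_ito l1) (prod_ito l2)) s)) t
      (tau (drift (ito_mul (prod_ito l1) (prod_ito l2)) t)).
    by move: H2; rewrite /prod_ito big_cat.
  have := is_complex_deriveD H1 (is_complex_deriveM dD H3).
  under eq_fun do rewrite -proc_centered_split.
  by rewrite (drift_centered_split _ D) [tau (drift _ t + _)]tauD [tau (_ *: _ + _)]tauD !tauZ.
- move=> v sv Av; rewrite /P.
  have pE : prod_ito (map snd v) = ito_prod v by rewrite /prod_ito /ito_prod big_map.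
  have Lv : allP (fun x => ito_in t G x.1 x.2 /\ ito_zero_mean t x.2) v.
    by elim: (v) Av => //= x v' IH [[[_ ?] ?] /IH].
  rewrite pE (tau_drift_alternating G_free (ltW t0) sv Lv).
  apply: is_complex_derive0 => // s s0; case: (v) sv Lv => [|x v'] sv Lv.
    by rewrite /ito_prod !big_nil.
  by rewrite !(tau_proc_alternating G_free _ sv Lv).
- move=> l1 D D' l2; rewrite /P !prod_ito_cat_cons => H1 H2.
  have := is_complex_deriveD H1 H2; rewrite drift_add_split tauD.
  by under eq_fun do rewrite -tauD -mulrDr -mulrDl.
Qed.

End JointDerivative.

(** * Unitarity and moments of the free unitary Brownian motion *)

Section LinearODE.
Variable R : realType.

(** Multiplied by [expR (- a * s)], [f] becomes constant on positive times. The derivative is given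
    only there, so continuity at 0 is used to identify the constant. *)
Lemma linear_ode_zero (f : R -> R) (a : R) :
  (forall t : R, 0 < t -> is_derive t 1 f (a * f t)) -> f 0 = 0 ->
  (forall e : R, 0 < e -> exists2 d : R, 0 < d & forall s, 0 <= s -> s < d -> `|f s| <= e) ->
  forall t : R, 0 <= t -> f t = 0.
Proof.
move=> df f0 fc t; rewrite le_eqVlt => /orP[/eqP <- //|t0].
pose g (s : R) : R := f s * expR (- a * s).
have dg (s : R) : 0 < s -> is_derive s 1 g 0.
  move=> s0; have dfs := df s s0; rewrite /g.
  have dl : is_derive s 1 (fun s : R => - a * s) (- a).
    by apply: is_derive_eq; rewrite /GRing.scale /=; ring.
  have de := @is_derive1_comp _ expR (fun s : R => - a * s) s _ _ (is_derive_expR _) dl.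
  have H := is_deriveM dfs de.
  by apply: (@is_derive_eq _ _ _ _ _ _ _ _ H); rewrite /GRing.scale /=; ring.
have g_const (s : R) : 0 < s -> s <= t -> g s = g t.
  move=> s0 st; have [||c _] := @MVT_segment _ g (fun=> 0) s t st.
  - by move=> x; rewrite in_itv /= => /andP[sx _]; apply: dg; exact: lt_trans sx.
  - apply: derivable_within_continuous => x; rewrite in_itv /= => /andP[sx _].
    by have [] := dg x (lt_le_trans s0 sx).
  by rewrite mul0r => /subr0_eq ->.
have g0 : g t = 0.
  apply/eqP; rewrite -normr_le0; apply/ler_addgt0Pr => e e0; rewrite add0r.
  have K0 : 0 < expR (`|a| * t) by exact: expR_gt0.
  have [d d0 dP] := fc _ (divr_gt0 e0 K0).
  pose s := Num.min (d / 2) t.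
  have s0 : 0 < s by rewrite lt_min divr_gt0.
  have st : s <= t by rewrite ge_min lexx orbT.
  have sd : s < d by rewrite gt_min; apply/orP; left; lra.
  rewrite -(g_const s s0 st) /g normrM (ger0_norm (ltW (expR_gt0 _))).
  rewrite -[leRHS](@divfK _ (expR (`|a| * t))) ?gt_eqF //.
  apply: ler_pM; [exact: normr_ge0|exact: expR_ge0|exact: dP (ltW s0) sd|].
  rewrite ler_expR; apply: (@le_trans _ _ (`|a| * s)); last by rewrite ler_wpM2l.
  apply: ler_wpM2r; first exact: ltW.
  by rewrite (le_trans (ler_norm _)) // normrN.
by move: g0 => /eqP; rewrite mulf_eq0 (gt_eqF (expR_gt0 _)) orbF => /eqP.
Qed.

End LinearODE.

(** * Unitarity and the moment equations of a single process *)

Section UnitaryProcess.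
Variables (R : realType) (A : tracialSpace R).

Lemma conj_i : ('i%C : R[i])^*%C = - 'i%C.
Proof. by apply/eqP; rewrite eq_complex /= oppr0 !eqxx. Qed.

Lemma conj_half : (- 2^-1 : R[i])^*%C = - 2^-1.
Proof.
have -> : (- 2^-1 : R[i]) = (- 2^-1 : R)%:C%C by rewrite rmorphN fmorphV rmorph_nat.
exact: conjc_real.
Qed.

Lemma tau_ode_zero (a : R) (z : R -> A) :
  (forall t, 0 < t -> is_complex_derive (fun s => tau (z s)) t (a%:C%C * tau (z t))) ->
  norm_continuous 0 z -> z 0 = 0 -> forall t, 0 <= t -> tau (z t) = 0.
Proof.
move=> dz cz z0 t t0.
have bound (h : R[i] -> R) : (forall w, `|h w| <= cnorm w) -> forall e : R, 0 < e ->
    exists2 d : R, 0 < d & forall s, 0 <= s -> s < d -> `|h (tau (z s))| <= e.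
  move=> hle e e0; have [d d0 dP] := cz _ e0; exists d => // s s0 sd.
  have := dP s s0; rewrite subr0 ger0_norm // z0 subr0 => /(_ sd).
  by apply: le_trans; rewrite (le_trans (hle _)) // cnorm_tau_opnorm.
have Re0 : complex.Re (tau (z t)) = 0.
  apply: (@linear_ode_zero _ (fun s => complex.Re (tau (z s))) a) => //.
  - by move=> s s0; have [+ _] := dz s s0; rewrite Re_realM.
  - by rewrite z0 tau0.
  - by apply: (bound (@complex.Re R)); exact: cnorm_Re.
have Im0 : complex.Im (tau (z t)) = 0.
  apply: (@linear_ode_zero _ (fun s => complex.Im (tau (z s))) a) => //.
  - by move=> s s0; have [_ +] := dz s s0; rewrite Im_realM.
  - by rewrite z0 tau0.
  - by apply: (bound (@complex.Im R)); exact: cnorm_Im.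
by apply/eqP; rewrite eq_complex Re0 Im0 !eqxx.
Qed.

Variables (X U : R -> A).
Hypotheses (hX : free_additive_BM X) (hU : free_unitary_BM X U).

Let data := @ito_unitary R A unit tt U.
Let dataV := ito_mul data (ito_adj data).

Let is_ito_data t : 0 < t -> is_ito X tt t data.
Proof. by move=> t0; exact: is_ito_unitary. Qed.

Let Vm s := U s * adj (U s) - 1.

(** The noise list of [dataV] has two entries whose increments cancel; recording an empty list makes
    the bracket of this process with itself trivially zero. *)
Let dataVm : itoData A unit := ItoData Vm [::] (fun=> 0).

(* The martingale part and the drift of U U^* both cancel. *)
Let is_ito_V t : 0 < t -> is_ito X tt t dataVm.
Proof.
move=> t0; have iD := is_ito_data t0; have [rV _ _ nV] := is_ito_mul hX iD (is_ito_adj hX iD).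
split => //=.
- have := regularD rV (regular_cst X t (-1)).
  by rewrite /Vm /=; under eq_fun do rewrite scaleN1r.
- by have := regular_cst X t 0; under eq_fun do rewrite scale0r.
move=> c /nV; apply: near_incr_sub => s s' s0 ss'.
suff -> : ito_error X dataV s s' = ito_error X dataVm s s' by [].
rewrite /ito_error /noise_incr /= !big_cons !big_nil /= /bracket !big_cons !big_nil /= ?big_cons ?big_nil ?eqxx /=.
rewrite !adj1 !mulr1 tau1 scale1r ?mul1r !adjZ conj_i conj_half /Vm.
rewrite -!scalerAl -!scalerAr ?scalerA !addr0.
rewrite scaleNr subrr subr0 -scalerDl mulrN -expr2 sqr_i opprK scale1r.
have -> : (- 2^-1 - 2^-1 : R[i]) = -1 by field.
by rewrite scaleN1r addNr scaler0 !subr0 opprB addrA subrK.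
Qed.

Let Vm_continuous t : 0 <= t -> norm_continuous t Vm.
Proof.
move=> t0; have cU := unitary_continuous hU t0.
apply: norm_continuousD (norm_continuousM cU (norm_continuous_adj cU)) _.
exact: norm_continuous_cst.
Qed.

(** With no noise and no drift, the square of [Vm] has constant trace, namely its initial value 0.
    As [Vm] is self-adjoint, faithfulness gives [Vm s = 0]. *)
Lemma unitary_mul_adj s : 0 <= s -> U s * adj (U s) = 1.
Proof.
have [U0 _ _ _] := hU; move=> s0.
have VV : tau (Vm s * Vm s) = 0.
  apply: (@tau_ode_zero 0 (fun s => Vm s * Vm s)) => //.
  - move=> t t0; have := is_ito_derive hX t0 (is_ito_mul hX (is_ito_V t0) (is_ito_V t0)).
    by rewrite /= mul0r mulr0 addr0 bracket_nill addr0 tau0 mul0r.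
  - by apply: norm_continuousM; exact: Vm_continuous.
  - by rewrite /Vm U0 adj1 mulr1 subrr mulr0.
have : Vm s = 0.
  by apply: tau_faithful; rewrite /Vm adjD adjN adjM adjK adj1.
by move=> /subr0_eq.
Qed.

(** Finiteness of a tracial algebra: the first relation makes [1 - adj (U s) * U s] a projection,
    and its trace is 0 by traciality. *)
Lemma unitary_adj_mul s : 0 <= s -> adj (U s) * U s = 1.
Proof.
move=> s0; have UU := unitary_mul_adj s0; apply: subr0_eq; apply: tau_faithful.
rewrite adjD adjN adjM adjK adj1 mulrBl mul1r mulrBr mulr1.
rewrite -(mulrA (adj (U s))) (mulrA (U s)) UU mul1r subrr sub0r.
by rewrite -scaleN1r tauZ tauB tau1 tauC UU tau1 subrr mulr0.
Qed.

Fixpoint ito_pow n : itoData A unit :=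
  if n is m.+1 then ito_mul (ito_pow m) data else ito_cst unit 1.

Let is_ito_pow t n : 0 < t -> is_ito X tt t (ito_pow n).
Proof.
move=> t0; elim: n => [|n IH] /=; first by rewrite -(scale1r 1); exact: is_ito_cst.
by apply: is_ito_mul => //; exact: is_ito_data.
Qed.

Let proc_pow n s : proc (ito_pow n) s = U s ^+ n.
Proof. by elim: n => [|n IH] //=; rewrite IH exprSr. Qed.

(** The factor [U s ^+ c] is there for the induction: each step moves one more [U] across the
    bracket by [bracket_mid]. *)
Let bracket_pow n c s : bracket (noise (ito_pow n)) (noise_mull (fun s => U s ^+ c) (noise data)) s
  = - \sum_(b < n) tau (U s ^+ (n - b + c)) *: U s ^+ b.+1.
Proof.
elim: n c => [|n IH] c; first by rewrite /= bracket_nill big_ord0 oppr0.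
have -> : noise (ito_pow n.+1) =
    noise_mulr (proc data) (noise (ito_pow n)) ++ noise_mull (proc (ito_pow n)) (noise data) by [].
rewrite bracket_catl bracket_mid.
have -> : noise_mull (proc data) (noise_mull (fun s => U s ^+ c) (noise data)) =
    noise_mull (fun s => U s ^+ c.+1) (noise data).
  by congr [:: (tt, (_, _))]; apply/funext => r /=; rewrite mulrA exprS.
rewrite IH bracket_mull proc_pow big_ord_recr /= opprD; congr (_ + _).
  congr (- _); apply: eq_bigr => b _; congr (tau (_ ^+ _) *: _).
  by rewrite addnS -addSn subSn // ltnW.
rewrite /bracket !big_cons !big_nil /= !addr0 mul1r mulr1 subSnn add1n.
rewrite -!scalerAr tauZ -exprSr scalerA mulrAC -expr2 sqr_i mulN1r scaleNr.
by rewrite -exprSr.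
Qed.

Let drift_pow n s : drift (ito_pow n) s = (- (n%:R / 2) : R[i]) *: U s ^+ n
  - \sum_(m < n) \sum_(b < m) tau (U s ^+ (m - b)) *: U s ^+ (b + (n - m)).
Proof.
elim: n => [|n IH] /=; first by rewrite big_ord0 mul0r oppr0 scale0r subr0.
have -> : bracket (noise (ito_pow n)) [:: (tt, (fun s0 => ('i%C : R[i]) *: U s0, fun=> 1))] s =
    bracket (noise (ito_pow n)) (noise_mull (fun s => U s ^+ 0) (noise data)) s.
  by congr (bracket _ [:: (tt, (_, _))] _); apply/funext => r /=; rewrite mul1r.
rewrite bracket_pow IH proc_pow mulrBl -scalerAl -scalerAr -exprSr big_ord_recr /= opprD addrA.
rewrite [X in X + _ = _]addrAC -scalerDl; congr (_ + _ + _).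
- by congr (_ *: _); rewrite -natr1; field.
- congr (- _); rewrite mulr_suml; apply: eq_bigr => m _; rewrite mulr_suml; apply: eq_bigr => b _.
  by rewrite -scalerAl -exprSr subSn ?addnS // ltnW.
- congr (- _); apply: eq_bigr => b _; rewrite addn0 subSnn addn1 //.
Qed.

Lemma tau_unitary_pow_derive n t : 0 < t ->
  is_complex_derive (fun s => tau (U s ^+ n)) t
    (- (n%:R / 2) * tau (U t ^+ n)
     - \sum_(m < n) \sum_(b < m) tau (U t ^+ (m - b)) * tau (U t ^+ (b + (n - m)))).
Proof.
move=> t0; have := is_ito_derive hX t0 (is_ito_pow n t0).
under eq_fun do rewrite proc_pow; rewrite drift_pow tauB tauZ tau_sum.
by under eq_bigr do [rewrite tau_sum; under eq_bigr do rewrite tauZ].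
Qed.

End UnitaryProcess.

Lemma is_complex_deriveB (R : realType) (f g : R -> R[i]) (t : R) (a b : R[i]) :
  is_complex_derive f t a -> is_complex_derive g t b ->
  is_complex_derive (fun s => f s - g s) t (a - b).
Proof.
move=> [f1 f2] [g1 g2]; split.
  by under eq_fun do rewrite ReD ReN; rewrite ReD ReN; exact: is_deriveB.
by under eq_fun do rewrite ImD ImN; rewrite ImD ImN; exact: is_deriveB.
Qed.

(** Strong induction: in the quadratic terms both exponents [m - b] and [b + (n - m)] are less than
    [n], so these terms agree and the difference of the moments solves [y' = - (n / 2) y] with
    [y 0 = 0]. *)
Lemma tau_unitary_pow_eq (R : realType) (A : tracialSpace R) (X U X' U' : R -> A) :
  free_additive_BM X -> free_unitary_BM X U -> free_additive_BM X' -> free_unitary_BM X' U' ->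
  forall n s, 0 <= s -> tau (U s ^+ n) = tau (U' s ^+ n).
Proof.
move=> hX hU hX' hU' n; have [N] := ubnP n; elim: N n => // N IH n; rewrite ltnS => nN s s0.
apply/eqP; rewrite -subr_eq0 -tauB; apply/eqP.
apply: (@tau_ode_zero _ _ (- (n%:R / 2)) (fun s => U s ^+ n - U' s ^+ n)) => //.
- move=> t t0; under eq_fun do rewrite tauB.
  have := is_complex_deriveB (tau_unitary_pow_derive hX hU n t0) (tau_unitary_pow_derive hX' hU' n t0).
  congr (is_complex_derive _ _ _).
  have -> : \sum_(m < n) \sum_(b < m) tau (U t ^+ (m - b)) * tau (U t ^+ (b + (n - m))) =
      \sum_(m < n) \sum_(b < m) tau (U' t ^+ (m - b)) * tau (U' t ^+ (b + (n - m))).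
    apply: eq_bigr => m _; apply: eq_bigr => b _.
    have t0' := ltW t0; congr (_ * _); apply: IH => //.
      by apply: leq_trans nN; apply: leq_ltn_trans (leq_subr _ _) _.
    apply: leq_trans nN.
    by rewrite -[X in (_ < X)%N](subnKC (ltnW (ltn_ord m))) ltn_add2r.
  rewrite opprB addrA subrK -mulrBr -tauB; congr (_ * _).
  by rewrite rmorphN rmorphM fmorphV !rmorph_nat.
- have pow_cont (V Y : R -> A) : free_unitary_BM Y V -> norm_continuous 0 (fun s => V s ^+ n).
    move=> hV; elim: (n) => [|m IHm]; first by under eq_fun do rewrite expr0; exact: norm_continuous_cst.
    under eq_fun do rewrite exprS.
    by apply: norm_continuousM => //; exact: unitary_continuous hV _ (lexx 0).
  have := norm_continuousD (pow_cont _ _ hU) (norm_continuousZ (-1) (pow_cont _ _ hU')).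
  by under eq_fun do rewrite scaleN1r.
- by have [-> _ _ _] := hU; have [-> _ _ _] := hU'; rewrite !expr1n subrr.
Qed.

(** * Exchangeability of free unitaries with equal moments *)

Section Exchangeability.
Variables (R : realType) (A : tracialSpace R) (I : eqType) (G : I -> set A) (u : I -> A) (p : I -> I).
Hypothesis G_free : star_free G.
Hypothesis u_in : forall i, star_generated (G i) (u i).
Hypothesis u_unitary : forall i, u i * adj (u i) = 1 /\ adj (u i) * u i = 1.
Hypothesis u_moments : forall i j n, tau (u i ^+ n) = tau (u j ^+ n).
Hypothesis p_inj : injective p.
Local Notation B i := (star_generated (G i)).

Let B_ssub i : star_subalgebra (B i).
Proof. exact: star_generated_star_subalgebra. Qed.

Definition unitary_pow (a : A) (b : bool) n := (if b then adj a else a) ^+ n.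

Lemma expM_cancel (K : nzRingType) (a c : K) n m : a * c = 1 -> c * a = 1 ->
  a ^+ n * c ^+ m = if (m <= n)%N then a ^+ (n - m) else c ^+ (m - n).
Proof.
move=> ac ca; have cancel q : a ^+ q * c ^+ q = 1.
  by rewrite -exprMn_comm ?ac ?expr1n // /GRing.comm ac ca.
case: leqP => [mn|/ltnW nm].
  by rewrite -{1}(subnK mn) exprD -mulrA cancel mulr1.
by rewrite -{1}(subnKC nm) exprD mulrA cancel mul1r.
Qed.

(** The resulting exponent is uniform in [i]; this makes the relation [laurent] compatible with
    products. *)
Lemma unitary_pow_mul b n c m : exists b' n', forall i,
  unitary_pow (u i) b n * unitary_pow (u i) c m = unitary_pow (u i) b' n'.
Proof.
have [<-|bc] := eqVneq b c.
  by exists b, (n + m)%N => i; rewrite /unitary_pow exprD.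
exists (if (m <= n)%N then b else c), (if (m <= n)%N then n - m else m - n)%N => i.
have [u1 u2] := u_unitary i.
rewrite /unitary_pow; case: b c bc => -[] // _; rewrite expM_cancel //.
all: by case: leqP.
Qed.

(* A relation and not a function, because a Laurent polynomial in u i does not
   determine its coefficients. *)
Inductive laurent (i : I) : A -> A -> Prop :=
| LaurentPow b n : laurent i (unitary_pow (u i) b n) (unitary_pow (u (p i)) b n)
| LaurentLin (c : R[i]) x x' y y' of laurent i x x' & laurent i y y' :
    laurent i (c *: x + y) (c *: x' + y').

Lemma laurent0 i : laurent i 0 0.
Proof.
have := @LaurentLin i (-1) _ _ _ _ (LaurentPow i false 0) (LaurentPow i false 0).
by rewrite !scaleN1r !addNr.
Qed.

Lemma laurent_mul i x x' y y' : laurent i x x' -> laurent i y y' ->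
  laurent i (x * y) (x' * y').
Proof.
move=> Lx; elim: Lx y y' => [b n|c a a' d d' _ IHa _ IHd] y y' Ly; last first.
  by rewrite !mulrDl -!scalerAl; apply: LaurentLin; [exact: IHa|exact: IHd].
elim: Ly => [b' m|c a a' d d' _ IHa _ IHd].
  have [b0 [n0 E]] := unitary_pow_mul b n b' m; rewrite !E; exact: LaurentPow.
by rewrite !mulrDr -!scalerAr; exact: LaurentLin.
Qed.

Lemma laurent_in i x x' : laurent i x x' -> B i x /\ B (p i) x'.
Proof.
elim=> [b n|c a a' d d' _ [Ba Ba'] _ [Bd Bd']].
  have Bu h : B h (if b then adj (u h) else u h).
    by case: b; [apply: (ssub_adj (B_ssub h)); exact: u_in|exact: u_in].
  by split; [exact: (ssubX (B_ssub i))|exact: (ssubX (B_ssub (p i)))].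
by split; apply: (ssubD (B_ssub _)) => //; exact: (ssubZ (B_ssub _)).
Qed.

Lemma laurent_tau i x x' : laurent i x x' -> tau x = tau x'.
Proof.
elim=> [b n|c a a' d d' _ IHa _ IHd]; last by rewrite !tauD !tauZ IHa IHd.
have adjX a : adj a ^+ n = adj (a ^+ n) :> A.
  by elim: n => [|n IH]; rewrite ?expr0 ?adj1 // exprS IH exprSr adjM.
by rewrite /unitary_pow; case: b; rewrite ?adjX ?tau_adj (u_moments i (p i)).
Qed.

Lemma laurent_centered i x x' : laurent i x x' -> laurent i (centered x) (centered x').
Proof.
move=> L; have -> : centered x = - tau x *: (1 : A) + x by rewrite scaleNr addrC.
have -> : centered x' = - tau x *: (1 : A) + x' by rewrite (laurent_tau L) scaleNr addrC.
by apply: LaurentLin => //; rewrite -(expr0 (u i)) -[X in laurent _ _ X](expr0 (u (p i))); exact: (LaurentPow i false 0).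
Qed.

Local Notation pair_mul := (fun x y : A * A => (x.1 * y.1, x.2 * y.2)).
Local Notation pair_cen := (fun x : A * A => (centered x.1, centered x.2)).
Definition pair_add (x y : A * A) := (x.1 + y.1, x.2 + y.2).
Definition laurent_pair i (x : A * A) := laurent i x.1 x.2.

(** Letters are pairs so that both words are reduced in parallel. Means agree by [laurent_tau], and
    on alternating centered words both traces vanish, injectivity of [p] keeping the second word
    alternating. *)
Lemma tau_exchange (l : seq (A * A)) : allP (letter_sum laurent_pair pair_add) l ->
  tau (\prod_(x <- l) x.1) = tau (\prod_(x <- l) x.2).
Proof.
apply: (@free_induction_sum I _ pair_mul pair_cen laurent_pair
  (fun x => tau x.1 = 0 /\ tau x.2 = 0) (fun l => tau (\prod_(x <- l) x.1) = tau (\prod_(x <- l) x.2))).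
- by move=> i x y; exact: laurent_mul.
- move=> i x Lx; split; first exact: laurent_centered.
  by split; exact: tau_centered.
- by move=> l1 x y l2; rewrite !big_cat !big_cons /= !mulrA.
- move=> i l1 x l2 /laurent_tau xx; rewrite !big_cat !big_cons /= => H1 H2.
  by rewrite (tau_center_split _ x.1) (tau_center_split _ x.2) H1 H2 xx.
- case=> [|x v] sv Av; first by rewrite !big_nil.
  rewrite !big_map.
  have t1 : tau (\prod_(y <- [seq (y.1, y.2.1) | y <- x :: v]) y.2) = 0.
    apply: (tau_free_word G_free) => //; split; first by rewrite -map_comp.
    elim: (x :: v) Av => //= y v' IH [[/laurent_in[? ?] [? ?]] /IH]; split=> //.
  have t2 : tau (\prod_(y <- [seq (p y.1, y.2.2) | y <- x :: v]) y.2) = 0.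
    apply: (tau_free_word G_free) => //; split.
      rewrite -map_comp (map_comp p fst) sorted_map.
      by apply: sub_sorted sv => i j /=; rewrite /alternating (inj_eq p_inj).
    elim: (x :: v) Av => //= y v' IH [[/laurent_in[? ?] [? ?]] /IH]; split=> //.
  by rewrite !big_map /= in t1 t2; rewrite t1 t2.
- move=> l1 x y l2; rewrite !big_cat !big_cons /= => H1 H2.
  by rewrite !mulrDl !mulrDr !tauD H1 H2.
Qed.

End Exchangeability.

(** * The sum of free unitary Brownian motions *)

Section FreeUnitarySum.
Variables (R : realType) (A : tracialSpace R) (k : nat) (X U : 'I_k -> R -> A).
Hypothesis k0 : (0 < k)%N.
Hypothesis hX : forall j, free_additive_BM (X j).
Hypothesis hU : forall j, free_unitary_BM (X j) (U j).
Hypothesis U_free : star_free (fun j : 'I_k => U j @` [set s | 0 <= s]).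
Variable t : R.
Hypothesis t0 : 0 < t.
Local Notation I := 'I_k.
Local Notation ito := (itoData A I).
Local Notation G := (Gsum U).
Local Notation H := (fun s => adj (Gsum U s)).
Local Notation W := (Wprod U).
Local Notation m := (fun n => tau (W t ^+ n)).
Implicit Types (j : I) (F : I -> ito).

Let ranges j : set A := U j @` [set s | 0 <= s].

Let U_in j s : 0 <= s -> star_generated (ranges j) (U j s).
Proof. by move=> s0; apply: sub_star_generated; exists s. Qed.

Let UUa j : U j t * adj (U j t) = 1.
Proof. exact: unitary_mul_adj (hX j) (hU j) _ (ltW t0). Qed.

Let UaU j : adj (U j t) * U j t = 1.
Proof. exact: unitary_adj_mul (hX j) (hU j) _ (ltW t0). Qed.

Let u j : ito := ito_unitary j (U j).

Let free_u j : free_ito t X ranges j (u j).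
Proof.
have B := star_generated_star_subalgebra (ranges j).
split; first exact: (is_ito_unitary _ (hX j) t0 (hU j)).
split=> /= [s s0||]; first exact: U_in.
  split=> //; split=> //; last exact: (ssub1 B).
  by apply: (ssubZ B); apply: U_in; exact: ltW.
by apply: (ssubZ B); apply: U_in; exact: ltW.
Qed.

Definition ito_sum F := foldr (fun j => ito_add (F j)) (ito_cst I 0) (enum I).

Lemma ito_sum_letters F : (forall j, free_ito t X ranges j (F j)) ->
  letter_sum (free_ito t X ranges) (@ito_add R A I) (ito_sum F).
Proof.
move=> fF; rewrite /ito_sum; elim: (enum I) => [|j l IH] /=.
  (* The constant 0 that ends the fold must belong to some index, hence the need for [0 < k]. *)
  by apply: (@LetterSum1 _ _ _ _ (Ordinal k0)); rewrite -(scale0r 1); exact: free_ito_cst.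
by apply: LetterSumD => //; exact: LetterSum1 (fF j).
Qed.

Lemma proc_ito_sum F s : proc (ito_sum F) s = \sum_j proc (F j) s.
Proof.
rewrite -big_enum /ito_sum; elim: (enum I) => [|j l IH] /=; first by rewrite big_nil.
by rewrite big_cons IH.
Qed.

Lemma drift_ito_sum F s : drift (ito_sum F) s = \sum_j drift (F j) s.
Proof.
rewrite -big_enum /ito_sum; elim: (enum I) => [|j l IH] /=; first by rewrite big_nil.
by rewrite big_cons IH.
Qed.

Lemma noise_ito_sum F (p q : I -> R -> A) : (forall j, noise (F j) = [:: (j, (p j, q j))]) ->
  noise (ito_sum F) = [seq (j, (p j, q j)) | j <- enum I].
Proof. by move=> FE; rewrite /ito_sum; elim: (enum I) => //= j l ->; rewrite FE. Qed.

Lemma bracket_ord (p q p' q' : I -> R -> A) s :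
  bracket [seq (j, (p j, q j)) | j <- enum I] [seq (j, (p' j, q' j)) | j <- enum I] s =
  \sum_j tau (q j s * p' j s) *: (p j s * q' j s).
Proof.
rewrite /bracket big_map big_enum; apply: eq_bigr => j _ /=.
rewrite big_map big_enum_cond /= (eq_bigl (pred1 j)) ?big_pred1_eq // => i; rewrite eq_sym.
Qed.

Let gG := ito_sum u.
Let gH := ito_sum (fun j => ito_adj (u j)).
Let gW := ito_mul gG gH.

Let proc_gG s : proc gG s = G s. Proof. exact: proc_ito_sum. Qed.
Let proc_gH s : proc gH s = H s. Proof. by rewrite proc_ito_sum /Gsum adj_sum. Qed.
Let proc_gW s : proc gW s = W s. Proof. by rewrite /gW /= proc_gG proc_gH. Qed.

Let noise_gG : noise gG = [seq (j, (fun s => ('i%C : R[i]) *: U j s, fun=> 1)) | j <- enum I].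
Proof. exact: noise_ito_sum. Qed.

Let noise_gH : noise gH =
  [seq (j, (fun=> adj 1, fun s => adj (('i%C : R[i]) *: U j s))) | j <- enum I].
Proof. exact: noise_ito_sum. Qed.

Fixpoint ito_wpow n : ito := if n is n'.+1 then ito_mul (ito_wpow n') gW else ito_cst I 1.

Let proc_wpow n s : proc (ito_wpow n) s = W s ^+ n.
Proof. by elim: n => [|n IH] //=; rewrite IH proc_gG proc_gH exprSr. Qed.

Lemma ito_wpow_derive n :
  is_complex_derive (fun s => tau (W s ^+ n)) t (tau (drift (ito_wpow n) t)).
Proof.
(* W^n as a word of [2 n] letters, each of them a sum over the indices. *)
pose l n := iter n (fun l => l ++ [:: gG; gH]) [::].
have lE : prod_ito (l n) = ito_wpow n.
  elim: n => [|n IH]; first by rewrite /prod_ito big_nil.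
  rewrite /= prod_ito_cat_cons /= IH; congr ito_mul.
  by rewrite /prod_ito big_seq1.
have := @prod_ito_derive _ _ _ t X ranges hX U_free t0 (l n); rewrite lE.
under eq_fun do rewrite proc_wpow; apply.
elim: n {lE} => // n IH; apply/allP_cat; split=> //=; do !split; apply: ito_sum_letters => //.
by move=> j; exact: free_ito_adj.
Qed.

Let bracket_wpow n c s : bracket (noise (ito_wpow n)) (noise_mull (fun s => W s ^+ c) (noise gW)) s
  = \sum_(b < n) W s ^+ (n - b.+1) *
      bracket (noise gW) (noise_mull (fun s => W s ^+ (b + c)) (noise gW)) s.
Proof.
elim: n c => [|n IH] c; first by rewrite /= bracket_nill big_ord0.
have -> : noise (ito_wpow n.+1) =
    noise_mulr (proc gW) (noise (ito_wpow n)) ++ noise_mull (proc (ito_wpow n)) (noise gW) by [].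
rewrite bracket_catl bracket_mid.
have -> : noise_mull (proc gW) (noise_mull (fun s => W s ^+ c) (noise gW)) =
    noise_mull (fun s => W s ^+ c.+1) (noise gW).
  rewrite /noise_mull -map_comp; apply: eq_map => -[i [p q]] /=; congr (_, (_, _)).
  by apply/funext => r; rewrite -/(proc gW r) proc_gG proc_gH mulrA exprS.
rewrite IH bracket_mull proc_wpow big_ord_recl addrC subSS subn0 add0n; congr (_ + _).
by apply: eq_bigr => b _; rewrite /= /bump /= add1n subSS addnS addSn.
Qed.

Let drift_wpow n s : drift (ito_wpow n) s = \sum_(i < n)
  (W s ^+ i * drift gW s + bracket (noise (ito_wpow i)) (noise gW) s) * W s ^+ (n - i.+1).
Proof.
elim: n => [|n IH]; first by rewrite big_ord0.
have -> : drift (ito_wpow n.+1) s = drift (ito_wpow n) s * proc gW s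
    + proc (ito_wpow n) s * drift gW s + bracket (noise (ito_wpow n)) (noise gW) s by [].
rewrite proc_gW proc_wpow big_ord_recr subnn expr0 mulr1 IH mulr_suml -addrA; congr (_ + _).
by apply: eq_bigr => i _; rewrite -mulrA -exprSr -(subSn (ltn_ord i)).
Qed.

Let kappa b c := tau (W t ^+ c * bracket (noise gW) (noise_mull (fun s => W s ^+ b) (noise gW)) t).

(** By traciality the [n] first-order terms are equal, and a second-order term depends only on the
    numbers of factors W on the two arcs between the chosen factors: [b] and [n - b - 2]. *)
Lemma tau_drift_wpow n : tau (drift (ito_wpow n) t) =
  n%:R * tau (W t ^+ n.-1 * drift gW t)
  + \sum_(i < n) \sum_(b < i) kappa b (n - b.+2).
Proof.
rewrite drift_wpow tau_sum.
under eq_bigr do rewrite mulrDl tauD.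
rewrite big_split; congr (_ + _).
  rewrite -[in RHS](card_ord n) mulr_natl -sumr_const; apply: eq_bigr => i _.
  rewrite tauC mulrA -exprD; congr (tau (_ ^+ _ * _)).
  by have := ltn_ord i; rewrite card_ord; lia.
apply: eq_bigr => i _.
have e0 : noise_mull (fun s => W s ^+ 0) (noise gW) = noise gW.
  rewrite -[RHS]map_id; apply: eq_map => -[j [p q]]; congr (_, (_, _)).
  by apply/funext => r /=; rewrite mul1r.
rewrite -[X in bracket _ X]e0 bracket_wpow mulr_suml tau_sum; apply: eq_bigr => b _.
rewrite /kappa tauC mulrA -exprD addn0; congr (tau (_ ^+ _ * _)).
by have := ltn_ord i; have := ltn_ord b; lia.
Qed.

Let ii : ('i%C : R[i]) * (- 'i%C) = 1.
Proof. by rewrite mulrN -expr2 sqr_i opprK. Qed.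

Let drift_gW : drift gW t = k%:R *: 1 - W t.
Proof.
have -> : drift gW t = drift gG t * proc gH t + proc gG t * drift gH t
    + bracket (noise gG) (noise gH) t by [].
rewrite proc_gG proc_gH !drift_ito_sum noise_gG noise_gH bracket_ord /=.
have -> : \sum_j (- 2^-1 : R[i]) *: U j t = (- 2^-1 : R[i]) *: G t by rewrite scaler_sumr.
have -> : \sum_j adj ((- 2^-1 : R[i]) *: U j t) = (- 2^-1 : R[i]) *: H t.
  by rewrite /Gsum adj_sum scaler_sumr; apply: eq_bigr => j _; rewrite adjZ conj_half.
rewrite -scalerAl -scalerAr -scalerDl.
have -> : (- 2^-1 + - 2^-1 : R[i]) = -1 by field.
rewrite scaleN1r addrC; congr (_ - _).
rewrite -[in RHS](card_ord k) scaler_nat -sumr_const; apply: eq_bigr => j _.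
by rewrite adj1 mulr1 tau1 scale1r adjZ conj_i -scalerAl -scalerAr scalerA ii scale1r UUa.
Qed.

Let alpha b j := tau (H t * W t ^+ b * U j t).

Let W_sa : adj (W t) = W t.
Proof. by rewrite /Wprod adjM adjK. Qed.

Let Wn_sa n : adj (W t ^+ n) = W t ^+ n.
Proof. by elim: n => [|n IH]; [rewrite adj1|rewrite {1}exprS adjM IH W_sa exprSr]. Qed.

Let m_conj n : ((m n)^*)%C = m n.
Proof. by rewrite -tau_adj Wn_sa. Qed.

Let HWG b : tau (H t * W t ^+ b * G t) = m b.+1.
Proof. by rewrite -mulrA tauC -mulrA -exprSr. Qed.

Let GWH b : tau (W t ^+ b * G t * H t) = m b.+1.
Proof. by rewrite -mulrA -exprSr. Qed.

Let alpha_eq b i j : alpha b i = alpha b j.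
Proof.
have u_mom i' j' n : tau (U i' t ^+ n) = tau (U j' t ^+ n).
  exact: (tau_unitary_pow_eq (hX i') (hU i') (hX j') (hU j') n (ltW t0)).
pose lt := laurent_pair (fun j => U j t) (tperm i j).
have ex l : allP (letter_sum lt (@pair_add R A)) l ->
    tau (\prod_(x <- l) x.1) = tau (\prod_(x <- l) x.2).
  apply: (tau_exchange U_free) => //; last exact: perm_inj.
  by move=> h; apply: U_in; exact: ltW.
pose ls := letter_sum lt (@pair_add R A).
have LU h : lt h (U h t, U (tperm i j h) t).
  by have := LaurentPow (fun j => U j t) (tperm i j) h false 1; rewrite /unitary_pow !expr1.
have LH h : lt h (adj (U h t), adj (U (tperm i j h) t)).
  by have := LaurentPow (fun j => U j t) (tperm i j) h true 1; rewrite /unitary_pow !expr1.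
have Lsum (f : I -> A) : (forall h, lt h (f h, f (tperm i j h))) -> ls (\sum_h f h, \sum_h f h).
  (* The transposition only permutes the summands, so G and its adjoint are paired with
     themselves. *)
  move=> Lf; rewrite [X in (_, X)](reindex_inj (@perm_inj _ (tperm i j))) /=.
  rewrite -!big_enum /=; elim: (enum I) => [|h l IH].
    rewrite !big_nil; apply: (@LetterSum1 _ _ _ _ (Ordinal k0)); exact: laurent0.
  by rewrite !big_cons; apply: (LetterSumD (LetterSum1 _ (Lf h)) IH).
pose l := (H t, H t) :: flatten (nseq b [:: (G t, G t); (H t, H t)]) ++ [:: (U i t, U j t)].
have lG : ls (G t, G t) by exact: Lsum.
have lH : ls (H t, H t) by rewrite /Gsum adj_sum; exact: Lsum.
have := ex l.
have prodl (pr : A * A -> A) : pr (G t, G t) = G t -> pr (H t, H t) = H t ->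
    \prod_(x <- l) pr x = H t * W t ^+ b * pr (U i t, U j t).
  move=> prG prH; rewrite /l big_cons prH big_cat big_seq1 mulrA; congr (_ * _ * _).
  elim: b {l} => [|b IH]; first by rewrite big_nil.
  by rewrite /= !big_cons prG prH IH exprS mulrA.
rewrite !prodl //; apply; split=> //; apply/allP_cat; split.
  by elim: b {l prodl} => //= b IH.
split=> //; apply: (@LetterSum1 _ _ _ _ i).
by have := LU i; rewrite tpermL.
Qed.

Let alphaE b j : alpha b j = m b.+1 / k%:R.
Proof.
have kn : k%:R != 0 :> R[i] by rewrite pnatr_eq0 -lt0n.
apply: (canRL (mulfK kn)); rewrite -HWG /Gsum mulr_sumr tau_sum.
rewrite mulrC -[in LHS](card_ord k) mulr_natl -sumr_const.
by apply: eq_bigr => i _; exact: alpha_eq.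
Qed.

Let beta_eq b j : tau (adj (U j t) * (W t ^+ b * G t)) = m b.+1 / k%:R.
Proof.
have -> : adj (U j t) * (W t ^+ b * G t) = adj (H t * W t ^+ b * U j t).
  by rewrite !adjM adjK Wn_sa.
rewrite tau_adj -/(alpha b j) alphaE rmorphM [X in X * _]m_conj; congr (_ * _).
by apply: (etrans (conjc_inv _)); rewrite conjc_nat.
Qed.

(** In each of the two chosen factors W the noise comes from G or from its adjoint. The two mixed
    choices use unitarity and give [m b.+1 * m c] and [m b * m c.+1]; the two equal choices each
    give [i^2 / k^2] times [m b.+1 * m c.+1]. *)
Let noise_term b c j (i := 'i%C : R[i]) :
  tau (H t * (W t ^+ b * (i *: U j t))) * tau (W t ^+ c * (i *: U j t * H t))
  + tau (H t * (W t ^+ b * G t)) * tau (W t ^+ c * (i *: U j t * (- i *: adj (U j t))))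
  + (tau (- i *: adj (U j t) * (W t ^+ b * (i *: U j t))) * tau (W t ^+ c * (G t * H t))
  + tau (- i *: adj (U j t) * (W t ^+ b * G t)) * tau (W t ^+ c * (G t * (- i *: adj (U j t)))))
  = m b.+1 * m c + m b * m c.+1 - 2 / k%:R ^+ 2 * (m b.+1 * m c.+1).
Proof.
have kn : k%:R != 0 :> R[i] by rewrite pnatr_eq0 -lt0n.
have E1 : tau (H t * (W t ^+ b * (i *: U j t))) = i * (m b.+1 / k%:R).
  by rewrite -!scalerAr tauZ mulrA -/(alpha b j) alphaE.
have E1' : tau (W t ^+ c * (i *: U j t * H t)) = i * (m c.+1 / k%:R).
  by rewrite -scalerAl -scalerAr tauZ mulrA tauC mulrA -/(alpha c j) alphaE.
have E2 : tau (H t * (W t ^+ b * G t)) = m b.+1 by rewrite mulrA HWG.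
have E2' : tau (W t ^+ c * (i *: U j t * (- i *: adj (U j t)))) = m c.
  by rewrite -scalerAl -!scalerAr scalerA ii scale1r UUa mulr1.
have E3 : tau (- i *: adj (U j t) * (W t ^+ b * (i *: U j t))) = m b.
  by rewrite -scalerAl -!scalerAr scalerA mulrC ii scale1r tauC -mulrA UUa mulr1.
have E3' : tau (W t ^+ c * (G t * H t)) = m c.+1 by rewrite mulrA GWH.
have E4 : tau (- i *: adj (U j t) * (W t ^+ b * G t)) = - i * (m b.+1 / k%:R).
  by rewrite -scalerAl tauZ beta_eq.
have E4' : tau (W t ^+ c * (G t * (- i *: adj (U j t)))) = - i * (m c.+1 / k%:R).
  by rewrite -!scalerAr tauZ mulrA tauC beta_eq.
rewrite E1 E1' E2 E2' E3 E3' E4 E4'.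
move: (m b.+1) (m c.+1) (m b) (m c) => p q r s.
have i2 : i ^+ 2 = -1 by exact: sqr_i.
have -> : i * (p / k%:R) * (i * (q / k%:R)) + p * s + (r * q + - i * (p / k%:R) * (- i * (q / k%:R)))
  = p * s + r * q + 2 * i ^+ 2 / k%:R ^+ 2 * (p * q) by field.
by rewrite i2; field.
Qed.

Let kappaE b c : kappa b c =
  k%:R * (m b.+1 * m c + m b * m c.+1) - 2 / k%:R * (m b.+1 * m c.+1).
Proof.
have kn : k%:R != 0 :> R[i] by rewrite pnatr_eq0 -lt0n.
have nW : noise gW = [seq (j, (fun s => ('i%C : R[i]) *: U j s, fun s => 1 * proc gH s)) | j <- enum I]
   ++ [seq (j, (fun s => proc gG s * adj 1, fun s => adj (('i%C : R[i]) *: U j s))) | j <- enum I].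
  have -> : noise gW = noise_mulr (proc gH) (noise gG) ++ noise_mull (proc gG) (noise gH) by [].
  by rewrite noise_gG noise_gH /noise_mulr /noise_mull -!map_comp.
rewrite /kappa nW.
have -> : noise_mull (fun s => W s ^+ b)
    ([seq (j, (fun s => ('i%C : R[i]) *: U j s, fun s => 1 * proc gH s)) | j <- enum I]
   ++ [seq (j, (fun s => proc gG s * adj 1, fun s => adj (('i%C : R[i]) *: U j s))) | j <- enum I]) =
   [seq (j, (fun s => W s ^+ b * (('i%C : R[i]) *: U j s), fun s => 1 * proc gH s)) | j <- enum I]
   ++ [seq (j, (fun s => W s ^+ b * (proc gG s * adj 1), fun s => adj (('i%C : R[i]) *: U j s))) | j <- enum I].
  by rewrite /noise_mull map_cat -!map_comp.
rewrite !bracket_catl !bracket_catr !bracket_ord -!big_split /= mulr_sumr tau_sum.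
transitivity (\sum_(j < k) (m b.+1 * m c + m b * m c.+1 - 2 / k%:R ^+ 2 * (m b.+1 * m c.+1))).
  apply: eq_bigr => j _; rewrite adj1 !mul1r !mulr1 proc_gG proc_gH adjZ conj_i -(noise_term b c j).
  by rewrite !mulrDr !tauD -!(scalerAr (tau _)) !(tauZ (tau _)).
by rewrite sumr_const card_ord -mulr_natl; field.
Qed.

(** The partial sums up to [i] and up to [N - i] complement each other, by the symmetry of [f]. *)
Lemma double_sum_sym (f : nat -> R[i]) N : (forall b, (b < N)%N -> f (N - b.+1)%N = f b) ->
  2 * \sum_(i < N.+1) \sum_(b < i) f b = N.+1%:R * \sum_(b < N) f b.
Proof.
move=> fsym; pose F i := \sum_(0 <= b < i) f b.
have FF i : (i <= N)%N -> F i + F (N - i)%N = F N.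
  move=> iN; rewrite /F [RHS](@big_cat_nat _ _ _ i) //=; congr (_ + _).
  rewrite [RHS]big_nat_rev [RHS](big_addn 0) /= big_nat [RHS]big_nat.
  apply: eq_bigr => b /andP[_ bN]; rewrite -fsym; last by lia.
  by congr f; lia.
have -> : \sum_(i < N.+1) \sum_(b < i) f b = \sum_(0 <= i < N.+1) F i.
  by rewrite big_mkord; apply: eq_bigr => i _; rewrite /F big_mkord.
rewrite mulr2n mulrDl mul1r [X in _ + X]big_nat_rev -big_split /= big_nat.
rewrite (eq_bigr (fun=> F N)); last first.
  by move=> i /andP[_ iN]; rewrite add0n subSS FF.
by rewrite -big_nat big_const_nat subn0 iter_addr_0 mulr_natl /F big_mkord.
Qed.

Lemma tau_Wprod_derive N :
  is_complex_derive (fun s => tau (W s ^+ N.+1)) t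
   (N.+1%:R * (k%:R * m N - m N.+1
     + \sum_(0 <= b < N) m (N - b)%N * (k%:R * m b - m b.+1 / k%:R))).
Proof.
have := ito_wpow_derive N.+1; congr (is_complex_derive _ _ _).
rewrite tau_drift_wpow drift_gW mulrBr -exprSr -scalerAr mulr1 tauB tauZ.
rewrite [RHS]mulrDr; congr (_ + _).
have kn : k%:R != 0 :> R[i] by rewrite pnatr_eq0 -lt0n.
have two0 : 2 != 0 :> R[i] by rewrite pnatr_eq0.
pose f b := kappa b (N - b.+1).
have fsym b : (b < N)%N -> f (N - b.+1)%N = f b.
  move=> bN; rewrite /f; have -> : (N - (N - b.+1).+1 = b)%N by lia.
  rewrite !kappaE; move: (m _) (m _) (m _) (m _) => *; ring.
(* Doubling avoids a division by 2 when the double sum is folded into [N.+1] copies of a single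
   sum. *)
apply: (mulfI two0).
transitivity (2 * \sum_(i < N.+1) \sum_(b < i) f b).
  by congr (_ * _); apply: eq_bigr => i _; apply: eq_bigr => b _; rewrite /f subSS.
rewrite double_sum_sym // mulrCA; congr (_ * _).
rewrite -(big_mkord xpredT f).
(* Reversing the index identifies the two terms of [kappa] with coefficient [k], so the factor 2
   also appears on this side. *)
have e1 : \sum_(0 <= b < N) m b.+1 * m (N - b.+1)%N = \sum_(0 <= b < N) m (N - b)%N * m b.
  rewrite big_nat_rev big_nat [RHS]big_nat; apply: eq_bigr => b /andP[_ bN].
  by rewrite add0n; congr (m _ * m _); lia.
have -> : \sum_(0 <= b < N) f b = k%:R * \sum_(0 <= b < N) m b.+1 * m (N - b.+1)%N
   + k%:R * \sum_(0 <= b < N) m (N - b)%N * m b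
   - 2 / k%:R * \sum_(0 <= b < N) m (N - b)%N * m b.+1.
  rewrite !mulr_sumr -big_split -sumrB big_nat [RHS]big_nat; apply: eq_bigr => b /andP[_ bN].
  rewrite /f kappaE; have -> : (N - b.+1).+1 = (N - b)%N by lia.
  by rewrite /=; field.
rewrite e1; have -> : \sum_(0 <= b < N) m (N - b)%N * (k%:R * m b - m b.+1 / k%:R) =
   k%:R * (\sum_(0 <= b < N) m (N - b)%N * m b) - (\sum_(0 <= b < N) m (N - b)%N * m b.+1) / k%:R.
  by rewrite mulr_sumr mulr_suml -sumrB; apply: eq_bigr => b _; field.
by field.
Qed.

End FreeUnitarySum.

Lemma momentE (R : realType) (A : tracialSpace R) (k : nat) (U : 'I_k -> R -> A) n s :
  moment U n s = (k%:R ^+ 2)^-1 ^+ n * tau (Wprod U s ^+ n).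
Proof. by rewrite /moment exprZn tauZ. Qed.

Theorem corollary1 (R : realType) (A : tracialSpace R) (k : nat) (hk : (2 <= k)%N)
    (X U : 'I_k -> R -> A)
    (hX : forall j, free_additive_BM (X j))
    (hU : forall j, free_unitary_BM (X j) (U j))
    (hXfree : star_free (fun j : 'I_k => X j @` [set s | 0 <= s]))
    (hUfree : star_free (fun j : 'I_k => U j @` [set s | 0 <= s]))
    (n : nat) (hn : (1 <= n)%N) (t : R) (ht : 0 < t) :
  is_complex_derive (moment U n) t
    (- (n%:R * moment U n t)
     + n%:R / k%:R * moment U n.-1 t
     + n%:R / k%:R *
       \sum_(0 <= j < n.-1)
          moment U (n - j - 1) t * (moment U j t - moment U j.+1 t)).
Proof.
case: n hn => // N _.
have k0 : (0 < k)%N by exact: ltnW.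
have kn : k%:R != 0 :> R[i] by rewrite pnatr_eq0 -lt0n.
have dW := tau_Wprod_derive k0 hX hU hUfree ht N.
pose c : R[i] := (k%:R ^+ 2)^-1 ^+ N.+1.
have := is_complex_deriveM (is_complex_derive0 (f := fun=> c) ht (fun _ _ => erefl)) dW.
rewrite mul0r add0r.
have -> : moment U N.+1 = (fun s => c * tau (Wprod U s ^+ N.+1)).
  by apply/funext => s; rewrite momentE.
congr (is_complex_derive _ _ _).
(* The products with [r_(j+1)] carry the factor [c], those with [r_j] carry [k^2 c]; taking out
   [k c] leaves the weights [1 / k] and [k] of [tau_Wprod_derive]. *)
have -> : \sum_(0 <= j < N.+1.-1)
    moment U (N.+1 - j - 1) t * (moment U j t - moment U j.+1 t) =
    k%:R * c * \sum_(0 <= j < N) tau (Wprod U t ^+ (N - j)) *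
      (k%:R * tau (Wprod U t ^+ j) - tau (Wprod U t ^+ j.+1) / k%:R).
  rewrite mulr_sumr big_nat [RHS]big_nat; apply: eq_bigr => j /andP[_ jN].
  have -> : (N.+1 - j - 1 = N - j)%N by lia.
  rewrite !momentE /c.
  have -> : ((k%:R ^+ 2)^-1 : R[i]) ^+ N.+1 = (k%:R ^+ 2)^-1 ^+ (N - j) * (k%:R ^+ 2)^-1 ^+ j.+1.
    by rewrite -exprD; congr (_ ^+ _); lia.
  rewrite (exprS (k%:R ^+ 2)^-1 j).
  move: (tau (_ ^+ (N - j))) (tau (_ ^+ j)) (tau (_ ^+ j.+1)) => x y z.
  move: (_ ^+ (N - j)) (_ ^+ j) => u v.
  by field.
rewrite !momentE /c /= (exprS (k%:R ^+ 2)^-1 N).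
move: (\sum_(_ <= _ < _) _) => S.
move: (tau _) (tau _) ((k%:R ^+ 2)^-1 ^+ N) => x y u.
by field.
Qed.
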